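(* Assume the setting of case (a) or case (b) in the context, with $Q=Q(P)=\mathcal{L}(X_1-X_2)\in\mathcal{Q}$, and let $J=J_Q$, $H_1(x):=\mathbb{E}J(x-X_1)$, $H_2(x,y):=J(x-y)-H_1(x)-H_1(y)$. Fix an integer $d\ge1$. Let $\Pi^{(1)},\dots,\Pi^{(d)}$ be independent random permutations of $\{1,\dots,n\}$, each uniformly distributed, independent of $(X_i)_{i\ge1}$, and let $\hat Q^{(\ell)}_{n,1}:=n^{-1}\sum_{i=1}^n\delta^{\rm s}_{X_{\Pi^{(\ell)}(i+1)}-X_{\Pi^{(\ell)}(i)}}$ with $\Pi^{(\ell)}(n+1):=\Pi^{(\ell)}(1)$. Then for each $1\le\ell\le d$, \[ \boldsymbol{\Sigma}(\hat Q^{(\ell)}_{n,1})=\boldsymbol{\Sigma}(Q)+2\int H_1\,d\hat P_n+M^{(\ell)}_{n,1}+o_p(n^{-1/2}),\quad M^{(\ell)}_{n,1}:=n^{-1}\sum_{i=1}^nH_2(X_{\Pi^{(\ell)}(i)},X_{\Pi^{(\ell)}(i+1)}). \] Moreover \[ \sqrt n\Bigl(\int H_1\,d\hat P_n,\,M^{(1)}_{n,1},\dots,M^{(d)}_{n,1}\Bigr)\to_{\mathcal L}(\boldsymbol{G}_1,\boldsymbol{G}_2^{(1)},\dots,\boldsymbol{G}_2^{(d)}) \] with independent random matrices, where $\boldsymbol{G}_1$ is centered Gaussian in $\mathbb{R}^{q\times q}_{\rm sym}$ with $\mathbb{E}\langle A,\boldsymbol{G}_1\rangle^2=\mathbb{E}\langle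 A,H_1(X_1)\rangle^2$ and each $\boldsymbol{G}_2^{(\ell)}$ is centered Gaussian with $\mathbb{E}\langle A,\boldsymbol{G}_2^{(\ell)}\rangle^2=\mathbb{E}\langle A,H_2(X_1,X_2)\rangle^2$ for all $A\in\mathbb{R}^{q\times q}_{\rm sym}$. In particular, with $\boldsymbol{G}_2$ distributed as $\boldsymbol{G}_2^{(1)}$ and independent of $\boldsymbol{G}_1$, \[ \sqrt n\Bigl(d^{-1}\sum_{\ell=1}^d\boldsymbol{\Sigma}(\hat Q^{(\ell)}_{n,1})-\boldsymbol{\Sigma}(Q)\Bigr)\to_{\mathcal L}2\boldsymbol{G}_1+d^{-1/2}\boldsymbol{G}_2 \quad (n\to\infty). \]
   Context: Notation: $\mathbb{R}^{q\times q}_{\rm sym}$ is the space of symmetric $q\times q$ matrices, $\mathbb{R}^{q\times q}_{\rm sym,+}$ its subset of positive definite matrices; $\langle M,N\rangle=\mathrm{tr}(M^\top N)$ and $\|M\|$ is the Frobenius norm. $\delta_z$ is the Dirac measure at $z$ and $\delta^{\rm s}_z:=\frac12(\delta_z+\delta_{-z})$. $X_1,X_2,\dots$ are i.i.d. with distribution $P$ on $\mathbb{R}^q$ and $\hat P_n:=n^{-1}\sum_{i=1}^n\delta_{X_i}$. $\to_{\mathcal L}$ denotes convergence in distribution, $o_p(a_n)$ a term $R_n$ with $R_n/a_n\to0$ in probability. Estimators $\boldsymbol{\Sigma}(\hat Q)$ are defined on the event $\hat Q\in\mathcal{Q}$ (arbitrarily otherwise). Case (a): $\mathcal{Q}$ is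 a family of probability distributions on $\mathbb{R}^q$ which is open in the topology of weak convergence, and $\boldsymbol{\Sigma}:\mathcal{Q}\to\mathbb{R}^{q\times q}_{\rm sym,+}$ satisfies: (linear equivariance) for every nonsingular $B\in\mathbb{R}^{q\times q}$ and $Q\in\mathcal{Q}$, the law $Q^B$ of $BY$, $Y\sim Q$, lies in $\mathcal{Q}$ and $\boldsymbol{\Sigma}(Q^B)=B\boldsymbol{\Sigma}(Q)B^\top$; (differentiability) for each $Q\in\mathcal{Q}$ there is a bounded, measurable, even function $J=J_Q:\mathbb{R}^q\to\mathbb{R}^{q\times q}_{\rm sym}$ with $\int J\,dQ=0$ such that for $\check Q\in\mathcal{Q}$, $\boldsymbol{\Sigma}(\check Q)=\boldsymbol{\Sigma}(Q)+\int J\,d\check Q+o(\|\int J\,d\check Q\|)$ as $\check Q\to Q$ weakly. Case (b) (Tyler's functional): $P$ has no atoms; $\mathcal{Q}=\mathcal{Q}_0$ is the set of distributions $Q$ on $\mathbb{R}^q$ with $Q(\{0\})=0$ and $Q(\mathbb{W})<\dim(\mathbb{W})/q$ for every linear subspace $\mathbb{W}$ with $1\le\dim\mathbb{W}<q$; $\boldsymbol{\Sigma}(Q)=\boldsymbol{\Sigma}_0(Q)$ is the unique minimizer over $\{\Sigma\in\mathbb{R}^{q\times q}_{\rm sym,+}:\det\Sigma=1\}$ of $L_0(\Sigma,Q)=q\int\log\bigl(y^\top\Sigma^{-1}y/y^\top y\bigr)Q(dy)+\log\det\Sigma$; it has the differentiability property that for each $Q\in\mathcal{Q}_0$ there is a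 bounded, continuous, even $J=J_Q:\mathbb{R}^q\setminus\{0\}\to\mathbb{R}^{q\times q}_{\rm sym}$ with $\int J\,dQ=0$ and $\boldsymbol{\Sigma}_0(\check Q)=\boldsymbol{\Sigma}_0(Q)+\int J\,d\check Q+o(\|\int J\,d\check Q\|)$ as $\check Q\to Q$ weakly, $\check Q\in\mathcal{Q}_0$; one sets $J(0):=0$. *)

(* Defs.v *)
From HB Require Import structures.
From mathcomp Require Import all_boot all_order all_algebra perm.
From mathcomp Require Import all_classical all_reals all_analysis.
Import Order.TTheory GRing.Theory Num.Theory numFieldTopology.Exports numFieldNormedType.Exports.
Set Implicit Arguments.
Unset Strict Implicit.
Unset Printing Implicit Defensive.
Local Open Scope classical_set_scope.
Local Open Scope ring_scope.

Definition Vb (R : realType) (q : nat) := g_sigma_algebraType (@open 'rV[R]_q).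
Definition Mb (R : realType) (q : nat) := g_sigma_algebraType (@open 'M[R]_q).

(** (candidate) distributions on R^q are set functions; [is_prob] says it is a
    probability measure on the Borel sets of R^q *)
Definition dist (R : realType) (q : nat) := set (Vb R q) -> \bar R.
Definition is_prob (R : realType) (q : nat) (mu : dist R q) : Prop :=
  exists P : probability (Vb R q) R, forall A, P A = mu A.

Definition Rint (R : realType) (q : nat) (mu : dist R q) (f : Vb R q -> R) : R :=
  fine (\int[mu]_x (f x)%:E)%E.
Definition mxint (R : realType) (q : nat) (mu : dist R q) (F : Vb R q -> 'M[R]_q)
  : 'M[R]_q := \matrix_(i, j) Rint mu (fun x => F x i j).

Definition frob (R : realType) (q : nat) (M N : 'M[R]_q) : R := \tr (M^T *m N).
Definition mxnorm (R : realType) (q : nat) (M : 'M[R]_q) : R := Num.sqrt (frob M M).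

Definition symmx (R : realType) (q : nat) (M : 'M[R]_q) : Prop := M^T = M.
Definition spd (R : realType) (q : nat) (M : 'M[R]_q) : Prop :=
  symmx M /\ forall v : 'rV[R]_q, v != 0 -> 0 < (v *m M *m v^T) 0 0.

Definition law d (Om : measurableType d) (R : realType) (q : nat)
  (Pr : probability Om R) (Y : Om -> Vb R q) : dist R q :=
  fun A => Pr (Y @^-1` A).

(** Q^B : law of B Y when Y ~ Q (row-vector convention: B Y <-> y B^T) *)
Definition pushB (R : realType) (q : nat) (B : 'M[R]_q) (Q : dist R q) : dist R q :=
  fun A => Q ((fun y : Vb R q => (y *m B^T : Vb R q)) @^-1` A).

Definition bounded_continuous (R : realType) (T : topologicalType) (f : T -> R) : Prop :=
  continuous f /\ exists M : R, forall t, `|f t| <= M.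

Definition weak_nbhd (R : realType) (q : nat) (Q : dist R q) (N : set (dist R q)) : Prop :=
  exists (k : nat) (f : 'I_k -> 'rV[R]_q -> R) (e : R), 0 < e /\
    (forall i, bounded_continuous (f i)) /\
    forall Q' : dist R q, is_prob Q' ->
      (forall i, `|Rint Q' (f i) - Rint Q (f i)| < e) -> N Q'.

Definition weakly_open (R : realType) (q : nat) (F : set (dist R q)) : Prop :=
  (forall Q, F Q -> is_prob Q) /\ (forall Q, F Q -> weak_nbhd Q F).

Definition diff_at (R : realType) (q : nat) (Sig : dist R q -> 'M[R]_q)
  (F : set (dist R q)) (Q : dist R q) (J : 'rV[R]_q -> 'M[R]_q) : Prop :=
  forall e : R, 0 < e -> exists N, weak_nbhd Q N /\
    forall Q', F Q' -> N Q' ->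
      mxnorm (Sig Q' - Sig Q - mxint Q' J) <= e * mxnorm (mxint Q' J).

Definition bounded_mxfun (R : realType) (q : nat) (J : 'rV[R]_q -> 'M[R]_q) : Prop :=
  exists M : R, forall x, mxnorm (J x) <= M.
Definition even_mxfun (R : realType) (q : nat) (J : 'rV[R]_q -> 'M[R]_q) : Prop :=
  forall x, J (- x) = J x.
Definition symvalued (R : realType) (q : nat) (J : 'rV[R]_q -> 'M[R]_q) : Prop :=
  forall x, symmx (J x).

Definition Jprops_a (R : realType) (q : nat) (Q : dist R q) (J : 'rV[R]_q -> 'M[R]_q) : Prop :=
  (forall i j, measurable_fun setT (fun x : Vb R q => J x i j)) /\
  bounded_mxfun J /\ even_mxfun J /\ symvalued J /\ mxint Q J = 0.

Definition case_a (R : realType) (q : nat) (F : set (dist R q))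
  (Sig : dist R q -> 'M[R]_q) : Prop :=
  weakly_open F /\
  (forall Q, F Q -> spd (Sig Q)) /\
  (forall (B : 'M[R]_q) Q, B \in unitmx -> F Q ->
      F (pushB B Q) /\ Sig (pushB B Q) = B *m Sig Q *m B^T) /\
  (forall Q, F Q -> exists J, Jprops_a Q J /\ diff_at Sig F Q J).

Definition Q0set (R : realType) (q : nat) : set (dist R q) :=
  fun Q => is_prob Q /\ Q [set (0 : 'rV[R]_q)] = 0%E /\
    forall W : 'M[R]_q, (1 <= \rank W < q)%N ->
      (Q [set x : Vb R q | (x <= W)%MS] < ((\rank W)%:R / q%:R)%:E)%E.

Definition L0 (R : realType) (q : nat) (S : 'M[R]_q) (Q : dist R q) : R :=
  q%:R * Rint Q (fun y => ln ((y *m invmx S *m y^T) 0 0 / (y *m y^T) 0 0))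
  + ln (\det S).

Definition tyler_min (R : realType) (q : nat) (Q : dist R q) (S : 'M[R]_q) : Prop :=
  spd S /\ \det S = 1 /\
  forall T : 'M[R]_q, spd T -> \det T = 1 -> L0 S Q <= L0 T Q.

Definition case_b (R : realType) (q : nat) (P : dist R q) (F : set (dist R q))
  (Sig : dist R q -> 'M[R]_q) : Prop :=
  (forall x : 'rV[R]_q, P [set x] = 0%E) /\ F = @Q0set R q /\
  (forall Q, Q0set Q -> tyler_min Q (Sig Q) /\
      forall T, tyler_min Q T -> T = Sig Q).

Definition Jprops_b (R : realType) (q : nat) (Q : dist R q) (J : 'rV[R]_q -> 'M[R]_q) : Prop :=
  (forall x : 'rV[R]_q, x != 0 -> J @ x --> J x) /\ J 0 = 0 /\
  bounded_mxfun J /\ even_mxfun J /\ symvalued J /\ mxint Q J = 0.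

Definition setting (R : realType) (q : nat) (P : dist R q) (F : set (dist R q))
  (Sig : dist R q -> 'M[R]_q) (Q : dist R q) (J : 'rV[R]_q -> 'M[R]_q) : Prop :=
  (case_a F Sig /\ Jprops_a Q J /\ diff_at Sig F Q J) \/
  (case_b P F Sig /\ Jprops_b Q J /\ diff_at Sig F Q J).

(** Sampling scheme: X_0, X_1, ... iid with law P; for each n, Pi n 0, ..., Pi n (d-1)
    independent uniform random permutations of 'I_n, independent of (X_i).
    (Stated on the pi-system of cylinder events, which generates the
    relevant sigma-algebra.) *)
Definition sampling d0 (Om : measurableType d0) (R : realType) (q d : nat)
  (Pr : probability Om R) (P : dist R q) (X : nat -> Om -> Vb R q)
  (Pi : forall n : nat, 'I_d -> Om -> {perm 'I_n}) : Prop :=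
  (forall i, measurable_fun setT (X i)) /\
  (forall n l (s : {perm 'I_n}), measurable [set w | Pi n l w = s]) /\
  forall (n m : nat) (B : 'I_m -> set (Vb R q)) (s : 'I_d -> {perm 'I_n}),
    (forall i, measurable (B i)) ->
    Pr [set w | (forall i : 'I_m, B i (X i w)) /\ (forall l, Pi n l w = s l)] =
    ((\prod_(i < m) fine (P (B i))) * (n`!%:R)^-1 ^+ d)%:E.

Definition H1 (R : realType) (q : nat) (P : dist R q) (J : 'rV[R]_q -> 'M[R]_q)
  (x : 'rV[R]_q) : 'M[R]_q := mxint P (fun y => J (x - y)).
Definition H2 (R : realType) (q : nat) (P : dist R q) (J : 'rV[R]_q -> 'M[R]_q)
  (x y : 'rV[R]_q) : 'M[R]_q := J (x - y) - H1 P J x - H1 P J y.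

Definition intH1_emp d0 (Om : measurableType d0) (R : realType) (q : nat)
  (P : dist R q) (J : 'rV[R]_q -> 'M[R]_q) (X : nat -> Om -> Vb R q)
  (n : nat) (w : Om) : 'M[R]_q :=
  n%:R^-1 *: \sum_(i < n) H1 P J (X i w).

(** increments along the cyclic order given by a permutation (Pi(n+1) := Pi(1)) *)
Definition incr d0 (Om : measurableType d0) (R : realType) (q : nat)
  (X : nat -> Om -> Vb R q) (n : nat) (s : {perm 'I_n}) (w : Om) (i : 'I_n)
  : 'rV[R]_q := X (s (ordS i)) w - X (s i) w.

Definition Qhat d0 (Om : measurableType d0) (R : realType) (q : nat)
  (X : nat -> Om -> Vb R q) (n : nat) (s : {perm 'I_n}) (w : Om) : dist R q :=
  fun A => (n%:R^-1 * \sum_(i < n)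
     (2^-1 * (\1_A (incr X s w i : Vb R q) + \1_A (- incr X s w i : Vb R q))))%:E.

Definition Mn d0 (Om : measurableType d0) (R : realType) (q : nat)
  (P : dist R q) (J : 'rV[R]_q -> 'M[R]_q) (X : nat -> Om -> Vb R q)
  (n : nat) (s : {perm 'I_n}) (w : Om) : 'M[R]_q :=
  n%:R^-1 *: \sum_(i < n) H2 P J (X (s i) w) (X (s (ordS i)) w).

(** outer probability and outer expectation (for possibly non-measurable maps) *)
Definition outerP d0 (Om : measurableType d0) (R : realType)
  (Pr : probability Om R) (A : set Om) : \bar R :=
  ereal_inf [set Pr E | E in [set E : set Om | measurable E /\ A `<=` E]].

Definition outerE d0 (Om : measurableType d0) (R : realType)
  (Pr : probability Om R) (h : Om -> R) : \bar R :=
  ereal_inf [set (\int[Pr]_w (g w)%:E)%E | g in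
     [set g : Om -> R | measurable_fun setT g /\ (exists M : R, forall w, `|g w| <= M)
                        /\ forall w, h w <= g w]].

Definition o_p d0 (Om : measurableType d0) (R : realType) (q : nat)
  (Pr : probability Om R) (Rn : nat -> Om -> 'M[R]_q) (a : nat -> R) : Prop :=
  forall e : R, 0 < e ->
    (fun n => outerP Pr [set w | e * a n < mxnorm (Rn n w)]) @ \oo --> 0%E.

(** convergence in distribution (Hoffmann-Joergensen: outer expectations of
    bounded continuous functions; coincides with the usual notion for
    measurable maps) of Y_n (on Om) to Z (on Om') *)
Definition cvg_law d0 (Om : measurableType d0) d1 (Om' : measurableType d1)
  (R : realType) (T : topologicalType)
  (Pr : probability Om R) (Y : nat -> Om -> T) (Pr' : probability Om' R) (Z : Om' -> T)
  : Prop :=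
  forall f : T -> R, bounded_continuous f ->
    (fun n => outerE Pr (fun w => f (Y n w))) @ \oo --> (\int[Pr']_w (f (Z w))%:E)%E.

(** G is a centered Gaussian random element of R^{q x q}_sym with
    E <A,G>^2 = c(A) for all symmetric A  (characteristic function
    E exp(i<A,G>) = exp(-c(A)/2)) *)
Definition gaussian_sym d1 (Om' : measurableType d1) (R : realType) (q : nat)
  (Pr' : probability Om' R) (G : Om' -> 'M[R]_q) (c : 'M[R]_q -> R) : Prop :=
  measurable_fun setT (G : Om' -> Mb R q) /\ (forall w, symmx (G w)) /\
  forall A : 'M[R]_q, symmx A ->
    (\int[Pr']_w (cos (frob A (G w)))%:E)%E = (expR (- (c A / 2)))%:E /\
    (\int[Pr']_w (sin (frob A (G w)))%:E)%E = 0%E.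

Definition indep_mx d1 (Om' : measurableType d1) (R : realType) (q k : nat)
  (Pr' : probability Om' R) (G : 'I_k -> Om' -> 'M[R]_q) : Prop :=
  forall B : 'I_k -> set (Mb R q), (forall i, measurable (B i)) ->
    Pr' [set w | forall i, B i (G i w)] =
    (\prod_(i < k) fine (Pr' [set w | B i (G i w)]))%:E.

Definition stat_vec d0 (Om : measurableType d0) (R : realType) (q d : nat)
  (P : dist R q) (J : 'rV[R]_q -> 'M[R]_q) (X : nat -> Om -> Vb R q)
  (Pi : forall n : nat, 'I_d -> Om -> {perm 'I_n}) (n : nat) (w : Om)
  : {ptws 'I_d.+1 -> 'M[R]_q} :=
  fun k => Num.sqrt n%:R *:
    match unlift ord0 k with
    | None => intH1_emp P J X n w
    | Some l => Mn P J X (Pi n l w) w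
    end.

(* Main.v *)
(** Write W for the linear statistic sqrt n * (<A_0, int H_1 dP_n> + sum_l <A_l, M^(l)>).
    Given the permutations, W = n^(-1/2) sum_a zeta_a, where zeta_a involves X_a and its
    successors in the d cycles, so the summands are locally dependent. Since H_2 is
    degenerate, integrating out X_a yields Stein's identity E[W sin(uW+t)] = u s2 E cos(uW+t)
    up to O(n^(-1/2)) and up to the proportion of edges shared by two of the cycles, and the
    mean of this proportion over the permutations is O(1/n). As an approximate differential
    equation in u, the identity gives the Gaussian characteristic function in the limit.
    Convergence in law follows by approximating bounded continuous functions on a box by
    trigonometric polynomials with the same global bound.

    For the expansion, int J dQhat = 2 int H_1 dP_n + M is of order n^(-1/2) in probability,
    and Qhat enters every weak neighbourhood of Q by the second moment method. In Tyler's
    case the inequalities defining Q_0 persist in a weak neighbourhood, because the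
    orthogonal projections of a given rank form a compact set; Qhat has no atom at 0 almost
    surely since there are no ties. *)

Require Import Defs.
From HB Require Import structures.
From mathcomp Require Import all_boot all_order all_algebra fingroup perm.
From mathcomp Require Import all_classical all_reals all_analysis.
From mathcomp Require Import measurable_realfun.
From mathcomp Require Import lra ring zify.
Import Order.TTheory GRing.Theory Num.Theory numFieldTopology.Exports numFieldNormedType.Exports.
Set Implicit Arguments.
Unset Strict Implicit.
Unset Printing Implicit Defensive.
Local Open Scope classical_set_scope.
Local Open Scope ring_scope.

(** Stein's identity is proved for frozen permutations, with an error that depends on them only
    through the number of shared edges, and linearly so; independence of the permutations from the
    sample then turns it into a finite average, for which the mean number of shared edges is enough.
    Real cosines with a phase replace the complex characteristic function: the phase covers the
    sine, and [u] need only range over [0, 1] because the scale sits in the coefficient matrices.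
    [Sig] is an arbitrary map on set functions, so nothing built from it need be measurable. The
    limit theorem is therefore carried by measurable linear statistics, and the estimators are
    compared with them under outer probability. The global bound on the approximating trigonometric
    polynomials matters because off the box they must cost no more than a constant times a small
    probability. The set of Tyler's functional is not weakly open: having no atom at 0 is unstable.
    The expansion therefore works with a neighbourhood whose members lie in [F] provided that they
    have an extra property, which [Qhat] has almost surely. *)

Definition bmeas d (T : measurableType d) (R : realType) (f : T -> R) : Prop :=
  measurable_fun setT f /\ exists M : R, forall t, `|f t| <= M.

(** * Bounded measurable functions and their expectations *)

Section BoundedMeasurable.
Context {d : measure_display} {T : measurableType d} {R : realType}.
Implicit Types f g : T -> R.

Lemma bmeas_cst (c : R) : bmeas (fun _ : T => c).
Proof. by split; [exact: measurable_cst | exists `|c|]. Qed.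

Lemma bmeasD f g : bmeas f -> bmeas g -> bmeas (fun t => f t + g t).
Proof.
move=> [mf [M Mf]] [mg [N Ng]]; split; first exact: measurable_funD.
by exists (M + N) => t; rewrite (le_trans (ler_normD _ _))// lerD.
Qed.

Lemma bmeasM f g : bmeas f -> bmeas g -> bmeas (fun t => f t * g t).
Proof.
move=> [mf [M Mf]] [mg [N Ng]]; split; first exact: measurable_funM.
by exists (M * N) => t; rewrite normrM ler_pM.
Qed.

Lemma bmeasZ c f : bmeas f -> bmeas (fun t => c * f t).
Proof. by move=> bf; apply: bmeasM => //; exact: bmeas_cst. Qed.

Lemma bmeasN f : bmeas f -> bmeas (fun t => - f t).
Proof.
by move=> bf; have := bmeasZ (-1) bf; under eq_fun do rewrite mulN1r.
Qed.

Lemma bmeasB f g : bmeas f -> bmeas g -> bmeas (fun t => f t - g t).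
Proof. by move=> bf bg; apply: bmeasD => //; exact: bmeasN. Qed.

Lemma bmeas_sum (I : eqType) (r : seq I) (p : pred I) (F : I -> T -> R) :
  (forall i, p i -> bmeas (F i)) -> bmeas (fun t => \sum_(i <- r | p i) F i t).
Proof.
move=> bF; elim: r => [|i r IH].
  by under eq_fun do rewrite big_nil; exact: bmeas_cst.
under eq_fun do rewrite big_cons.
by case: (boolP (p i)) => // pi; apply: bmeasD => //; exact: bF.
Qed.

Lemma bmeasX n f : bmeas f -> bmeas (fun t => f t ^+ n).
Proof.
elim: n => [|n IH] bf; first by under eq_fun do rewrite expr0; exact: bmeas_cst.
by under eq_fun do rewrite exprS; apply: bmeasM => //; exact: IH.
Qed.

Lemma bmeas_norm f : bmeas f -> bmeas (fun t => `|f t|).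
Proof.
move=> [mf [M Mf]]; split; first exact: measurableT_comp.
by exists M => t; rewrite normr_id.
Qed.

Lemma bmeas_cos (u c : R) f : measurable_fun setT f ->
  bmeas (fun t => cos (u * f t + c)).
Proof.
move=> mf; split.
  apply: (@measurableT_comp _ _ _ _ _ _ (@cos R)).
    by apply: continuous_measurable_fun; exact: continuous_cos.
  apply: measurable_funD; last exact: measurable_cst.
  by apply: measurable_funM => //; exact: measurable_cst.
by exists 1 => t; rewrite ler_norml cos_geN1 cos_le1.
Qed.

Lemma bmeas_sin (u c : R) f : measurable_fun setT f ->
  bmeas (fun t => sin (u * f t + c)).
Proof.
move=> mf; split.
  apply: (@measurableT_comp _ _ _ _ _ _ (@sin R)).
    by apply: continuous_measurable_fun; exact: continuous_sin.
  apply: measurable_funD; last exact: measurable_cst.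
  by apply: measurable_funM => //; exact: measurable_cst.
by exists 1 => t; rewrite ler_norml sin_geN1 sin_le1.
Qed.

Lemma bmeas_indic (A : set T) : measurable A -> bmeas (\1_A : T -> R).
Proof.
move=> mA; split; first exact: measurable_indic.
by exists 1 => t; rewrite indicE; case: (_ \in _); rewrite ?normr1 ?normr0.
Qed.

End BoundedMeasurable.

Lemma bmeas_comp d (T : measurableType d) d' (T' : measurableType d')
  (R : realType) (f : T' -> R) (g : T -> T') :
  bmeas f -> measurable_fun setT g -> bmeas (fun t => f (g t)).
Proof.
move=> [mf [M Mf]] mg; split; last by exists M => t; exact: Mf.
exact: (measurableT_comp mf mg).
Qed.

Section Expectation.
Context {d : measure_display} {T : measurableType d} {R : realType}.
Variable P : probability T R.
Implicit Types f g : T -> R.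

Lemma bmeas_integrable f : bmeas f -> P.-integrable setT (EFin \o f).
Proof.
move=> [mf [M Mf]]; apply: measurable_bounded_integrable => //.
  exact: (le_lt_trans (probability_le1 P measurableT) (ltry _)).
exists M; split; first exact: num_real.
by move=> x Mx t _ /=; rewrite (le_trans (Mf t))// ltW.
Qed.

Lemma bmeas_integral_fin f : bmeas f ->
  (\int[P]_x (f x)%:E)%E = (\int[P]_x f x)%:E.
Proof.
by move=> bf; rewrite /Rintegral fineK//; apply: integrable_fin_num => //;
  exact: bmeas_integrable.
Qed.

Lemma expD f g : bmeas f -> bmeas g ->
  \int[P]_x (f x + g x) = \int[P]_x f x + \int[P]_x g x.
Proof. by move=> /bmeas_integrable bf /bmeas_integrable bg; rewrite RintegralD. Qed.

Lemma expB f g : bmeas f -> bmeas g ->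
  \int[P]_x (f x - g x) = \int[P]_x f x - \int[P]_x g x.
Proof. by move=> /bmeas_integrable bf /bmeas_integrable bg; rewrite RintegralB. Qed.

Lemma expZ c f : bmeas f -> \int[P]_x (c * f x) = c * \int[P]_x f x.
Proof. by move=> /bmeas_integrable bf; rewrite RintegralZl. Qed.

Lemma exp_cst c : \int[P]_x c = c.
Proof.
rewrite Rintegral_cst// -[RHS]mulr1; congr (_ * _).
exact: (congr1 fine (probability_setT P)).
Qed.

Lemma exp_sum (I : eqType) (r : seq I) (p : pred I) (F : I -> T -> R) :
  (forall i, p i -> bmeas (F i)) ->
  \int[P]_x (\sum_(i <- r | p i) F i x) = \sum_(i <- r | p i) \int[P]_x F i x.
Proof.
move=> bF; elim: r => [|i r IH].
  by rewrite big_nil -[RHS](exp_cst 0); under eq_Rintegral do rewrite big_nil.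
rewrite big_cons; under eq_Rintegral do rewrite big_cons.
case: (boolP (p i)) => // pi; rewrite expD ?IH//; first exact: bF.
exact: bmeas_sum.
Qed.

Lemma exp_le f g : bmeas f -> bmeas g -> (forall x, f x <= g x) ->
  \int[P]_x f x <= \int[P]_x g x.
Proof.
move=> /bmeas_integrable bf /bmeas_integrable bg fg.
by apply: le_Rintegral => // x _; exact: fg.
Qed.

Lemma exp_norm f : bmeas f -> `|\int[P]_x f x| <= \int[P]_x `|f x|.
Proof. by move=> /bmeas_integrable bf; exact: le_normr_Rintegral. Qed.

Lemma exp_bound f c : bmeas f -> (forall x, `|f x| <= c) ->
  `|\int[P]_x f x| <= c.
Proof.
move=> bf fc; apply: le_trans (exp_norm bf) _.
rewrite -[leRHS](exp_cst c); apply: exp_le => //; first exact: bmeas_norm.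
exact: bmeas_cst.
Qed.

Lemma exp_indic A : measurable A -> \int[P]_x (\1_A x : R) = fine (P A).
Proof. by move=> mA; rewrite /Rintegral integral_indic// setIT. Qed.

Lemma exp_ge0 f : (forall x, 0 <= f x) -> 0 <= \int[P]_x f x.
Proof. by move=> f0; apply: Rintegral_ge0. Qed.

Lemma exp_dist f g c : bmeas f -> bmeas g -> (forall x, `|f x - g x| <= c) ->
  `|\int[P]_x f x - \int[P]_x g x| <= c.
Proof. by move=> bf bg fg; rewrite -expB//; apply: exp_bound => //; exact: bmeasB. Qed.

(** Integrates [|f| <= c / 2 + f^2 / (2 c)], a substitute for Cauchy-Schwarz without square roots.
    The free [c] will be of order n^(-1/2) when [B] is of order 1/n. *)
Lemma exp_norm_le_sqr f (c B : R) : bmeas f -> 0 < c ->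
  \int[P]_x (f x ^+ 2) <= B -> \int[P]_x `|f x| <= (c + B / c) / 2.
Proof.
move=> bf c0 fB.
have c20 : 0 < 2 * c by rewrite mulr_gt0.
apply: (@le_trans _ _ (\int[P]_x (2^-1 * c + (2 * c)^-1 * f x ^+ 2))).
  apply: exp_le; first exact: bmeas_norm.
    apply: bmeasD; first exact: bmeas_cst.
    by apply: bmeasZ; exact: bmeasX.
  move=> x; rewrite -(ler_pM2l c20) mulrDr [_ * ((2 * c)^-1 * _)]mulrA divff ?gt_eqF// mul1r.
  have <- : `|f x| ^+ 2 = f x ^+ 2 by rewrite real_normK ?num_real.
  by have := sqr_ge0 (c - `|f x|); nra.
rewrite expD ?exp_cst ?expZ; last 3 first.
- exact: bmeasX.
- exact: bmeas_cst.
- by apply: bmeasZ; exact: bmeasX.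
have : (2 * c)^-1 * \int[P]_x (f x ^+ 2) <= (2 * c)^-1 * B.
  by rewrite ler_pM2l// invr_gt0.
by rewrite invfM => h; rewrite mulrDl; lra.
Qed.

Lemma prob_chebyshev f (e B : R) : bmeas f -> 0 < e ->
  \int[P]_x (f x ^+ 2) <= B ->
  fine (P [set x | e < `|f x|]) <= B / e ^+ 2.
Proof.
move=> bf e0 fB.
have mA : measurable [set x | e < `|f x|].
  rewrite -[X in measurable X]setTI.
  have [mn _] := bmeas_norm bf.
  have := mn measurableT _ (measurable_itv `]e, +oo[).
  by congr measurable; apply/seteqP; split=> x /=; rewrite in_itv/= andbT.
rewrite -exp_indic// ler_pdivlMr ?exprn_gt0//.
apply: le_trans fB; rewrite mulrC -expZ; last exact: bmeas_indic.
apply: exp_le.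
- by apply: bmeasZ; exact: bmeas_indic.
- exact: bmeasX.
- move=> x; rewrite indicE; have [|] := boolP (x \in _).
    rewrite inE/= => h; rewrite mulr1 -[f x ^+ 2]real_normK ?num_real//.
    by rewrite ler_sqr ?nnegrE// ?ltW.
  by rewrite mulr0 sqr_ge0.
Qed.

End Expectation.

Lemma exp_pushforward d (T : measurableType d) d' (T' : measurableType d')
  (R : realType) (P : probability T R) (P' : probability T' R)
  (phi : T -> T') (f : T' -> R) :
  measurable_fun setT phi -> bmeas f ->
  (forall A, measurable A -> P' A = P (phi @^-1` A)) ->
  \int[P']_y f y = \int[P]_x f (phi x).
Proof.
move=> mphi bf E; rewrite /Rintegral; congr fine.
transitivity (\int[pushforward P phi]_y (f y)%:E)%E.
  by apply: eq_measure_integral => A mA _; exact: E.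
rewrite integral_pushforward//.
- by apply/measurable_EFinP; exact: bf.1.
- exact: bmeas_integrable (bmeas_comp bf mphi).
Qed.

(** * Borel sets of R^q and coordinates *)

Section Borel.
Context {R : realType}.

Lemma Vb_coord_measurable q (j : 'I_q) :
  measurable_fun setT (fun x : Vb R q => x ord0 j).
Proof.
apply: (measurability _ (RGenOpens.measurableE R)).
move=> _ [_ [a [b ->] <-]]; rewrite setTI.
apply: sub_sigma_algebra; apply: open_comp; last exact: interval_open.
by move=> x _; exact: coord_continuous.
Qed.

Lemma continuous_Vb_measurable q (f : 'rV[R]_q -> R) : continuous f ->
  measurable_fun setT (f : Vb R q -> R).
Proof.
move=> cf; apply: (measurability _ (RGenOpens.measurableE R)).
move=> _ [_ [a [b ->] <-]]; rewrite setTI.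
by apply: sub_sigma_algebra; apply: open_comp; [move=> x _; exact: cf | exact: interval_open].
Qed.

Lemma Mb_coord_measurable q (i j : 'I_q) :
  measurable_fun setT (fun x : Mb R q => x i j).
Proof.
apply: (measurability _ (RGenOpens.measurableE R)).
move=> _ [_ [a [b ->] <-]]; rewrite setTI.
apply: sub_sigma_algebra; apply: open_comp; last exact: interval_open.
by move=> x _; exact: coord_continuous.
Qed.

Lemma rV_ballP q (x y : 'rV[R]_q) (e : R) : 0 < e ->
  ball x e y <-> forall j, `|x ord0 j - y ord0 j| < e.
Proof.
move=> e0; split=> [h j|h].
  have [_ h'] : 0 < e /\ forall i j, ball (x i j) e (y i j) := h.
  exact: h'.
suff : 0 < e /\ forall i j, ball (x i j) e (y i j) by [].
by split=> // i j; rewrite ord1; exact: h.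
Qed.

(* An open subset of R^q is a countable union of rational boxes, so the Borel
   sigma-algebra is generated by the coordinates. *)
Lemma Vb_measurable_coords d (T : measurableType d) q (f : T -> Vb R q) :
  (forall j, measurable_fun setT (fun t => f t ord0 j)) -> measurable_fun setT f.
Proof.
move=> mf; apply: (@measurability _ _ T (Vb R q) setT f (@open 'rV[R]_q)) => //.
move=> _ [U oU <-]; rewrite setTI.
pose B (c : 'rV[rat]_q * nat) : set 'rV[R]_q :=
  ball (map_mx (@ratr R) c.1) c.2.+1%:R^-1.
have mB c : measurable (f @^-1` B c).
  have k0 : 0 < c.2.+1%:R^-1 :> R by rewrite invr_gt0.
  have -> : f @^-1` B c = \bigcap_(j in [set: 'I_q])
     ((fun t => f t ord0 j) @^-1` ball (ratr (c.1 ord0 j) : R) c.2.+1%:R^-1).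
    apply/seteqP; split => t /=.
      by move=> /(rV_ballP _ _ k0) h j _ /=; have := h j; rewrite mxE.
    by move=> h; apply/(rV_ballP _ _ k0) => j; rewrite mxE; exact: h.
  apply: fin_bigcap_measurable => // j _.
  rewrite -[X in measurable X]setTI; apply: mf => //.
  by apply: open_measurable; exact: ball_open.
have -> : f @^-1` U = \bigcup_(c in [set c | B c `<=` U]) (f @^-1` B c).
  apply/seteqP; split => t /=; last by move=> [c h] /h.
  move=> Ut; have [e e0 eU] : exists2 e : R, 0 < e & ball (f t) e `<=` U.
    by move: oU; rewrite openE => /(_ _ Ut)/nbhs_ballP[e /= e0 h]; exists e.
  have [k hk] : exists k : nat, k.+1%:R^-1 < e / 2.
    have [k _ hk] := near_infty_natSinv_lt (PosNum (divr_gt0 e0 (ltr0n R 2))).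
    by exists k; exact: (hk k (leqnn _)).
  have k0 : 0 < k.+1%:R^-1 :> R by rewrite invr_gt0.
  have [c hc] : exists c : 'rV[rat]_q, forall j, `|ratr (c ord0 j) - f t ord0 j| < k.+1%:R^-1 :> R.
    have h j : exists r : rat, `|ratr r - f t ord0 j| < k.+1%:R^-1 :> R.
      have [r] := @rat_in_itvoo R (f t ord0 j - k.+1%:R^-1) (f t ord0 j + k.+1%:R^-1) ltac:(by rewrite ltrD2l gtrN ?invr_gt0).
      by rewrite in_itv /= => h; exists r; rewrite ltr_distl.
    exists (\row_j projT1 (cid (h j))) => j; rewrite mxE; exact: projT2 (cid (h j)).
  exists (c, k).
    move=> /= y /(rV_ballP _ _ k0) hy; apply: eU; apply/(rV_ballP _ _ e0) => j.
    have := hy j; rewrite /= mxE => h1; have := hc j => h2.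
    rewrite (le_lt_trans (ler_distD (ratr (c ord0 j)) _ _))//.
    rewrite (splitr e) ltrD//; last exact: lt_trans hk.
    by rewrite distrC (lt_trans _ hk).
  by apply/(rV_ballP _ _ k0) => j /=; rewrite mxE; exact: hc.
rewrite (_ : \bigcup_(c in _) _ = \bigcup_c (if `[< B c `<=` U >] then f @^-1` B c else set0)).
  apply: countable_bigcupT_measurable => [|c]; first exact: countableP.
  by case: ifPn.
apply/seteqP; split=> t /= [c].
  by move=> /= cU ct; exists c => //; case: asboolP.
by move=> _; case: asboolP => // cU ct; exists c.
Qed.

End Borel.

(** * Independence, product laws and Fubini *)

Section IndependentFunctions.
Context {d0 : measure_display} {Om : measurableType d0} {R : realType}.
Variable Pr : probability Om R.

Lemma prob_fineK (A : set Om) : measurable A -> Pr A = (fine (Pr A))%:E.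
Proof. by move=> mA; rewrite fineK// fin_num_measure. Qed.

(** Dynkin's argument with one event held fixed: the events independent of [A'] form a
    lambda-system, so independence passes from the pi-system [G] to the sigma-algebra it
    generates. *)
Lemma indep_sigma_pi (G : set (set Om)) (A' : set Om) :
  setI_closed G -> G `<=` measurable -> measurable A' ->
  (forall A, G A -> Pr (A `&` A') = (Pr A * Pr A')%E) ->
  forall A, <<s G >> A -> measurable A /\ Pr (A `&` A') = (Pr A * Pr A')%E.
Proof.
move=> GI Gm mA' GA' A sA.
suff: <<s G >> `<=` [set A | measurable A /\ Pr (A `&` A') = (Pr A * Pr A')%E].
  by move=> /(_ _ sA).
apply: lambda_system_subset => //; last first.
  by move=> B GB; split; [exact: Gm|exact: GA'].
apply/dynkin_lambda_system; split.
- by split => //; rewrite setTI probability_setT mul1e.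
- move=> B [mB hB]; split; first exact: measurableC.
  have mBA : measurable (B `&` A') by exact: measurableI.
  rewrite setIC -setDE measureD//; last by rewrite ltey_eq fin_num_measure.
  transitivity (Pr A' - Pr (B `&` A'))%E; first by rewrite [B `&` _]setIC.
  rewrite hB probability_setC// (prob_fineK mB) (prob_fineK mA').
  have e : fine (Pr A') - fine (Pr B) * fine (Pr A') =
           (1 - fine (Pr B)) * fine (Pr A') by ring.
  exact: (congr1 EFin e).
- move=> F tF hF; have mF n : measurable (F n) by have [] := hF n.
  split; first exact: bigcupT_measurable.
  rewrite setI_bigcupl measure_bigcup//; last 2 first.
  + by move=> n _; exact: measurableI.
  + by apply: trivIset_setIr.
  rewrite measure_bigcup// muleC (prob_fineK mA') -nneseriesZl//.
  by apply: eq_eseriesr => n _; apply: etrans (hF n).2 _; rewrite muleC -prob_fineK.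
Qed.


End IndependentFunctions.

Lemma law_exists d (T : measurableType d) d' (T' : measurableType d')
  (R : realType) (P : probability T R) (Y : T -> T') :
  measurable_fun setT Y ->
  exists P' : probability T' R, forall A, P' A = P (Y @^-1` A).
Proof.
move=> mY.
pose mY' := isMeasurableFun.Build _ _ _ _ _ mY.
pose Y' : {mfun T >-> T'} := HB.pack Y mY'.
by exists (distribution P Y').
Qed.

Section Fubini.
Context {R : realType} {d1 d2 : measure_display} {T1 : measurableType d1}
  {T2 : measurableType d2}.
Variables (P1 : probability T1 R) (P2 : probability T2 R).

Lemma bmeas_section (f : T1 * T2 -> R) : bmeas f ->
  bmeas (fun y => \int[P1]_x f (x, y)).
Proof.
move=> [mf [M Mf]].
have bs y : bmeas (fun x => f (x, y)).
  split; last by exists M.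
  exact: (measurableT_comp mf (measurable_pair2 y)).
split; last by exists M => y; apply: exp_bound => //.
have bf := bmeas_integrable (P1 \x P2)%E (conj mf (ex_intro _ M Mf)).
have := measurable_fubini_G bf.
rewrite /fubini_G => h; apply/measurable_EFinP.
apply: (eq_measurable_fun _ _ h) => y _ /=.
by rewrite bmeas_integral_fin.
Qed.

Lemma exp_fubini (f : T1 * T2 -> R) (P3 : probability (T1 * T2)%type R) :
  bmeas f ->
  (forall A B, measurable A -> measurable B ->
     P3 (A `*` B) = (P1 A * P2 B)%E) ->
  \int[P3]_z f z = \int[P2]_y \int[P1]_x f (x, y).
Proof.
move=> bf E; have [mf [M Mf]] := bf.
have bs y : bmeas (fun x => f (x, y)).
  split; last by exists M.
  exact: (measurableT_comp mf (measurable_pair2 y)).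
have bf' := bmeas_integrable (P1 \x P2)%E bf.
rewrite /Rintegral; congr fine.
transitivity (\int[P1 \x P2]_z (f z)%:E)%E.
  apply: eq_measure_integral => A mA _.
  by rewrite -(product_measure_unique E).
rewrite -(integral21_prod_meas1 bf').
by apply: eq_integral => y _; rewrite /fubini_G/= bmeas_integral_fin.
Qed.

End Fubini.

(** The law of [(Y, Z)] agrees with the product of the marginals on rectangles, hence everywhere,
    and Fubini applies. The inner [w'] acts as an independent copy of [w] that enters through [Y]
    only. *)
Lemma exp_indep_pair d (Om : measurableType d) (R : realType)
  (Pr : probability Om R) d1 (T1 : measurableType d1) d2 (T2 : measurableType d2)
  (Y : Om -> T1) (Z : Om -> T2) (f : T1 * T2 -> R) :
  measurable_fun setT Y -> measurable_fun setT Z -> bmeas f ->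
  (forall A B, measurable A -> measurable B ->
     Pr (Y @^-1` A `&` Z @^-1` B) = (Pr (Y @^-1` A) * Pr (Z @^-1` B))%E) ->
  \int[Pr]_w f (Y w, Z w) = \int[Pr]_w \int[Pr]_w' f (Y w', Z w).
Proof.
move=> mY mZ bf E.
have [P1 hP1] := law_exists Pr mY.
have [P2 hP2] := law_exists Pr mZ.
have mYZ : measurable_fun setT (fun w => (Y w, Z w)) by exact: measurable_fun_pair.
have [P3 hP3] := law_exists Pr mYZ.
rewrite -(@exp_pushforward _ _ _ _ _ Pr P3 _ f mYZ bf); last by move=> A _.
rewrite (@exp_fubini _ _ _ _ _ P1 P2)//; last first.
  by move=> A B mA mB; rewrite hP1 hP2 hP3 -E.
rewrite (@exp_pushforward _ _ _ _ _ Pr P2 _ _ mZ (bmeas_section P1 P2 bf)); last by move=> A _.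
apply: eq_Rintegral => w _.
rewrite (@exp_pushforward _ _ _ _ _ Pr P1 _ (fun x => f (x, Z w)) mY)//.
have [mf [M Mf]] := bf; split; last by exists M.
exact: (measurableT_comp mf (measurable_pair2 (Z w))).
Qed.

(** * Sigma-algebras generated by subfamilies of independent variables *)

Section CylinderSigmaAlgebras.
Context {d0 : measure_display} {Om : measurableType d0} {R : realType}
  {Idx : eqType} {d1 : measure_display} {T : measurableType d1}.
Variables (Pr : probability Om R) (Y : Idx -> Om -> T).

(** The family [B] is total, with [setT] off [r] and off [I], so that intersections of cylinders are
    formed coordinatewise. *)
Definition cylinders (I : set Idx) : set (set Om) :=
  [set A | exists (B : Idx -> set T) (r : seq Idx),
     [/\ forall i, measurable (B i),
         forall i, i \notin r \/ ~ I i -> B i = setT &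
         A = [set w | forall i, B i (Y i w)]]].

(** The carrier stays [Om]: measurability of [f : subsigma I -> R] expresses that [f] depends only
    on the [Y i] with [i] in [I], without any factorization of [f]. *)
Definition subsigma (I : set Idx) := g_sigma_algebraType (cylinders I).

Lemma cylinders_setI I : setI_closed (cylinders I).
Proof.
move=> _ _ [B [r [mB sB ->]]] [B' [r' [mB' sB' ->]]].
exists (fun i => B i `&` B' i), (r ++ r'); split.
- by move=> i; exact: measurableI.
- move=> i; rewrite mem_cat negb_or => h.
  by rewrite sB ?sB' ?setTI//; case: h => [/andP[]|]; tauto.
- apply/seteqP; split=> w /=; first by move=> [h h'] i; split.
  by move=> h; split=> i; have [] := h i.
Qed.

Hypothesis mY : forall i, measurable_fun setT (Y i).

Lemma cylinders_measurable I : cylinders I `<=` measurable.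
Proof.
move=> _ [B [r [mB sB ->]]].
have -> : [set w | forall i, B i (Y i w)] =
    \bigcap_(i in [set` r]) (Y i @^-1` B i).
  apply/seteqP; split=> w /=; first by move=> h i _; exact: h.
  move=> h i; have [ir|ir] := boolP (i \in r); first exact: h.
  by rewrite sB//; left.
by apply: fin_bigcap_measurable => // i _; rewrite -[X in measurable X]setTI; exact: mY.
Qed.

Lemma subsigma_le I A : measurable (A : set (subsigma I)) -> measurable (A : set Om).
Proof.
move=> mA; apply: (smallest_sub (sigma_algebra_measurable Om) (@cylinders_measurable I)).
exact: mA.
Qed.

Lemma measurable_subsigma I d' (T' : measurableType d') (f : Om -> T') :
  measurable_fun setT (f : subsigma I -> T') -> measurable_fun setT f.
Proof.
by move=> mf _ B mB; rewrite setTI; apply: (@subsigma_le I); rewrite -[X in measurable X]setTI; exact: mf.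
Qed.

Lemma bmeas_subsigma I (f : Om -> R) :
  bmeas (f : subsigma I -> R) -> bmeas f.
Proof. by move=> [mf Mf]; split => //; exact: measurable_subsigma mf. Qed.

Lemma subsigma_measurable_var (I : set Idx) i : I i ->
  measurable_fun setT (Y i : subsigma I -> T).
Proof.
move=> Ii _ B mB; rewrite setTI; apply: sub_sigma_algebra.
exists (fun j => if j == i then B else setT), [:: i]; split.
- by move=> j; case: ifP.
- by move=> j; rewrite inE; case: eqP => // ->; case.
- apply/seteqP; split=> w /=; first by move=> h j; case: eqP => // ->.
  by move=> /(_ i); rewrite eqxx.
Qed.

Hypothesis PR : forall (B : Idx -> set T) (r : seq Idx),
  uniq r -> (forall i, measurable (B i)) -> (forall i, i \notin r -> B i = setT) ->
  Pr [set w | forall i, B i (Y i w)] = (\prod_(i <- r) fine (Pr (Y i @^-1` B i)))%:E.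

Lemma cylinders_indep I J A A' : (forall i, I i -> J i -> False) ->
  cylinders I A -> cylinders J A' -> Pr (A `&` A') = (Pr A * Pr A')%E.
Proof.
move=> IJ [B [r [mB sB ->]]] [B' [r' [mB' sB' ->]]].
have ur : uniq (undup (r ++ r')) by exact: undup_uniq.
have sr i : i \notin undup (r ++ r') -> B i = setT /\ B' i = setT.
  by rewrite mem_undup mem_cat negb_or => /andP[h h']; rewrite sB ?sB'//; left.
rewrite (PR ur mB); last by move=> i /sr[].
rewrite (PR ur mB'); last by move=> i /sr[].
rewrite -EFinM -big_split/=.
rewrite (_ : _ `&` _ = [set w | forall i, (B i `&` B' i) (Y i w)]); last first.
  apply/seteqP; split=> w /=; first by move=> [h h'] i; split.
  by move=> h; split=> i; have [] := h i.
rewrite (@PR (fun i => B i `&` B' i) _ ur); last 2 first.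
- by move=> i; exact: measurableI.
- by move=> i /sr[-> ->]; rewrite setTI.
congr EFin; apply: eq_bigr => i _.
have P1 : fine (Pr (Y i @^-1` setT)) = 1.
  by rewrite preimage_setT probability_setT.
have [Ii|Ii] := pselect (I i); last by rewrite sB ?setTI ?P1 ?mul1r//; right.
by rewrite (sB' i) ?setIT ?P1 ?mulr1//; right => Ji; exact: IJ Ii Ji.
Qed.

(** The pi-lambda argument is applied once for each factor. It starts from cylinders, where the
    product formula over the union of the two supports splits because [I] and [J] are disjoint. *)
Lemma subsigma_indep I J A A' : (forall i, I i -> J i -> False) ->
  measurable (A : set (subsigma I)) -> measurable (A' : set (subsigma J)) ->
  Pr (A `&` A') = (Pr A * Pr A')%E.
Proof.
move=> IJ mA mA'.
have h A1 : cylinders I A1 -> Pr (A1 `&` A') = (Pr A1 * Pr A')%E.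
  move=> cA1; rewrite setIC muleC.
  apply: (indep_sigma_pi (@cylinders_setI J) _ _ _ mA').2.
  - exact: cylinders_measurable.
  - exact: cylinders_measurable cA1.
  - by move=> A2 cA2; rewrite setIC muleC; exact: cylinders_indep cA1 cA2.
apply: (indep_sigma_pi (@cylinders_setI I) _ _ _ mA).2 => //.
- exact: cylinders_measurable.
- exact: subsigma_le mA'.
Qed.

(** With the identity as a random element of [subsigma I], independent sub-sigma-algebras become
    independent random elements, to which [exp_indep_pair] applies. *)
Lemma measurable_id_subsigma I : measurable_fun setT (id : Om -> subsigma I).
Proof. by move=> _ B mB; rewrite setTI; exact: subsigma_le mB. Qed.

Lemma exp_indepM I J (U V : Om -> R) : (forall i, I i -> J i -> False) ->
  bmeas (U : subsigma I -> R) -> bmeas (V : subsigma J -> R) ->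
  \int[Pr]_w (U w * V w) = \int[Pr]_w U w * \int[Pr]_w V w.
Proof.
move=> IJ bU bV.
have bUV : bmeas (fun z : subsigma I * subsigma J => U z.1 * V z.2).
  apply: bmeasM; first exact: (bmeas_comp bU).
  exact: (bmeas_comp bV).
rewrite (exp_indep_pair (@measurable_id_subsigma I) (@measurable_id_subsigma J) bUV); last first.
  by move=> A B mA mB; rewrite !preimage_id; exact: subsigma_indep.
rewrite /=; under eq_Rintegral do (under eq_Rintegral do rewrite mulrC).
transitivity (\int[Pr]_w (\int[Pr]_w U w * V w)).
  apply: eq_Rintegral => w _; rewrite expZ; last exact: bmeas_subsigma bU.
  by rewrite mulrC.
by rewrite expZ//; exact: bmeas_subsigma bV.
Qed.

(** Integrate out [Y a] first with everything in [J] frozen: [Y b] and [V] are then constants and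
    the inner integral of [h] vanishes. *)
Lemma exp_degenerate (a b : Idx) (J : set Idx) (h : T * T -> R) (V : Om -> R) :
  J b -> ~ J a -> bmeas h -> bmeas (V : subsigma J -> R) ->
  (forall y, \int[Pr]_w h (Y a w, y) = 0) ->
  \int[Pr]_w (h (Y a w, Y b w) * V w) = 0.
Proof.
move=> Jb Ja bh bV h0.
have mb := subsigma_measurable_var Jb.
have bf : bmeas (fun z : T * subsigma J => h (z.1, Y b z.2) * V z.2).
  apply: bmeasM; last exact: (bmeas_comp bV).
  apply: (bmeas_comp bh); apply: measurable_fun_pair => //.
  exact: (measurableT_comp mb).
rewrite (exp_indep_pair (mY a) (@measurable_id_subsigma J) bf); last first.
  move=> A B mA mB; rewrite preimage_id.
  apply: (@subsigma_indep [set a] J) => //.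
    by move=> i /= ->.
  rewrite -[X in measurable X]setTI.
  exact: (@subsigma_measurable_var [set a]).
rewrite -[RHS](exp_cst Pr 0); apply: eq_Rintegral => w _ /=.
under eq_Rintegral do rewrite mulrC.
rewrite expZ ?h0 ?mulr0//.
apply: (bmeas_comp bh); apply: measurable_fun_pair => //.
Qed.

End CylinderSigmaAlgebras.

(** * Taylor bounds for sine, cosine and exponential *)

Section TrigBounds.
Context {R : realType}.
Implicit Types x y : R.

Lemma sin_le_norm x : `|sin x| <= `|x|.
Proof.
wlog x0 : x / 0 < x => [hw|].
  have [/hw//|x0|<-] := ltgtP 0 x; last by rewrite sin0.
  by rewrite -normrN -sinN -[leRHS]normrN; apply: hw; rewrite oppr_gt0.
have dsin (z : R) : z \in `]0, x[ -> is_derive z 1 (@sin R) (cos z).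
  by move=> _; exact: is_derive_sin.
have [|z _] := @MVT R (@sin R) (@cos R) 0 x x0 dsin.
  by apply: continuous_subspaceT => z; exact: continuous_sin.
rewrite sin0 !subr0 => ->; rewrite normrM ler_piMl// ler_norml.
by rewrite cos_geN1 cos_le1.
Qed.

Lemma one_sub_cos_le x : `|1 - cos x| <= x ^+ 2 / 2.
Proof.
have e : 1 - cos x = 2 * sin (x / 2) ^+ 2.
  rewrite [in LHS](splitr x) cosD -expr2 -expr2.
  by have := cos2Dsin2 (x / 2); lra.
have h : `|sin (x / 2)| ^+ 2 <= `|x / 2| ^+ 2 by rewrite ler_sqr ?nnegrE// sin_le_norm.
have s0 : 0 <= 2 * sin (x / 2) ^+ 2 by rewrite mulr_ge0// sqr_ge0.
rewrite e (ger0_norm s0).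
by move: h; rewrite !real_normK ?num_real// expr_div_n; lra.
Qed.

Lemma id_sub_sin_le x : `|x - sin x| <= x ^+ 2.
Proof.
wlog x0 : x / 0 < x => [hw|].
  have [/hw//|x0|<-] := ltgtP 0 x; last by rewrite sin0 subrr normr0 expr0n.
  by have := hw (- x); rewrite oppr_gt0 sinN -opprD normrN sqrrN => /(_ x0).
have df (z : R) : z \in `]0, x[ -> is_derive z 1 (fun z : R => z - sin z) (1 - cos z).
  by move=> _; apply: is_deriveB.
have [|z /andP[]] := @MVT R (fun z => z - sin z) (fun z => 1 - cos z) 0 x x0 df.
  by apply: continuous_subspaceT => z; apply: cvgB; [exact: cvg_id|exact: continuous_sin].
rewrite !bnd_simp => z0 zx; rewrite sin0 !subr0 => ->; rewrite normrM [`|x|]gtr0_norm// expr2 ler_pM2r//.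
apply: le_trans (ltW zx).
(* [1 - cos z <= z] follows from [1 - cos z <= 2] beyond 2, and from [z^2 / 2 <= z] below. *)
have [z2|z2] := leP z 2; last first.
  rewrite (le_trans _ (ltW z2))// ger0_norm ?subr_ge0 ?cos_le1//.
  by have := cos_geN1 z; lra.
by apply: le_trans (one_sub_cos_le z) _; nra.
Qed.

(** The increment is taken backwards from [x] because the influence of one variable will be
    subtracted from the full statistic. *)
Lemma sin_taylor1 x y : `|sin x - sin (x - y) - y * cos x| <= 2 * y ^+ 2.
Proof.
have -> : sin x - sin (x - y) - y * cos x =
          sin x * (1 - cos y) - cos x * (y - sin y) by rewrite sinB; ring.
apply: le_trans (ler_normB _ _) _; rewrite !normrM.
have := one_sub_cos_le y; have := id_sub_sin_le y.
have s1 : `|sin x| <= 1 by rewrite ler_norml sin_geN1 sin_le1.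
have c1 : `|cos x| <= 1 by rewrite ler_norml cos_geN1 cos_le1.
move=> h1 h2.
have := ler_pM (normr_ge0 _) (normr_ge0 _) s1 h2.
have := ler_pM (normr_ge0 _) (normr_ge0 _) c1 h1.
by have := sqr_ge0 y; lra.
Qed.

Lemma cos_taylor1 x y : `|cos (x + y) - cos x + y * sin x| <= 2 * y ^+ 2.
Proof.
have -> : cos (x + y) - cos x + y * sin x =
          - (cos x * (1 - cos y)) + sin x * (y - sin y) by rewrite cosD; ring.
apply: le_trans (ler_normD _ _) _; rewrite normrN !normrM.
have := one_sub_cos_le y; have := id_sub_sin_le y.
have s1 : `|sin x| <= 1 by rewrite ler_norml sin_geN1 sin_le1.
have c1 : `|cos x| <= 1 by rewrite ler_norml cos_geN1 cos_le1.
move=> h1 h2.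
have := ler_pM (normr_ge0 _) (normr_ge0 _) c1 h2.
have := ler_pM (normr_ge0 _) (normr_ge0 _) s1 h1.
by have := sqr_ge0 y; lra.
Qed.

Lemma expRN_taylor1 x : 0 <= x -> `|expR (- x) - (1 - x)| <= x ^+ 2.
Proof.
move=> x0; rewrite ger0_norm; last by rewrite subr_ge0; exact: expR_ge1Dx.
rewrite expRN lerBlDr -(ler_pM2l (expR_gt0 x)) divff ?gt_eqF ?expR_gt0//.
have h := expR_ge1Dx x.
(* Since [(1 + x) (1 - x + x^2) = 1 + x^3], the bound [1 + x <= expR x] suffices. *)
have : (1 + x) * (x ^+ 2 + (1 - x)) <= expR x * (x ^+ 2 + (1 - x)).
  by rewrite ler_wpM2r//; nra.
by apply: le_trans; rewrite (_ : _ * _ = 1 + x ^+ 3) ?lerDl ?exprn_ge0//; ring.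
Qed.

End TrigBounds.

Ltac bm := repeat (first [ solve [auto] | exact: bmeas_cst | apply: bmeasD
  | apply: bmeasN | apply: bmeasM | apply: bmeasX | apply: bmeas_norm
  | (apply: bmeas_sum => ? ?) ]).

Ltac eqle := rewrite le_eqVlt; apply/orP; left; apply/eqP.

(** * Variance of locally dependent sums *)

Section LocalDependence.
Context {d0 : measure_display} {Om : measurableType d0} {R : realType}
  {d1 : measure_display} {E : measurableType d1}.
Variables (Pr : probability Om R) (X : nat -> Om -> E).
Hypothesis mX : forall i, measurable_fun setT (X i).
Hypothesis PR : forall (B : nat -> set E) (r : seq nat),
  uniq r -> (forall i, measurable (B i)) -> (forall i, i \notin r -> B i = setT) ->
  Pr [set w | forall i, B i (X i w)] = (\prod_(i <- r) fine (Pr (X i @^-1` B i)))%:E.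

(** [U a] depends on the variables with indices [nu k a]. As each [nu k] is a permutation, [a] and a
    pair [(k, k')] determine a single [b] with [nu k a = nu k' b], so at most [#|K|^2] of the [U b]
    are correlated with [U a]. *)
Lemma var_local_dependence (n : nat) (K : finType) (nu : K -> {perm 'I_n})
  (U : 'I_n -> Om -> R) (B : R) :
  (forall a, bmeas (U a : subsigma X [set i | exists k, i = nu k a :> nat] -> R)) ->
  (forall a w, `|U a w| <= B) ->
  \int[Pr]_w ((\sum_a (U a w - \int[Pr]_w U a w)) ^+ 2)
    <= n%:R * #|K|%:R ^+ 2 * (2 * B) ^+ 2.
Proof.
move=> bU UB.
have bU' a : bmeas (U a) by exact: bmeas_subsigma (bU a).
pose U0 a w := U a w - \int[Pr]_w U a w.
have bU0 a : bmeas (U0 a) by rewrite /U0; bm.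
have B0 a : `|\int[Pr]_w U a w| <= B by apply: exp_bound.
have U0B a w : `|U0 a w| <= 2 * B.
  by rewrite (le_trans (ler_normB _ _))//; have := UB a w; have := B0 a; lra.
have EU0 a : \int[Pr]_w U0 a w = 0 by rewrite expB ?exp_cst ?subrr//; bm.
under eq_Rintegral do rewrite expr2 big_distrlr/=.
rewrite exp_sum; last by move=> a _; bm.
(* The right side counts shared indices: it dominates the covariance if there is one, and is
   nonnegative if there is none, when the covariance is 0. *)
have cov a b : \int[Pr]_w (U0 a w * U0 b w) <=
    \sum_(k : K) \sum_(k' : K) (nu k a == nu k' b)%:R * (2 * B) ^+ 2.
  have [/existsP[k /existsP[k' kk']]|h] := boolP [exists k, exists k', nu k a == nu k' b].
    apply: le_trans (ler_norm _) _.
    apply: (@le_trans _ _ ((2 * B) ^+ 2)).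
      apply: exp_bound; first by bm.
      by move=> w; rewrite normrM expr2 ler_pM.
    rewrite (bigD1 k)//= (bigD1 k')//= kk' mul1r -addrA lerDl addr_ge0// sumr_ge0// => i _.
      by rewrite mulr_ge0 ?sqr_ge0.
    by rewrite sumr_ge0// => j _; rewrite mulr_ge0 ?sqr_ge0.
  rewrite (@exp_indepM _ _ _ _ _ _ Pr X mX PR [set i | exists k, i = nu k a :> nat]
    [set i | exists k, i = nu k b :> nat]); first last.
  - by apply: bmeasB => //; exact: bmeas_cst.
  - by apply: bmeasB => //; exact: bmeas_cst.
  - move=> i [k ->] [k' /val_inj e]; move/negP: h; apply; apply/existsP; exists k.
    by apply/existsP; exists k'; apply/eqP.
  rewrite EU0 mul0r sumr_ge0// => k _; rewrite sumr_ge0// => k' _.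
  by rewrite mulr_ge0 ?sqr_ge0.
apply: (@le_trans _ _ (\sum_(a < n) \sum_(b < n)
    \sum_(k : K) \sum_(k' : K) (nu k a == nu k' b)%:R * (2 * B) ^+ 2)).
  by apply: ler_sum => a _; rewrite exp_sum; [apply: ler_sum => b _; exact: cov|move=> b _; bm].
have e a : \sum_(b < n) \sum_(k : K) \sum_(k' : K) (nu k a == nu k' b)%:R * (2 * B) ^+ 2
   = #|K|%:R ^+ 2 * (2 * B) ^+ 2.
  rewrite exchange_big/= (eq_bigr (fun=> #|K|%:R * (2 * B) ^+ 2)).
    by rewrite sumr_const -[LHS]mulr_natl mulrA expr2.
  move=> k _; rewrite exchange_big/= (eq_bigr (fun=> (2 * B) ^+ 2)).
    by rewrite sumr_const -[LHS]mulr_natl.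
  move=> k' _; rewrite (bigD1 ((nu k')^-1%g (nu k a)))//= permKV eqxx mul1r big1 ?addr0//.
  by move=> b hb; case: eqP => [e|]; rewrite ?mul0r//; move: hb; rewrite e permK eqxx.
by rewrite (eq_bigr _ (fun a _ => e a)) sumr_const card_ord -[leLHS]mulr_natl mulrA.
Qed.

End LocalDependence.

(** * Stein's identity for fixed cycles *)

Section SteinCycles.
Context {d0 : measure_display} {Om : measurableType d0} {R : realType}
  {d1 : measure_display} {E : measurableType d1}.
Variables (Pr : probability Om R) (P : probability E R) (X : nat -> Om -> E).
Hypothesis mX : forall i, measurable_fun setT (X i).
Hypothesis lawX : forall i A, measurable A -> Pr (X i @^-1` A) = P A.
Hypothesis PR : forall (B : nat -> set E) (r : seq nat),
  uniq r -> (forall i, measurable (B i)) -> (forall i, i \notin r -> B i = setT) ->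
  Pr [set w | forall i, B i (X i w)] = (\prod_(i <- r) fine (Pr (X i @^-1` B i)))%:E.

Lemma exp_var i (f : E -> R) : bmeas f -> \int[Pr]_w f (X i w) = \int[P]_x f x.
Proof.
move=> bf; rewrite -(@exp_pushforward _ _ _ _ _ Pr P (X i) f)// => A mA.
by rewrite lawX.
Qed.

Lemma bmeas_pair2 (f : E * E -> R) y : bmeas f -> bmeas (fun x => f (x, y)).
Proof.
move=> [mf [M Mf]]; split; last by exists M.
exact: (measurableT_comp mf (measurable_pair2 y)).
Qed.

Lemma bmeas_var2 (I : set nat) i j (f : E * E -> R) : I i -> I j -> bmeas f ->
  bmeas ((fun w => f (X i w, X j w)) : subsigma X I -> R).
Proof.
by move=> Ii Ij bf; apply: (bmeas_comp bf); apply: measurable_fun_pair;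
  exact: subsigma_measurable_var.
Qed.

Lemma bmeas_var1 (I : set nat) i (f : E -> R) : I i -> bmeas f ->
  bmeas ((fun w => f (X i w)) : subsigma X I -> R).
Proof. by move=> Ii bf; apply: (bmeas_comp bf); exact: subsigma_measurable_var. Qed.

Lemma bmeas_pair i j (f : E * E -> R) : bmeas f -> bmeas (fun w => f (X i w, X j w)).
Proof. by move=> bf; apply: (bmeas_comp bf); exact: measurable_fun_pair. Qed.

Lemma exp_pair i j (f : E * E -> R) : i != j -> bmeas f ->
  \int[Pr]_w f (X i w, X j w) = \int[P]_y \int[P]_x f (x, y).
Proof.
move=> ij bf; rewrite (exp_indep_pair (mX i) (mX j) bf).
  rewrite -(@exp_var j (fun y => \int[P]_x f (x, y))); last exact: (bmeas_section P P bf).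
  by apply: eq_Rintegral => w _; rewrite (@exp_var i (fun x => f (x, X j w)))//; exact: bmeas_pair2.
move=> A B mA mB; apply: (@subsigma_indep _ _ _ _ _ _ Pr X mX PR [set i] [set j]).
- by move=> k /= -> /eqP; rewrite (negbTE ij).
- by rewrite -[X in measurable X]setTI; exact: (@subsigma_measurable_var _ _ _ _ _ X [set i]).
- by rewrite -[X in measurable X]setTI; exact: (@subsigma_measurable_var _ _ _ _ _ X [set j]).
Qed.

Variables (n d : nat) (tau : 'I_d -> {perm 'I_n}).
Hypothesis tau1 : forall l a, tau l a != a.
Hypothesis tau2 : forall l a, tau l (tau l a) != a.
Variables (g : E -> R) (h : 'I_d -> E * E -> R) (B : R).
Hypothesis B0 : 0 <= B.
Hypothesis bg : bmeas g.
Hypothesis bh : forall l, bmeas (h l).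
Hypothesis gB : forall x, `|g x| <= B.
Hypothesis hB : forall l z, `|h l z| <= B.
Hypothesis hsym : forall l x y, h l (x, y) = h l (y, x).
Hypothesis g0 : \int[P]_x g x = 0.
Hypothesis h0 : forall l y, \int[P]_x h l (x, y) = 0.

(** Each edge of a cycle is charged to its starting vertex, so that the sum over [a] counts every
    edge once. *)
Definition zeta (a : 'I_n) (w : Om) : R :=
  g (X a w) + \sum_l h l (X a w, X (tau l a) w).

(* The part of [\sum_a zeta a] that involves [X a]. *)
Definition rho (a : 'I_n) (w : Om) : R :=
  zeta a w + \sum_l h l (X ((tau l)^-1%g a) w, X a w).

Definition tstat (w : Om) : R := (Num.sqrt n%:R)^-1 * \sum_a zeta a w.

(** The vertex itself, its successors and its predecessors: the [2 d + 1] index maps on which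
    [zeta a] and [rho a] depend, in the form required by [var_local_dependence]. *)
Definition nbr (k : option ('I_d * bool)) : {perm 'I_n} :=
  match k with
  | None => 1%g
  | Some (l, b) => if b then tau l else (tau l)^-1%g
  end.

Lemma bmeas_zeta_sub a :
  bmeas (zeta a : subsigma X [set i | exists k, i = nbr k a :> nat] -> R).
Proof.
have Ia : [set i | exists k, i = nbr k a :> nat] (a : nat) by exists None; rewrite /= perm1.
apply: bmeasD; first exact: bmeas_var1.
by apply: bmeas_sum => l _; apply: bmeas_var2 => //; exists (Some (l, true)).
Qed.

Lemma bmeas_rho_sub a :
  bmeas (rho a : subsigma X [set i | exists k, i = nbr k a :> nat] -> R).
Proof.
have Ia : [set i | exists k, i = nbr k a :> nat] (a : nat) by exists None; rewrite /= perm1.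
apply: bmeasD; first exact: bmeas_zeta_sub.
by apply: bmeas_sum => l _; apply: bmeas_var2 => //; exists (Some (l, false)).
Qed.

Let bzeta a : bmeas (zeta a). Proof. exact: bmeas_subsigma (bmeas_zeta_sub a). Qed.
Let brho a : bmeas (rho a). Proof. exact: bmeas_subsigma (bmeas_rho_sub a). Qed.
Lemma bmeas_tstat : bmeas tstat. Proof. by rewrite /tstat; apply: bmeasZ; bm. Qed.

Lemma zeta_le a w : `|zeta a w| <= d.+1%:R * B.
Proof.
apply: le_trans (ler_normD _ _) _.
rewrite -natr1 mulrDl mul1r addrC lerD//.
apply: le_trans (ler_norm_sum _ _ _) _.
apply: (@le_trans _ _ (\sum_(l < d) B)); first exact: ler_sum.
by rewrite sumr_const card_ord -[leLHS]mulr_natl.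
Qed.

Lemma rho_le a w : `|rho a w| <= d.+1%:R * B + d%:R * B.
Proof.
apply: le_trans (ler_normD _ _) _.
rewrite lerD//; first exact: zeta_le.
apply: le_trans (ler_norm_sum _ _ _) _.
apply: (@le_trans _ _ (\sum_(l < d) B)); first exact: ler_sum.
by rewrite sumr_const card_ord -[leLHS]mulr_natl.
Qed.

Lemma exp_hV (a b : nat) l (V : Om -> R) : a != b ->
  bmeas (V : subsigma X [set i | i != a] -> R) ->
  \int[Pr]_w (h l (X a w, X b w) * V w) = 0.
Proof.
move=> ab bV.
apply: (@exp_degenerate _ _ _ _ _ _ Pr X mX PR a b [set i | i != a]) => //=.
- by rewrite eq_sym.
- by rewrite eqxx.
- by move=> y; rewrite (exp_var a (bmeas_pair2 y (bh l))) h0.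
Qed.

(** The orthogonality behind Stein's method: given the variables other than [X a], the term in [g]
    has mean 0 and so has each edge term, by degeneracy. [tau1] ensures that the other endpoint is
    not [a]. *)
Lemma exp_zetaV (a : 'I_n) (V : Om -> R) :
  bmeas (V : subsigma X [set i | i != (a : nat)] -> R) ->
  \int[Pr]_w (zeta a w * V w) = 0.
Proof.
move=> bV; have bV' : bmeas V := bmeas_subsigma mX bV.
have bg' : bmeas (fun w => g (X a w)) by exact: (bmeas_comp bg).
have bh' l : bmeas (fun w => h l (X a w, X (tau l a) w)) by exact: bmeas_pair.
rewrite /zeta; under eq_Rintegral do rewrite mulrDl mulr_suml.
rewrite expD ?exp_sum; [|by move=> l _; bm|by bm|by bm].
rewrite (@exp_indepM _ _ _ _ _ _ Pr X mX PR [set (a : nat)] [set i | i != (a : nat)])//; last 2 first.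
- by move=> i /= ->; rewrite eqxx.
- exact: bmeas_var1.
rewrite (exp_var a bg) g0 mul0r add0r big1// => l _; apply: exp_hV => //.
by apply: contraNneq (tau1 l a) => /val_inj/esym ->.
Qed.

(** No [X a] is left after the subtraction: neither a summand at [a] nor an edge ending in [a]. This
    makes the leave-one-out statistic measurable for the remaining variables. *)
Lemma sum_zeta_sub_rho a w : \sum_b zeta b w - rho a w =
  \sum_(b | b != a) (g (X b w) + \sum_(l | tau l b != a) h l (X b w, X (tau l b) w)).
Proof.

rewrite (bigD1 a)//= /rho opprD addrACA subrr add0r; apply/eqP; rewrite subr_eq; apply/eqP.
(* An edge of cycle [l] ends in [a] only if it starts at [(tau l)^-1 a], and that vertex is not
   [a]. *)
have -> : \sum_l h l (X ((tau l)^-1%g a) w, X a w) =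
    \sum_(b | b != a) \sum_(l | tau l b == a) h l (X b w, X (tau l b) w).
  under [in RHS]eq_bigr => b _ do rewrite big_mkcond/=.
  rewrite exchange_big/=; apply: eq_bigr => l _.
  rewrite (bigD1 ((tau l)^-1%g a))/=; last first.
    by apply/eqP => e; have := tau1 l a; rewrite -[in X in X != _]e permKV eqxx.
  rewrite permKV eqxx big1 ?addr0// => b /andP[_ hb].
  by case: eqP => // e; move: hb; rewrite -e permK eqxx.
rewrite -big_split/=; apply: eq_bigr => b _.
rewrite /zeta -addrA; congr (_ + _).
by rewrite addrC (bigID (fun l => tau l b == a)).
Qed.

Let rn : R := Num.sqrt n%:R.
Let Z : R := d.+1%:R * B.
Let Y : R := d.+1%:R * B + d%:R * B.
(** The random factor that the linearization puts in place of the variance. [Z] and [Y] are the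
    bounds on [zeta] and [rho]. *)
Let V (w : Om) : R := n%:R^-1 * \sum_a (zeta a w * rho a w).
Hypothesis n0 : (0 < n)%N.

Let rn0 : 0 < rn. Proof. by rewrite sqrtr_gt0 ltr0n. Qed.
Let rn2 : rn * rn = n%:R. Proof. by rewrite -expr2 sqr_sqrtr. Qed.
Let bV : bmeas V. Proof. by rewrite /V; apply: bmeasZ; bm. Qed.
Let bT := bmeas_tstat.

(** [zeta a] is orthogonal to the sine of the statistic freed from [X a]. Only the increment of the
    sine remains, and its first-order parts add up to [u V cos]. Each of the [n] remainders is at
    most [2 u^2 Z Y^2 / n], with a prefactor [1 / rn]. *)
Lemma stein_linearization (u th : R) :
  `|\int[Pr]_w (tstat w * sin (u * tstat w + th))
    - u * \int[Pr]_w (V w * cos (u * tstat w + th))|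
  <= 2 * u ^+ 2 * Z * Y ^+ 2 / rn.
Proof.
have bs : bmeas (fun w => sin (u * tstat w + th)) by apply: bmeas_sin; exact: bT.1.
have bc : bmeas (fun w => cos (u * tstat w + th)) by apply: bmeas_cos; exact: bT.1.
pose Ta a w := tstat w - rn^-1 * rho a w.
have bTa (a : 'I_n) : bmeas (Ta a : subsigma X [set i | i != (a : nat)] -> R).
  have -> : Ta a = (fun w => rn^-1 * \sum_(b | b != a) (g (X b w) +
      \sum_(l | tau l b != a) h l (X b w, X (tau l b) w))).
    by apply/funext => w; rewrite /Ta /tstat -mulrBr sum_zeta_sub_rho.
  apply: bmeasZ; apply: bmeas_sum => b ba; apply: bmeasD.
    exact: bmeas_var1.
  by apply: bmeas_sum => l la; apply: bmeas_var2.
have bsa a : bmeas (fun w => sin (u * Ta a w + th)).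
  by apply: (bmeas_subsigma mX); apply: bmeas_sin; exact: (bTa a).1.
have E0 a : \int[Pr]_w (zeta a w * sin (u * Ta a w + th)) = 0.
  by apply: exp_zetaV; apply: bmeas_sin; exact: (bTa a).1.
have e1 : \int[Pr]_w (tstat w * sin (u * tstat w + th)) =
   rn^-1 * \sum_a \int[Pr]_w (zeta a w * (sin (u * tstat w + th) - sin (u * Ta a w + th))).
  under eq_Rintegral do rewrite /tstat -mulrA mulr_suml.
  rewrite expZ; last by bm.
  rewrite exp_sum; last by move=> a _; bm.
  congr (_ * _); apply: eq_bigr => a _.
  under [in RHS]eq_Rintegral do rewrite mulrBr.
  by rewrite expB ?E0 ?subr0//; bm.
have e2 : u * \int[Pr]_w (V w * cos (u * tstat w + th)) =
   rn^-1 * \sum_a \int[Pr]_w (zeta a w * (u * rho a w / rn * cos (u * tstat w + th))).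
  rewrite mulr_sumr -expZ; last by bm.
  have -> : (fun w => u * (V w * cos (u * tstat w + th))) =
     (fun w => \sum_a rn^-1 * (zeta a w * (u * rho a w / rn * cos (u * tstat w + th)))).
    apply/funext => w; rewrite /V -rn2 invfM mulr_sumr mulr_suml mulr_sumr.
    by apply: eq_bigr => a _; ring.
  rewrite exp_sum; last by move=> a _; bm.
  by apply: eq_bigr => a _; rewrite expZ//; bm.
have p0 : 0 <= rn^-1 by rewrite invr_ge0 ltW.
rewrite e1 e2 -mulrBr -sumrB normrM (ger0_norm p0).
have bd a : `|\int[Pr]_w (zeta a w * (sin (u * tstat w + th) - sin (u * Ta a w + th))) -
   \int[Pr]_w (zeta a w * (u * rho a w / rn * cos (u * tstat w + th)))| <=
   Z * (2 * (u ^+ 2 * Y ^+ 2 / n%:R)).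
  apply: exp_dist; [by bm|by bm|] => w.
  rewrite -mulrBr normrM ler_pM//; first exact: zeta_le.
  have -> : u * Ta a w + th = (u * tstat w + th) - u * rho a w / rn.
    by rewrite /Ta; ring.
  apply: le_trans (sin_taylor1 _ _) _; rewrite ler_pM2l//.
  rewrite expr_div_n exprMn [rn ^+ 2]expr2 rn2.
  have u2 : 0 <= u ^+ 2 by rewrite sqr_ge0.
  rewrite ler_wpM2r ?invr_ge0// (ler_wpM2l u2)// -[leLHS]real_normK ?num_real// ler_sqr ?nnegrE//; last first.
    by apply: le_trans (rho_le a w).
  exact: rho_le.
apply: (@le_trans _ _ (rn^-1 * (n%:R * (Z * (2 * (u ^+ 2 * Y ^+ 2 / n%:R)))))).
  rewrite ler_pM2l ?invr_gt0//; apply: le_trans (ler_norm_sum _ _ _) _.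
  apply: (@le_trans _ _ (\sum_(a < n) (Z * (2 * (u ^+ 2 * Y ^+ 2 / n%:R))))); first exact: ler_sum.
  by rewrite sumr_const card_ord -[leLHS]mulr_natl.
have nn : (n%:R : R) != 0 by rewrite pnatr_eq0 -lt0n.
have rnn : rn != 0 by rewrite gt_eqF.
by eqle; field; rewrite nn rnn.
Qed.

(** The variance that [zeta a] has when edge terms of distinct cycles are uncorrelated. *)
Definition sig2 : R := \int[P]_x (g x ^+ 2) +
  \sum_l \int[P]_y \int[P]_x (h l (x, y) ^+ 2).

(* Coincidences of undirected edges between distinct cycles. *)
Definition collisions : nat :=
  \sum_(a < n) \sum_(l < d) \sum_(l' < d)
    ((l != l') && ((tau l a == tau l' a) || (tau l' (tau l a) == a))).

(** Let [ga] be the vertex term, [xi l] the outgoing and [eta l] the incoming edges. By degeneracy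
    only [ga^2] and the [xi l ^2] have nonzero mean, unless an outgoing edge joins the same two
    vertices as an edge of another cycle. Within one cycle [tau2] excludes this coincidence. *)
Lemma exp_zeta_rho a :
  `|\int[Pr]_w (zeta a w * rho a w) - sig2| <=
   2 * B ^+ 2 * (\sum_(l < d) \sum_(l' < d)
    ((l != l') && ((tau l a == tau l' a) || (tau l' (tau l a) == a))))%:R.
Proof.
pose xi l w := h l (X a w, X (tau l a) w).
pose eta l w := h l (X ((tau l)^-1%g a) w, X a w).
pose ga w := g (X a w).
have bxi l : bmeas (xi l) by exact: bmeas_pair.
have beta l : bmeas (eta l) by exact: bmeas_pair.
have bga : bmeas ga by exact: (bmeas_comp bg).
have e : (fun w => zeta a w * rho a w) = (fun w => ga w ^+ 2 +
    (\sum_l (2 * (xi l w * ga w) + eta l w * ga w) +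
     \sum_l \sum_l' (xi l w * xi l' w + xi l w * eta l' w))).

  apply/funext => w; rewrite /rho /zeta.
  rewrite (_ : \sum_l \sum_l' _ = (\sum_l xi l w) * (\sum_l xi l w + \sum_l eta l w)); last first.
    rewrite -big_split big_distrlr/=; apply: eq_bigr => l _; apply: eq_bigr => l' _.
    by rewrite mulrDr.
  rewrite (_ : \sum_l (2 * (xi l w * ga w) + _) =
    2 * ((\sum_l xi l w) * ga w) + (\sum_l eta l w) * ga w); last first.
    by rewrite big_split/= -mulr_sumr -!mulr_suml.
  by rewrite /ga; set A := \sum_l xi l w; set C := \sum_l eta l w; ring.
have ne l : ((tau l a : 'I_n) : nat) != a by apply: contraNneq (tau1 l a) => /val_inj ->.
have neV l : (((tau l)^-1%g a : 'I_n) : nat) != a.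
  apply/negP => /eqP/val_inj e'; have := tau1 l a.
  by rewrite -[in X in X != _]e' permKV eqxx.
(* By symmetry the far endpoint [X (tau l a)] can be the one integrated out; absent a coincidence,
   the other factor does not involve it. *)
have xsw l w : xi l w = h l (X (tau l a) w, X a w) by rewrite /xi hsym.
have bgaJ (i : nat) : i != a -> bmeas (ga : subsigma X [set j | j != i] -> R).
  by move=> ia; apply: bmeas_var1 => //=; rewrite eq_sym.
have xi_ga l : \int[Pr]_w (xi l w * ga w) = 0.
  under eq_Rintegral do rewrite xsw.
  by apply: exp_hV => //; apply: bgaJ.
have eta_ga l : \int[Pr]_w (eta l w * ga w) = 0.
  by apply: exp_hV => //; apply: bgaJ.
pose m l := \int[P]_y \int[P]_x (h l (x, y) ^+ 2).
have xi_xi l : \int[Pr]_w (xi l w * xi l w) = m l.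
  have bh2 : bmeas (fun z => h l z ^+ 2) by bm.
  rewrite /m -(exp_pair _ bh2 (i := a) (j := tau l a)); last by rewrite eq_sym.
  by apply: eq_Rintegral => w _; rewrite expr2.
have Bb (F1 F2 : Om -> R) : bmeas F1 -> bmeas F2 -> (forall w, `|F1 w| <= B) ->
    (forall w, `|F2 w| <= B) -> `|\int[Pr]_w (F1 w * F2 w)| <= B ^+ 2.
  move=> b1 b2 h1 h2; apply: exp_bound; first by bm.
  by move=> w; rewrite normrM expr2 ler_pM.
have xi_xi' l l' : tau l a != tau l' a -> \int[Pr]_w (xi l w * xi l' w) = 0.
  move=> ll'; under eq_Rintegral do rewrite xsw.
  apply: exp_hV => //; apply: bmeas_var2 => //=; first by rewrite eq_sym.
  by apply: contraNneq ll' => /val_inj ->.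
have xi_eta l l' : tau l' (tau l a) != a -> \int[Pr]_w (xi l w * eta l' w) = 0.
  move=> ll'; under eq_Rintegral do rewrite xsw.
  apply: exp_hV => //; apply: bmeas_var2 => //=; last by rewrite eq_sym.
  by apply: contraNneq ll' => /val_inj <-; rewrite permKV.
rewrite e expD; [|by bm|by bm].
rewrite expD; [|by bm|by bm].
rewrite (_ : \int[Pr]_w ga w ^+ 2 = \int[P]_x (g x ^+ 2)); last first.
  by rewrite -(exp_var a (f := fun x => g x ^+ 2))//; bm.
rewrite exp_sum; last by move=> l _; bm.
rewrite [X in _ + (X + _) - _]big1 ?add0r; last first.
  by move=> l _; rewrite expD ?expZ ?xi_ga ?eta_ga ?mulr0 ?addr0//; bm.
rewrite /sig2 opprD addrACA subrr add0r exp_sum; last by move=> l _; bm.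
rewrite -sumrB natr_sum mulr_sumr.
apply: le_trans (ler_norm_sum _ _ _) _; apply: ler_sum => l _.
rewrite exp_sum; last by move=> l' _; bm.
rewrite (_ : \int[P]_y _ = \sum_(l' < d) (l == l')%:R * m l); last first.
  rewrite (bigD1 l)//= eqxx mul1r big1 ?addr0// => l' /negbTE ll'.
  by rewrite eq_sym ll' mul0r.
rewrite -sumrB natr_sum mulr_sumr.
apply: le_trans (ler_norm_sum _ _ _) _; apply: ler_sum => l' _.
rewrite expD; [|by bm|by bm].
have [<-|ll'] := eqVneq l l'.
  by rewrite mul1r xi_xi xi_eta// addr0 subrr normr0 /= mulr0.
(* A coincidence costs at most [B^2] for [xi xi'] and [B^2] for [xi eta']. *)
rewrite mul0r subr0 /=; case: orP => [_|hc].
  rewrite mulr1; apply: le_trans (ler_normD _ _) _.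
  have hx l1 w : `|xi l1 w| <= B by exact: hB.
  have := Bb _ _ (bxi l) (bxi l') (hx l) (hx l').
  have := Bb _ _ (bxi l) (beta l') (hx l) (fun w => hB l' _).
  lra.
rewrite mulr0 xi_xi' ?xi_eta ?addr0 ?normr0//.
- by apply/negP => /eqP h'; apply: hc; right; rewrite h'.
- by apply/negP => /eqP h'; apply: hc; left; rewrite h'.
Qed.

Let kap : R := #|{: option ('I_d * bool)}|%:R.

(** Fluctuation plus bias: [zeta a * rho a] depends on the neighbours of [a] only, so [V] has
    variance O(1/n), and its mean misses [sig2] by the collisions. *)
Lemma exp_norm_V :
  \int[Pr]_w `|V w - sig2| <=
    (1 + kap ^+ 2 * (2 * (Z * Y)) ^+ 2) / 2 / rn + 2 * B ^+ 2 * collisions%:R / n%:R.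
Proof.
have nn : (n%:R : R) != 0 by rewrite pnatr_eq0 -lt0n.
have rnn : rn != 0 by rewrite gt_eqF.
have n0' : 0 < n%:R :> R by rewrite ltr0n.
have UB a w : `|zeta a w * rho a w| <= Z * Y.
  by rewrite normrM ler_pM//; [exact: zeta_le|exact: rho_le].
have vl := @var_local_dependence _ _ _ _ _ Pr X mX PR n _ nbr
  (fun a w => zeta a w * rho a w) (Z * Y)
  (fun a => bmeasM (bmeas_zeta_sub a) (bmeas_rho_sub a)) UB.
rewrite -/kap in vl.
pose EV := \int[Pr]_w V w.
have EVE : EV = n%:R^-1 * \sum_a \int[Pr]_w (zeta a w * rho a w).
  by rewrite /EV /V expZ ?exp_sum//; [move=> a _; bm|bm].
have v2 : \int[Pr]_w ((V w - EV) ^+ 2) <= kap ^+ 2 * (2 * (Z * Y)) ^+ 2 / n%:R.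
  have -> : (fun w => (V w - EV) ^+ 2) = (fun w => n%:R^-1 ^+ 2 *
     (\sum_a (zeta a w * rho a w - \int[Pr]_w (zeta a w * rho a w))) ^+ 2).
    by apply/funext => w; rewrite EVE /V -mulrBr exprMn sumrB.
  rewrite expZ; last by bm.
  have h1 : 0 <= n%:R^-1 ^+ 2 :> R by rewrite sqr_ge0.
  apply: le_trans (ler_wpM2l h1 vl) _.
  by eqle; field.
(* This [c] balances the two terms of the bound for a variance of order 1/n. *)
have v1 := exp_norm_le_sqr (bmeasB bV (bmeas_cst EV)) (c := rn^-1) ltac:(by rewrite invr_gt0) v2.
have mb : `|EV - sig2| <= 2 * B ^+ 2 * collisions%:R / n%:R.
  have -> : sig2 = n%:R^-1 * \sum_(a < n) sig2.
    by rewrite sumr_const card_ord -[sig2 *+ n]mulr_natl mulrA mulVf// mul1r.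
  rewrite EVE -mulrBr -sumrB normrM gtr0_norm ?invr_gt0// [leRHS]mulrC.
  rewrite ler_pM2l ?invr_gt0// /collisions natr_sum mulr_sumr.
  apply: le_trans (ler_norm_sum _ _ _) _; apply: ler_sum => a _.
  exact: exp_zeta_rho.
apply: (@le_trans _ _ (\int[Pr]_w (`|V w - EV| + `|EV - sig2|))).
  apply: exp_le; [by bm|by bm|] => w.
  by rewrite (le_trans _ (ler_normD _ _))// addrA subrK.
rewrite expD ?exp_cst; [|by bm|by bm].
rewrite lerD//; apply: le_trans v1 _; rewrite -rn2.
by eqle; field.
Qed.

(** It controls the second-order error of each Euler step, and later the tightness of the linear
    statistics. *)
Lemma exp_tstat_sqr : \int[Pr]_w (tstat w ^+ 2) <= kap ^+ 2 * (2 * Z) ^+ 2.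
Proof.
have nn : (n%:R : R) != 0 by rewrite pnatr_eq0 -lt0n.
have vl := @var_local_dependence _ _ _ _ _ Pr X mX PR n _ nbr
  zeta Z bmeas_zeta_sub zeta_le.
have Ez a : \int[Pr]_w zeta a w = 0.
  have := @exp_zetaV a (fun=> 1) (bmeas_cst 1).
  by under eq_Rintegral do rewrite mulr1.
have -> : (fun w => tstat w ^+ 2) = (fun w => n%:R^-1 *
    (\sum_a (zeta a w - \int[Pr]_w zeta a w)) ^+ 2).
  apply/funext => w; rewrite /tstat exprMn exprVn [rn ^+ 2]expr2 rn2.
  by under [in RHS]eq_bigr do rewrite Ez subr0.
rewrite expZ; last by bm.
have h1 : 0 <= n%:R^-1 :> R by rewrite invr_ge0.
apply: le_trans (ler_wpM2l h1 vl) _.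
by eqle; rewrite -/kap; field.
Qed.

(** One contribution each from the linearization, the fluctuation of [V] and the collisions. It
    depends on [d] and [B] alone, so the bounds are uniform in [n] and in the permutations. *)
Definition stein_const : R := 2 * Z * Y ^+ 2 +
  (1 + kap ^+ 2 * (2 * (Z * Y)) ^+ 2) / 2 + 2 * B ^+ 2.

Lemma stein_identity (u th : R) : 0 <= u <= 1 ->
  `|\int[Pr]_w (tstat w * sin (u * tstat w + th))
    - u * (sig2 * \int[Pr]_w cos (u * tstat w + th))|
  <= stein_const * (rn^-1 + collisions%:R / n%:R).
Proof.
move=> /andP[u0 u1].
have bs : bmeas (fun w => sin (u * tstat w + th)) by apply: bmeas_sin; exact: bT.1.
have bc : bmeas (fun w => cos (u * tstat w + th)) by apply: bmeas_cos; exact: bT.1.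
have h1 := stein_linearization u th.
have h2 : `|\int[Pr]_w (V w * cos (u * tstat w + th)) -
     sig2 * \int[Pr]_w cos (u * tstat w + th)| <= \int[Pr]_w `|V w - sig2|.
  rewrite -expZ// -expB; [|by bm|by bm].
  apply: le_trans (exp_norm _ _) _; first by bm.
  apply: exp_le; [by bm|by bm|] => w; rewrite -mulrBl normrM ler_piMr//.
  by rewrite ler_norml cos_geN1 cos_le1.

have h3 := le_trans h2 exp_norm_V.
have Z0 : 0 <= Z by rewrite /Z mulr_ge0.
have Y0 : 0 <= Y by rewrite /Y addr_ge0// mulr_ge0.
have p0 : 0 <= rn^-1 by rewrite invr_ge0 ltW.
have c0 : 0 <= collisions%:R / n%:R :> R by rewrite divr_ge0.
have a0 : 0 <= 2 * Z * Y ^+ 2 by rewrite mulr_ge0 ?mulr_ge0// exprn_ge0.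
have b0 : 0 <= (1 + kap ^+ 2 * (2 * (Z * Y)) ^+ 2) / 2.
  by rewrite divr_ge0// addr_ge0// mulr_ge0// sqr_ge0.
have e0 : 0 <= 2 * B ^+ 2 by rewrite mulr_ge0// sqr_ge0.
have h4 : `|u * (\int[Pr]_w (V w * cos (u * tstat w + th))) -
    u * (sig2 * \int[Pr]_w cos (u * tstat w + th))| <=
   (1 + kap ^+ 2 * (2 * (Z * Y)) ^+ 2) / 2 / rn + 2 * B ^+ 2 * collisions%:R / n%:R.
  rewrite -mulrBr normrM (ger0_norm u0); apply: le_trans h3.
  by rewrite ler_piMl.
rewrite /stein_const.
have h5 : 2 * u ^+ 2 * Z * Y ^+ 2 / rn <= 2 * Z * Y ^+ 2 / rn.
  rewrite (_ : 2 * u ^+ 2 * Z * Y ^+ 2 / rn = u ^+ 2 * (2 * Z * Y ^+ 2 / rn)); last by ring.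
  by rewrite ler_piMl ?mulr_ge0// expr_le1.
have := ler_distD (u * (\int[Pr]_w (V w * cos (u * tstat w + th))))
  (\int[Pr]_w (tstat w * sin (u * tstat w + th)))
  (u * (sig2 * \int[Pr]_w cos (u * tstat w + th))).
move: h1 h4 h5; rewrite -[2 * B ^+ 2 * _ / _]mulrA.
move: (2 * Z * Y ^+ 2) ((1 + kap ^+ 2 * (2 * (Z * Y)) ^+ 2) / 2) (2 * B ^+ 2) (rn^-1)
  (collisions%:R / n%:R) a0 b0 e0 p0 c0 => a b e p c a0 b0 e0 p0 c0.
move=> h1 h4 h5 h6.
have := mulr_ge0 a0 c0; have := mulr_ge0 b0 c0; have := mulr_ge0 e0 p0.
lra.
Qed.

(* Euler's scheme for [c' = - u sig2 c], the equation satisfied by the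
   characteristic function up to the error in [stein_identity]. *)
Lemma charfun_clt (th : R) :
  `|\int[Pr]_w cos (tstat w + th) - cos th * expR (- (sig2 / 2))|
    <= stein_const * (rn^-1 + collisions%:R / n%:R).
Proof.
pose eps := stein_const * (rn^-1 + collisions%:R / n%:R).
pose D := kap ^+ 2 * (2 * Z) ^+ 2.
have s0 : 0 <= sig2.
  rewrite /sig2 addr_ge0//; first by apply: exp_ge0 => x; rewrite sqr_ge0.
  rewrite sumr_ge0// => l _; apply: exp_ge0 => y; apply: exp_ge0 => x; exact: sqr_ge0.
pose c u := \int[Pr]_w cos (u * tstat w + th).
pose ga u := cos th * expR (- (sig2 * u ^+ 2 / 2)).
pose C := 2 * D + (sig2 / 2 + (2 * sig2) ^+ 2).
have bs u : bmeas (fun w => sin (u * tstat w + th)) by apply: bmeas_sin; exact: bT.1.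
have bc u : bmeas (fun w => cos (u * tstat w + th)) by apply: bmeas_cos; exact: bT.1.
(* The derivative of [c] at [u] is [- E (T sin (u T + th))], which [stein_identity] replaces by
   [- u sig2 c u]; the second moment bounds the Taylor remainder. *)
have stepc u hh : 0 <= u <= 1 -> 0 <= hh ->
    `|c (u + hh) - c u * (1 - hh * sig2 * u)| <= hh * eps + 2 * D * hh ^+ 2.
  move=> u01 hh0.
  have t1 : `|c (u + hh) - c u + hh * \int[Pr]_w (tstat w * sin (u * tstat w + th))|
      <= 2 * D * hh ^+ 2.
    rewrite -expB// -expZ; [|by bm]; rewrite -expD; [|by bm|by bm].
    apply: le_trans (exp_norm _ _) _; first by bm.
    apply: (@le_trans _ _ (\int[Pr]_w (2 * hh ^+ 2 * tstat w ^+ 2))).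
      apply: exp_le; [by bm|by bm|] => w.
      have := cos_taylor1 (u * tstat w + th) (hh * tstat w).
      rewrite exprMn (_ : u * tstat w + th + hh * tstat w = (u + hh) * tstat w + th); last by ring.
      by rewrite !mulrA.
    rewrite expZ; last by bm.
    have := exp_tstat_sqr; rewrite -/D => h1.
    by rewrite [2 * D * _]mulrAC ler_wpM2l// mulr_ge0// sqr_ge0.
  have t2 := stein_identity th u01; rewrite -/eps -/(c u) in t2.
  have t3 : `|hh * \int[Pr]_w (tstat w * sin (u * tstat w + th)) - hh * (u * (sig2 * c u))|
      <= hh * eps by rewrite -mulrBr normrM (ger0_norm hh0) ler_wpM2l.
  move: t1 t3; set A := hh * \int[Pr]_w _ => t1 t3.
  have -> : c (u + hh) - c u * (1 - hh * sig2 * u) =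
    (c (u + hh) - c u + A) - (A - hh * (u * (sig2 * c u))) by ring.
  by apply: le_trans (ler_normB _ _) _; lra.
have stepg u hh : 0 <= u <= 1 -> 0 <= hh <= 1 ->
    `|ga (u + hh) - ga u * (1 - hh * sig2 * u)| <= (sig2 / 2 + (2 * sig2) ^+ 2) * hh ^+ 2.
  move=> /andP[u0 u1] /andP[hh0 hh1].
  pose x := sig2 * (u * hh + hh ^+ 2 / 2).
  have hu : u * hh <= hh by rewrite ler_piMl.
  have hs : hh ^+ 2 <= hh by rewrite expr2 ler_piMl.
  have x0 : 0 <= x by rewrite mulr_ge0// addr_ge0// ?mulr_ge0// ?divr_ge0// sqr_ge0.
  have xl : x <= 2 * sig2 * hh by rewrite /x; nra.
  have -> : ga (u + hh) = ga u * expR (- x).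
    by rewrite /ga -[RHS]mulrA -expRD; congr (_ * expR _); rewrite /x; field.
  rewrite -mulrBr normrM.
  have g1 : `|ga u| <= 1.
    rewrite /ga normrM -[1]mulr1 ler_pM//.
      by rewrite ler_norml cos_geN1 cos_le1.
    by rewrite ger0_norm ?expR_ge0// -[leRHS]expR0 ler_expR oppr_le0 divr_ge0// mulr_ge0// sqr_ge0.
  apply: (@le_trans _ _ `|expR (- x) - (1 - hh * sig2 * u)|); first by rewrite ler_piMl.
  have -> : expR (- x) - (1 - hh * sig2 * u) = (expR (- x) - (1 - x)) - sig2 / 2 * hh ^+ 2.
    by rewrite /x; field.
  apply: le_trans (ler_normB _ _) _.
  rewrite [X in _ + X <= _]ger0_norm; last by rewrite mulr_ge0// ?divr_ge0// sqr_ge0.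
  have := expRN_taylor1 x0.
  have : x ^+ 2 <= (2 * sig2 * hh) ^+ 2 by rewrite ler_sqr// nnegrE (le_trans x0).
  rewrite exprMn; lra.
(* [sig2 <= m] keeps the factor [1 - hh sig2 u] in [0, 1], so the one-step errors add up without
   amplification. *)
have main (m : nat) : (0 < m)%N -> sig2 <= m%:R -> forall k, (k <= m)%N ->
    `|c (k%:R / m%:R) - ga (k%:R / m%:R)| <= (k%:R / m%:R) * (eps + C / m%:R).
  move=> m0 sm; have m0' : 0 < m%:R :> R by rewrite ltr0n.
  have mm : (m%:R : R) != 0 by rewrite gt_eqF.
  elim=> [|k IH] km.
    rewrite !mul0r /c /ga expr0n/= mulr0 mul0r oppr0 expR0 mulr1.
    under eq_Rintegral do rewrite mul0r add0r.
    by rewrite exp_cst subrr normr0.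
  have {}IH := IH (ltnW km).
  pose u : R := k%:R / m%:R; pose hh : R := m%:R^-1.
  have u01 : 0 <= u <= 1.
    by rewrite /u divr_ge0//= ler_pdivrMr// mul1r ler_nat ltnW.
  have hh01 : 0 <= hh <= 1.
    by rewrite /hh invr_ge0 ler0n/= invf_le1// ler1n.
  have -> : k.+1%:R / m%:R = u + hh by rewrite /u /hh -natr1 mulrDl mul1r.
  have h1 := stepc u hh u01 (andP hh01).1.
  have h2 := stepg u hh u01 hh01.
  have [u0 u1] := andP u01; have [hh0 hh1] := andP hh01.
  have h3 : `|1 - hh * sig2 * u| <= 1.
    have hsle : hh * sig2 <= 1 by rewrite /hh mulrC ler_pdivrMr// mul1r.
    have hsu : 0 <= hh * sig2 * u <= 1.
      by rewrite !mulr_ge0//= mulr_ile1// mulr_ge0.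
    by rewrite ger0_norm; move: hsu => /andP[]; lra.
  have h4 : `|c u * (1 - hh * sig2 * u) - ga u * (1 - hh * sig2 * u)| <= u * (eps + C / m%:R).
    by rewrite -mulrBl normrM; apply: le_trans IH; rewrite ler_piMr.
  have -> : c (u + hh) - ga (u + hh) = (c (u + hh) - c u * (1 - hh * sig2 * u)) +
     (c u * (1 - hh * sig2 * u) - ga u * (1 - hh * sig2 * u)) -
     (ga (u + hh) - ga u * (1 - hh * sig2 * u)) by ring.
  apply: le_trans (ler_normB _ _) _; apply: le_trans (lerD (ler_normD _ _) (lexx _)) _.
  have e : C / m%:R * hh = C * hh ^+ 2 by rewrite /hh; field.
  have -> : (u + hh) * (eps + C / m%:R) = u * (eps + C / m%:R) + (hh * eps + C * hh ^+ 2).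
    by rewrite -e; ring.
  have eC : C * hh ^+ 2 = 2 * D * hh ^+ 2 + (sig2 / 2 + (2 * sig2) ^+ 2) * hh ^+ 2.
    by rewrite /C mulrDl.
  by rewrite eC; lra.
apply/ler_addgt0Pr => e e0.
(* The number of steps is unrelated to [n]: taken large enough, it makes the discretization error
   negligible and leaves [eps]. *)
have [m [m0 m1 m2]] : exists m : nat, [/\ (0 < m)%N, sig2 <= m%:R & C / m%:R <= e].
  pose m := (Num.truncn (Num.max sig2 (`|C| / e))).+1.
  have hm : Num.max sig2 (`|C| / e) <= m%:R.
    by apply: ltW; rewrite /m truncnS_gt.
  exists m; split => //.
    by apply: le_trans hm; rewrite le_max lexx.
  rewrite ler_pdivrMr ?ltr0n//; apply: le_trans (ler_norm _) _.
  by rewrite mulrC -ler_pdivrMr//; apply: le_trans hm; rewrite le_max lexx orbT.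
have := main m m0 m1 m (leqnn m).
rewrite divff ?pnatr_eq0 -?lt0n// mul1r /c /ga expr1n mulr1.
under eq_Rintegral do rewrite mul1r.
by move=> /le_trans; apply; rewrite lerD2l.
Qed.

End SteinCycles.

(** * Successor maps of random cycles *)

Section CyclePermutations.
Variable n : nat.

(** A conjugate of the standard n-cycle: the successor of observation [a] in the cyclic order. It
    turns sums over positions into sums over observations. *)
Definition cycle_perm (s : {perm 'I_n}) : {perm 'I_n} :=
  (s^-1 * perm (@ordS_inj n) * s)%g.

Lemma cycle_permE s a : cycle_perm s a = s (ordS (s^-1%g a)).
Proof. by rewrite /cycle_perm !permM permE. Qed.

Lemma cycle_perm_image s i : cycle_perm s (s i) = s (ordS i).
Proof. by rewrite cycle_permE permK. Qed.

Lemma cycle_perm_neq s a : (1 < n)%N -> cycle_perm s a != a.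
Proof.
move=> n1; rewrite cycle_permE -[X in _ != X](permKV s) (inj_eq perm_inj).
rewrite -val_eqE /=; move: (s^-1%g a) => [i /= hi].
have [h|h] := ltnP i.+1 n; first by rewrite modn_small//; lia.
have -> : i.+1 = n by lia.
by rewrite modnn; lia.
Qed.

(** In a cycle of length 2 the successor is also the predecessor, hence the threshold on [n]. *)
Lemma cycle_perm2_neq s a : (2 < n)%N -> cycle_perm s (cycle_perm s a) != a.
Proof.
move=> n2; rewrite cycle_permE [in X in s X](cycle_permE s a) permK.
rewrite -[X in _ != X](permKV s) (inj_eq perm_inj).
rewrite -val_eqE /=; move: (s^-1%g a) => [i /= hi].
have [h|h] := ltnP i.+1 n.
  rewrite (modn_small h); have [h'|h'] := ltnP i.+2 n; first by rewrite modn_small//; lia.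
  have -> : i.+2 = n by lia.
  by rewrite modnn; lia.
have -> : i.+1 = n by lia.
by rewrite modnn modn_small; lia.
Qed.

(* Conjugation by a transposition fixing [a] permutes the possible successors of
   [a], which are therefore equally frequent. *)
Lemma sum_cycle_perm (a b : 'I_n) : a != b ->
  (n.-1 * \sum_(s : {perm 'I_n}) (cycle_perm s a == b) = n`!)%N.
Proof.
move=> ab.
have n1 : (1 < n)%N.
  move: ab; rewrite -val_eqE/= => ab; have := ltn_ord a; have := ltn_ord b; lia.
have same b' : a != b' ->
    (\sum_(s : {perm 'I_n}) (cycle_perm s a == b') =
     \sum_(s : {perm 'I_n}) (cycle_perm s a == b))%N.
  move=> ab'; rewrite (reindex_inj (@mulIg _ (tperm b b')))/=; apply: eq_bigr => s _.
  have ta : tperm b b' a = a by rewrite tpermD// eq_sym.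
  have e : cycle_perm (s * tperm b b')%g a = tperm b b' (cycle_perm s a).
    by rewrite !cycle_permE invMg tpermV !permM ta.
  by rewrite e -(inj_eq (@perm_inj _ (tperm b b'))) tpermK tpermR.
have -> : n`! = (\sum_(b' : 'I_n) \sum_(s : {perm 'I_n}) (cycle_perm s a == b'))%N.
  rewrite exchange_big/= -(card_Sn n) -sum1_card; apply: eq_bigr => s _.
  by rewrite (bigD1 (cycle_perm s a))//= eqxx big1 ?addn0// => b' /negbTE; rewrite eq_sym => ->.
rewrite [RHS](bigD1 a)//= [X in _ = (X + _)%N]big1 ?add0n; last first.
  by move=> s _; rewrite (negbTE (cycle_perm_neq s a n1)).
rewrite (eq_bigr (fun=> \sum_(s : {perm 'I_n}) (cycle_perm s a == b))%N); last first.
  by move=> b'; rewrite eq_sym; exact: same.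
rewrite sum_nat_const; congr (_ * _)%N.
by have := cardC1 a; rewrite card_ord => <-; apply: eq_card.
Qed.

End CyclePermutations.

(** * Average number of shared edges *)

Section CollisionAverage.
Context {R : realType}.

(** The expectation over [d] independent uniform draws from [T]. *)
Definition ffavg (T : finType) (d : nat) (F : {ffun 'I_d -> T} -> R) : R :=
  (#|T|%:R ^+ d)^-1 * \sum_(s : {ffun 'I_d -> T}) F s.

Lemma ffavg_sum (T I : finType) d (F : I -> {ffun 'I_d -> T} -> R) :
  ffavg (fun s => \sum_i F i s) = \sum_i ffavg (F i).
Proof. by rewrite /ffavg exchange_big/= mulr_sumr. Qed.

Lemma ffavg_le (T : finType) d (F G : {ffun 'I_d -> T} -> R) :
  (forall s, F s <= G s) -> ffavg F <= ffavg G.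
Proof.
by move=> FG; rewrite /ffavg ler_wpM2l ?invr_ge0 ?exprn_ge0//; exact: ler_sum.
Qed.

Lemma ffavgZ (T : finType) d c (F : {ffun 'I_d -> T} -> R) :
  ffavg (fun s => c * F s) = c * ffavg F.
Proof. by rewrite /ffavg -mulr_sumr mulrCA. Qed.

Lemma ffavgD (T : finType) d (F G : {ffun 'I_d -> T} -> R) :
  ffavg (fun s => F s + G s) = ffavg F + ffavg G.
Proof. by rewrite /ffavg big_split/= mulrDr. Qed.

Lemma ffavg_cst (T : finType) d c : (0 < #|T|)%N ->
  ffavg (fun _ : {ffun 'I_d -> T} => c) = c.
Proof.
move=> T0; rewrite /ffavg sumr_const card_ffun card_ord -[c *+ _]mulr_natl natrX.
by rewrite mulKf// expf_neq0// pnatr_eq0 -lt0n.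
Qed.

Lemma ffavg_norm (T : finType) d (F : {ffun 'I_d -> T} -> R) :
  `|ffavg F| <= ffavg (fun s => `|F s|).
Proof.
rewrite /ffavg normrM ger0_norm ?invr_ge0 ?exprn_ge0// ler_wpM2l ?invr_ge0 ?exprn_ge0//.
exact: ler_norm_sum.
Qed.

Lemma ffavg_pair (T : finType) d (l l' : 'I_d) (f g : T -> R) :
  (0 < #|T|)%N -> l != l' ->
  ffavg (fun s : {ffun 'I_d -> T} => f (s l) * g (s l')) =
  (#|T|%:R^-1 * \sum_t f t) * (#|T|%:R^-1 * \sum_t g t).
Proof.
move=> T0 ll'; have T0' : (#|T|%:R : R) != 0 by rewrite pnatr_eq0 -lt0n.
(* Factors 1 at the other coordinates turn the integrand into a full product, to which
   distributivity applies. *)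
pose F (k : 'I_d) (t : T) : R := if k == l then f t else if k == l' then g t else 1.
rewrite /ffavg (eq_bigr (fun s : {ffun 'I_d -> T} => \prod_k F k (s k))); last first.
  move=> s _; rewrite (bigD1 l)//= (bigD1 l')/=; last by rewrite eq_sym.
  rewrite big1 ?mulr1; last first.
    by move=> k /andP[kl kl']; rewrite /F (negbTE kl) (negbTE kl').
  by rewrite /F eqxx [l' == l]eq_sym (negbTE ll') eqxx.
rewrite -(bigA_distr_bigA F)/=.
have -> : (#|T|%:R ^+ d : R)^-1 = \prod_(k < d) #|T|%:R^-1.
  by rewrite prodr_const card_ord exprVn.
rewrite -big_split/= (bigD1 l)//= (bigD1 l')/=; last by rewrite eq_sym.
rewrite [X in _ * (_ * X)]big1 ?mulr1; last first.
  move=> k /andP[kl kl']; rewrite /F (negbTE kl) (negbTE kl') sumr_const.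
  by rewrite -[X in _ * X]mulr_natl mulr1 mulVf.
by rewrite /F eqxx [l' == l]eq_sym (negbTE ll') eqxx.
Qed.

(** Two independent cycles give [a] the same successor with probability [(n - 1) / (n - 1)^2], and
    likewise for a reversed edge. Summing over [a], [l], [l'] yields at most [2 n d^2 / (n - 1)],
    and [n <= 2 (n - 1)]. *)
Lemma ffavg_collisions n d : (1 < n)%N ->
  ffavg (fun s : {ffun 'I_d -> {perm 'I_n}} =>
    (collisions (fun l => cycle_perm (s l)))%:R) <= 4 * d%:R ^+ 2.
Proof.
move=> n1; have n1' : 0 < n.-1%:R :> R by rewrite ltr0n; lia.
have S0 : (0 < #|{perm 'I_n}|)%N by rewrite card_Sn fact_gt0.
have avg1 (a b : 'I_n) : #|{perm 'I_n}|%:R^-1 * \sum_(s : {perm 'I_n}) (cycle_perm s a == b)%:R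
    = (a != b)%:R / n.-1%:R :> R.
  have [<-|ab] /= := eqVneq a b.
    by rewrite big1 ?mulr0 ?mul0r// => s _; rewrite (negbTE (cycle_perm_neq s a n1)).
  have := sum_cycle_perm ab; rewrite -natr_sum -(card_Sn n) => e.
  have e' : n.-1%:R * (\sum_(s : {perm 'I_n}) (cycle_perm s a == b))%:R = #|{perm 'I_n}|%:R :> R.
    by rewrite -natrM e.
  rewrite -e'; set x := (\sum_s _)%:R.
  have x0 : x != 0.
    by apply/eqP => x0; move: e'; rewrite -/x x0 mulr0 => /esym/eqP; rewrite pnatr_eq0 -leqn0 leqNgt S0.
  by rewrite mul1r; field; rewrite x0 gt_eqF.
have bnd (l l' : 'I_d) (a : 'I_n) : l != l' ->
    ffavg (fun s : {ffun 'I_d -> {perm 'I_n}} =>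
      (cycle_perm (s l) a == cycle_perm (s l') a)%:R) <= n.-1%:R^-1 :> R.
  move=> ll'.
  have -> : (fun s : {ffun 'I_d -> {perm 'I_n}} =>
      (cycle_perm (s l) a == cycle_perm (s l') a)%:R : R) =
      (fun s => \sum_b (cycle_perm (s l) a == b)%:R * (cycle_perm (s l') a == b)%:R).
    apply/funext => s; rewrite (bigD1 (cycle_perm (s l) a))//= eqxx mul1r big1 ?addr0.
      by rewrite eq_sym.
    by move=> b; rewrite eq_sym => /negbTE ->; rewrite mul0r.
  rewrite ffavg_sum (eq_bigr (fun b => (a != b)%:R / n.-1%:R ^+ 2)); last first.
    move=> b _; rewrite (ffavg_pair (fun s => (cycle_perm s a == b)%:R)
      (fun s => (cycle_perm s a == b)%:R) S0 ll') avg1.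
    by case: (a != b); rewrite /= ?mul0r// !mul1r expr2 invfM.
  rewrite -mulr_suml -natr_sum (_ : (\sum_i _)%N = n.-1); first by eqle; field; rewrite gt_eqF.
  rewrite (bigD1 a)//= eqxx add0n (eq_bigr (fun=> 1%N)); last by move=> b; rewrite eq_sym => ->.
  by rewrite sum1_card; have := cardC1 a; rewrite card_ord => <-; apply: eq_card.
have bnd2 (l l' : 'I_d) (a : 'I_n) : l != l' ->
    ffavg (fun s : {ffun 'I_d -> {perm 'I_n}} =>
      (cycle_perm (s l') (cycle_perm (s l) a) == a)%:R) <= n.-1%:R^-1 :> R.
  move=> ll'.
  have -> : (fun s : {ffun 'I_d -> {perm 'I_n}} =>
      (cycle_perm (s l') (cycle_perm (s l) a) == a)%:R : R) =
      (fun s => \sum_b (cycle_perm (s l) a == b)%:R * (cycle_perm (s l') b == a)%:R).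
    apply/funext => s; rewrite (bigD1 (cycle_perm (s l) a))//= eqxx mul1r big1 ?addr0//.
    by move=> b; rewrite eq_sym => /negbTE ->; rewrite mul0r.
  rewrite ffavg_sum (eq_bigr (fun b => (a != b)%:R / n.-1%:R ^+ 2)); last first.
    move=> b _; rewrite (ffavg_pair (fun s => (cycle_perm s a == b)%:R)
      (fun s => (cycle_perm s b == a)%:R) S0 ll') !avg1 [b == a]eq_sym.
    by case: (a != b); rewrite /= ?mul0r// !mul1r expr2 invfM.
  rewrite -mulr_suml -natr_sum (_ : (\sum_i _)%N = n.-1); first by eqle; field; rewrite gt_eqF.
  rewrite (bigD1 a)//= eqxx add0n (eq_bigr (fun=> 1%N)); last by move=> b; rewrite eq_sym => ->.
  by rewrite sum1_card; have := cardC1 a; rewrite card_ord => <-; apply: eq_card.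
have e s : (collisions (fun l => cycle_perm (s l)))%:R = \sum_(a < n) \sum_(l < d) \sum_(l' < d)
    ((l != l') && ((cycle_perm (s l) a == cycle_perm (s l') a) ||
      (cycle_perm (s l') (cycle_perm (s l) a) == a)))%:R :> R.
  rewrite /collisions natr_sum; apply: eq_bigr => a _; rewrite natr_sum.
  by apply: eq_bigr => l _; rewrite natr_sum.
have -> := funext (fun s : {ffun 'I_d -> {perm 'I_n}} => e s).
rewrite ffavg_sum; under eq_bigr do rewrite ffavg_sum.
under eq_bigr do (under eq_bigr do rewrite ffavg_sum).
apply: (@le_trans _ _ (\sum_(a < n) \sum_(l < d) \sum_(l' < d) (2 / n.-1%:R))).
  apply: ler_sum => a _; apply: ler_sum => l _; apply: ler_sum => l' _.
  have [->|ll'] := eqVneq l l'.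
    rewrite /ffavg /= big1 ?mulr0// divr_ge0// ltW//.
  have := bnd l l' a ll'; have := bnd2 l l' a ll' => h2 h1.
  apply: (@le_trans _ _ (n.-1%:R^-1 + n.-1%:R^-1)); last by rewrite mulrDl mul1r.
  apply: le_trans (lerD h1 h2); rewrite -ffavgD; apply: ffavg_le => s /=.
  by case: (_ == _); case: (_ == _); rewrite /= ?addr0 ?add0r ?lerDl.
rewrite !sumr_const !card_ord -!mulrnA -[leLHS]mulr_natr !natrM.
rewrite mulrAC ler_pdivrMr//.
have : n%:R <= 2 * n.-1%:R :> R by rewrite -natrM ler_nat; lia.
have := sqr_ge0 (d%:R : R); rewrite expr2; nra.
Qed.

End CollisionAverage.

(** * Uniform approximation by trigonometric polynomials *)

Section CompactModulus.
Context {R : realType} {T : topologicalType}.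

Lemma continuous_bigsum (I : finType) (F : I -> T -> R) :
  (forall i, continuous (F i)) -> continuous (fun x => \sum_i F i x).
Proof.
move=> cF; elim: (index_enum I) => [|i r IH].
  by under eq_fun do rewrite big_nil; move=> x; exact: cvg_cst.
under eq_fun do rewrite big_cons.
by move=> x; apply: cvgD; [exact: cF|exact: IH].
Qed.

Lemma continuous_addr_fun (f g : T -> R) : continuous f -> continuous g ->
  continuous (fun x => f x + g x).
Proof. by move=> cf cg x; apply: cvgD; [exact: cf|exact: cg]. Qed.

Lemma continuous_subr_fun (f g : T -> R) : continuous f -> continuous g ->
  continuous (fun x => f x - g x).
Proof. by move=> cf cg x; apply: cvgB; [exact: cf|exact: cg]. Qed.

Lemma continuous_mulr_fun (f g : T -> R) : continuous f -> continuous g ->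
  continuous (fun x => f x * g x).
Proof. by move=> cf cg x; apply: cvgM; [exact: cf|exact: cg]. Qed.

Lemma continuous_normr_fun (f : T -> R) : continuous f -> continuous (fun x => `|f x|).
Proof. by move=> cf x; apply: cvg_norm; exact: cf. Qed.

Lemma continuous_cst_fun (c : R) : continuous (fun _ : T => c).
Proof. by move=> x; exact: cvg_cst. Qed.

Lemma continuous_sqr_diff (f g : T -> R) : continuous f -> continuous g ->
  continuous (fun x => (f x - g x) ^+ 2).
Proof.
move=> cf cg; under eq_fun do rewrite expr2.
have h x : (f t - g t) @[t --> x] --> f x - g x by apply: cvgB; [exact: cf|exact: cg].
by move=> x; apply: cvgM; exact: h.
Qed.

(** The pairs in [K] with [|f x - f y| >= e] form a compact set, on which [phi] has a positive
    minimum; [C] is [2 M] divided by it. A bound linear in [phi] can be averaged, unlike an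
    epsilon-delta modulus. *)
Lemma compact_modulus (K : set T) (f : T -> R) (phi : T * T -> R) (M e : R) :
  compact K -> continuous f -> continuous phi ->
  (forall x, `|f x| <= M) -> (forall z, 0 <= phi z) ->
  (forall x y, K x -> K y -> phi (x, y) = 0 -> x = y) -> 0 < e ->
  exists2 C : R, 0 <= C & forall x y, K x -> K y -> `|f x - f y| <= e + C * phi (x, y).
Proof.
move=> cK cf cphi fM phi0 inj e0.
pose F (z : T * T) := `|f z.1 - f z.2|.
have cF : continuous F.
  move=> z; apply: cvg_norm; apply: cvgB.
  - by apply: continuous_comp; [exact: cvg_fst|exact: cf].
  - by apply: continuous_comp; [exact: cvg_snd|exact: cf].
pose Z := (K `*` K) `&` [set z | e <= F z].
have cZ : compact Z.
  apply: compact_closedI; first exact: compact_setX.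
  have -> : [set z | e <= F z] = F @^-1` [set x | e <= x] by [].
  by apply: closed_comp; [move=> z _; exact: cF|exact: closed_ge].
have [Z0|/set0P Zn] := eqVneq Z set0.
  exists 0 => // x y Kx Ky; rewrite mul0r addr0 leNgt; apply/negP => h.
  by have : Z (x, y) by [split => //=; exact: ltW]; rewrite Z0.
have [[x0 y0] + hmin] := compact_EVT_min Zn cZ (continuous_subspaceT cphi).
move=> /set_mem[[/= Kx0 Ky0] hF].
have m0 : 0 < phi (x0, y0).
  rewrite lt_neqAle phi0 andbT eq_sym; apply/eqP => h.
  have E := inj _ _ Kx0 Ky0 h; move: hF; rewrite E /F/= subrr normr0.
  by rewrite leNgt e0.
have M0 : 0 <= M by exact: le_trans (fM x0).
exists (2 * M / phi (x0, y0)); first by rewrite divr_ge0// ?mulr_ge0// ltW.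
move=> x y Kx Ky; have [h|h] := leP `|f x - f y| e.
  by rewrite (le_trans h)// lerDl mulr_ge0// divr_ge0// ?mulr_ge0// ltW.
have hz : phi (x0, y0) <= phi (x, y).
  by apply: hmin; apply/mem_set; split => //=; exact: ltW.
apply: (@le_trans _ _ (2 * M)).
  by rewrite (le_trans (ler_normB _ _))// mulr_natl mulr2n lerD.
apply: (@le_trans _ _ (2 * M / phi (x0, y0) * phi (x, y))); last by rewrite lerDr ltW.
by rewrite mulrAC ler_pdivlMr// ler_wpM2l// mulr_ge0.
Qed.

End CompactModulus.

Section Bernstein.
Context {R : realType}.

(* Expectation of [phi] under the binomial distribution with parameters [m], [t]. *)
Fixpoint bern (m : nat) (t : R) (phi : nat -> R) : R :=
  if m is m'.+1 then (1 - t) * bern m' t phi + t * bern m' t (fun k => phi k.+1)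
  else phi 0%N.

Lemma bern_cst m t c : bern m t (fun=> c) = c.
Proof. by elim: m => //= m ->; ring. Qed.

Lemma bernD m t p q : bern m t (fun k => p k + q k) = bern m t p + bern m t q.
Proof. by elim: m p q => //= m IH p q; rewrite !IH; ring. Qed.

Lemma bernZ m t c p : bern m t (fun k => c * p k) = c * bern m t p.
Proof. by elim: m p => //= m IH p; rewrite !IH; ring. Qed.

Lemma bern_le m t p q : 0 <= t <= 1 -> (forall k, p k <= q k) ->
  bern m t p <= bern m t q.
Proof.
move=> /andP[t0 t1]; elim: m p q => //= m IH p q pq.
by rewrite lerD// ler_wpM2l ?subr_ge0// IH.
Qed.

(** At [c = - m t] this is the binomial variance; the free [c] absorbs the shift of [k] in the
    induction. *)
Lemma bern_sqr m t c :
  bern m t (fun k => (k%:R + c) ^+ 2) = (m%:R * t + c) ^+ 2 + m%:R * t * (1 - t).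
Proof.
elim: m c => [|m IH] c; first by rewrite /= !mul0r !add0r addr0.
rewrite /= IH.
have -> : (fun k : nat => (k.+1%:R + c) ^+ 2) = (fun k => (k%:R + (1 + c)) ^+ 2).
  by apply/funext => k; rewrite -natr1 addrA.
by rewrite IH -natr1; ring.
Qed.

Variable N : nat.

Definition upd (nu : 'I_N -> nat) (j : 'I_N) (k : nat) : 'I_N -> nat :=
  fun i => if i == j then k else nu i.

(** Independent binomial counts, integrated one coordinate of [js] at a time; coordinates outside
    [js] stay 0. *)
Fixpoint mbern (js : seq 'I_N) (m : nat) (t : 'I_N -> R) (phi : ('I_N -> nat) -> R) : R :=
  if js is j :: js' then bern m (t j) (fun k => mbern js' m t (fun nu => phi (upd nu j k)))
  else phi (fun=> 0%N).

Lemma mbern_cst js m t c : mbern js m t (fun=> c) = c.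
Proof.
elim: js => //= j js IH; rewrite -[RHS](bern_cst m (t j)); congr bern.
by apply/funext => k; rewrite IH.
Qed.

Lemma mbernD js m t p q :
  mbern js m t (fun nu => p nu + q nu) = mbern js m t p + mbern js m t q.
Proof.
elim: js p q => //= j js IH p q; rewrite -bernD; congr bern.
by apply/funext => k; rewrite IH.
Qed.

Lemma mbernZ js m t c p :
  mbern js m t (fun nu => c * p nu) = c * mbern js m t p.
Proof.
elim: js p => //= j js IH p; rewrite -bernZ; congr bern.
by apply/funext => k; rewrite IH.
Qed.

Lemma mbern_sum js m t (I : finType) (p : I -> ('I_N -> nat) -> R) :
  mbern js m t (fun nu => \sum_i p i nu) = \sum_i mbern js m t (p i).
Proof.
elim: (index_enum I) => [|i r IH].
  rewrite big_nil -[RHS](mbern_cst js m t); congr mbern.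
  by apply/funext => nu; rewrite big_nil.
rewrite big_cons -IH -mbernD; congr mbern.
by apply/funext => nu; rewrite big_cons.
Qed.

Lemma mbern_le js m t p q : (forall j, 0 <= t j <= 1) ->
  (forall nu, p nu <= q nu) -> mbern js m t p <= mbern js m t q.
Proof.
by move=> t01; elim: js p q => //= j js IH p q pq; apply: bern_le => // k; exact: IH.
Qed.

Lemma mbern_coord js m t j (psi : nat -> R) : j \in js -> uniq js ->
  mbern js m t (fun nu => psi (nu j)) = bern m (t j) psi.
Proof.
elim: js => //= i js IH; rewrite inE => /orP[/eqP <-|jjs] /andP[ijs ujs].
  congr bern; apply/funext => k; rewrite -[RHS](mbern_cst js m t); congr mbern.
  by apply/funext => nu; rewrite /upd eqxx.
have ij : j != i by apply: contraNneq ijs => <-.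
rewrite -[RHS](bern_cst m (t i)); congr bern; apply/funext => k.
rewrite -IH//; congr mbern; apply/funext => nu.
by rewrite /upd (negbTE ij).
Qed.

End Bernstein.

Section TrigApproximation.
Context {R : realType} {N : nat}.

Definition dotr (a x : 'rV[R]_N) : R := \sum_j a ord0 j * x ord0 j.

(** Cosines with a phase span the sines as well, and by the product formula they generate an
    algebra. *)
Inductive trig : ('rV[R]_N -> R) -> Prop :=
| trig_cos a th : trig (fun x => cos (dotr a x + th))
| trigD p q : trig p -> trig q -> trig (fun x => p x + q x)
| trigZ c p : trig p -> trig (fun x => c * p x).

Lemma dotrDl a b x : dotr (a + b) x = dotr a x + dotr b x.
Proof. by rewrite /dotr -big_split; apply: eq_bigr => j _; rewrite mxE mulrDl. Qed.

Lemma dotrNl a x : dotr (- a) x = - dotr a x.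
Proof. by rewrite /dotr -sumrN; apply: eq_bigr => j _; rewrite mxE mulNr. Qed.

Lemma dotr0l x : dotr 0 x = 0.
Proof. by rewrite /dotr big1// => j _; rewrite mxE mul0r. Qed.

Lemma trig_ext p q : trig p -> (forall x, p x = q x) -> trig q.
Proof. by move=> tp pq; have <- : p = q by apply/funext. Qed.

Lemma trig_cst c : trig (fun=> c).
Proof.
apply: (trig_ext (trigZ c (trig_cos 0 0))) => x.
by rewrite dotr0l add0r cos0 mulr1.
Qed.

Lemma trigM p q : trig p -> trig q -> trig (fun x => p x * q x).
Proof.
move=> tp; elim: tp q => {p} [a th|p1 p2 t1 IH1 t2 IH2|c p t IH] q tq; last 2 first.
- by apply: (trig_ext (trigD (IH1 _ tq) (IH2 _ tq))) => x; rewrite mulrDl.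
- by apply: (trig_ext (trigZ c (IH _ tq))) => x; rewrite mulrA.
elim: tq => {q} [b ph|p1 p2 t1 IH1 t2 IH2|c p t IH]; last 2 first.
- by apply: (trig_ext (trigD IH1 IH2)) => x; rewrite mulrDr.
- by apply: (trig_ext (trigZ c IH)) => x; rewrite mulrCA.
apply: (trig_ext (trigZ 2^-1 (trigD (trig_cos (a + b) (th + ph)) (trig_cos (a - b) (th - ph))))) => x.
rewrite !dotrDl dotrNl.
have -> : dotr a x + dotr b x + (th + ph) = (dotr a x + th) + (dotr b x + ph) by ring.
have -> : dotr a x - dotr b x + (th - ph) = (dotr a x + th) - (dotr b x + ph) by ring.
by rewrite cosD cosB; field.
Qed.

(** Not the cardinal sine, but a trigonometric stand-in for the coordinate [j] with values in
    [0, 1], as a binomial parameter requires. *)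
Definition sinc (c : R) (j : 'I_N) (x : 'rV[R]_N) : R := (1 + sin (c * x ord0 j)) / 2.

Lemma trig_sinc c j : trig (sinc c j).
Proof.
apply: (trig_ext (trigZ 2^-1 (trigD (trig_cst 1) (trig_cos (c *: delta_mx ord0 j) (- (pi / 2)))))) => x.
rewrite /dotr (bigD1 j)//= !mxE !eqxx mulr1 big1 ?addr0; last first.
  by move=> i /negbTE ij; rewrite !mxE eqxx ij mulr0 mul0r.
by rewrite /sinc cosBpihalf mulrC.
Qed.

Lemma sinc01 c j x : 0 <= sinc c j x <= 1.
Proof.
rewrite /sinc; have := sin_geN1 (c * x ord0 j); have := sin_le1 (c * x ord0 j).
by move=> h1 h2; apply/andP; split; lra.
Qed.

Lemma trig_bern m (t : 'rV[R]_N -> R) (F : nat -> 'rV[R]_N -> R) :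
  trig t -> (forall k, trig (F k)) -> trig (fun x => bern m (t x) (fun k => F k x)).
Proof.
move=> tt; elim: m F => [|m IH] F tF; first exact: (tF 0%N).
rewrite /=; apply: trigD; last by apply: trigM => //; exact: (IH (fun k => F k.+1)).
apply: trigM; last exact: IH.
by apply: (trig_ext (trigD (trig_cst 1) (trigZ (-1) tt))) => x; rewrite mulN1r.
Qed.

Lemma trig_mbern js m c (phi : ('I_N -> nat) -> R) :
  trig (fun x => mbern js m (sinc c ^~ x) phi).
Proof.
elim: js phi => [|j js IH] phi /=; first exact: trig_cst.
by apply: (@trig_bern m (sinc c j) (fun k x => mbern js m (sinc c ^~ x) (fun nu => phi (upd nu j k))))
  => [|k]; [exact: trig_sinc|exact: IH].
Qed.

Lemma coord_cont (j : 'I_N) : continuous (fun x : 'rV[R]_N => x ord0 j).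
Proof. by move=> x; exact: coord_continuous. Qed.

Lemma box_compact (L : R) : compact [set x : 'rV[R]_N | forall j, `|x ord0 j| <= L].
Proof.
have -> : [set x : 'rV[R]_N | forall j, `|x ord0 j| <= L] =
    [set x : 'rV[R]_N | forall j, `[- L, L]%classic (x ord0 j)].
  apply/seteqP; split=> x /= h j; have := h j; first by rewrite /= in_itv/= ler_norml.
  by rewrite /= in_itv/= ler_norml.
by apply: (@rV_compact R N (fun=> `[- L, L]%classic)) => j; exact: segment_compact.
Qed.

(* Bernstein polynomials in [(1 + sin (c x_j)) / 2] are trigonometric, and being
   averages of values of [f] they obey the same bound globally. *)
Lemma trig_approx (f : 'rV[R]_N -> R) (M L e : R) :
  continuous f -> (forall x, `|f x| <= M) -> 0 < L -> 0 < e ->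
  exists p, [/\ trig p, (forall x, `|p x| <= M) &
    forall x : 'rV[R]_N, (forall j, `|x ord0 j| <= L) -> `|p x - f x| <= e].
Proof.
move=> cf fM L0 e0.
have M0 : 0 <= M := le_trans (normr_ge0 _) (fM 0).
have pi0 : 0 < pi :> R := pi_gt0 R.
(* This scale maps [-L, L] onto [-pi/2, pi/2], where the sine is injective. *)
pose c := pi / 2 / L.
have c0 : 0 < c by rewrite !divr_gt0.
pose phi (z : 'rV[R]_N * 'rV[R]_N) := \sum_j (sinc c j z.1 - sinc c j z.2) ^+ 2.
have csinc j : continuous (fun x : 'rV[R]_N => (1 + sin (c * x ord0 j)) / 2).
  have cu : continuous (fun r : R => (1 + sin (c * r)) / 2).
    move=> r; apply: cvgM; last exact: cvg_cst.
    apply: cvgD; first exact: cvg_cst.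
    apply: continuous_comp; last exact: continuous_sin.
    by apply: cvgM; [exact: cvg_cst|exact: cvg_id].
  move=> x; apply: (@continuous_comp _ _ _ (fun x : 'rV[R]_N => x ord0 j)
    (fun r : R => (1 + sin (c * r)) / 2)); [exact: coord_continuous|exact: cu].
have cphi : continuous phi.
  apply: continuous_bigsum => j; apply: continuous_sqr_diff => z.
  - by apply: (@continuous_comp _ _ _ fst (sinc c j)); [exact: cvg_fst|exact: csinc].
  - by apply: (@continuous_comp _ _ _ snd (sinc c j)); [exact: cvg_snd|exact: csinc].
have phi0 z : 0 <= phi z by apply: sumr_ge0 => j _; exact: sqr_ge0.
have crange x : `|x| <= L -> - (pi / 2) <= c * x <= pi / 2.
  rewrite ler_norml => /andP[h1 h2].
  have cL : c * L = pi / 2 by rewrite /c divfK// gt_eqF.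
  have := ler_wpM2l (ltW c0) h1; have := ler_wpM2l (ltW c0) h2.
  by rewrite mulrN cL => -> ->.
pose K := [set x : 'rV[R]_N | forall j, `|x ord0 j| <= L].
have inj x y : K x -> K y -> phi (x, y) = 0 -> x = y.
  move=> Kx Ky h; apply/rowP => j.
  have : (sinc c j x - sinc c j y) ^+ 2 = 0.
    apply/eqP; move/eqP: h; rewrite /phi psumr_eq0; last by move=> i _; exact: sqr_ge0.
    by move=> /allP/(_ j); rewrite mem_index_enum => /(_ isT).
  move=> /eqP; rewrite sqrf_eq0 subr_eq0 => /eqP h1.
  have h2 : sin (c * x ord0 j) = sin (c * y ord0 j).
    by move: h1; rewrite /sinc => h1; lra.
  have : c * x ord0 j = c * y ord0 j by apply: sin_inj => //; rewrite in_itv/= crange.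
  by move=> /(mulfI (lt0r_neq0 c0)).
have e2 : 0 < e / 2 by rewrite divr_gt0.
have [C C0 hC] := compact_modulus (@box_compact L) cf cphi fM phi0 inj e2.
have [m m0 hm] : exists2 m : nat, (0 < m)%N & C * N%:R / m%:R <= e / 2.
  exists (Num.truncn (C * N%:R / (e / 2))).+1 => //.
  rewrite ler_pdivrMr ?ltr0n// [leRHS]mulrC -ler_pdivrMr//; apply: ltW.
  by rewrite truncnS_gt.
have m0' : 0 < m%:R :> R by rewrite ltr0n.
(* The point at which [sinc] takes the value [k / m]. Capping [k] at [m] provides a node for every
   natural number, since the inequalities under [mbern] are required for all counts. *)
pose y (k : nat) : R := asin (2 * (minn k m)%:R / m%:R - 1) / c.
have yr k : (minn k m)%:R / m%:R <= 1 :> R by rewrite ler_pdivrMr// mul1r ler_nat geq_minr.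
have yr0 k : 0 <= (minn k m)%:R / m%:R :> R by rewrite divr_ge0.
have yb k : -1 <= (2 * (minn k m)%:R / m%:R - 1 : R) <= 1.
  by rewrite -mulrA; apply/andP; split; have := yr k; have := yr0 k; lra.
have yK k : `|y k| <= L.
  have ci0 : 0 <= c^-1 by rewrite invr_ge0 ltW.
  rewrite /y normrM (ger0_norm ci0) ler_pdivrMr//.
  rewrite (_ : L * c = pi / 2); last by rewrite /c mulrC divfK// gt_eqF.
  by rewrite ler_norml asin_geNpi2// asin_lepi2.
pose node (nu : 'I_N -> nat) : 'rV[R]_N := \row_j y (nu j).
have Knode nu : K (node nu) by move=> j; rewrite mxE.
have snode nu j : sinc c j (node nu) = (minn (nu j) m)%:R / m%:R.
  rewrite /sinc mxE /y [c * _]mulrC divfK ?gt_eqF// asinK; last by rewrite in_itv/= yb.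
  by field; rewrite gt_eqF.
exists (fun x => mbern (enum 'I_N) m (sinc c ^~ x) (fun nu => f (node nu))); split.
- exact: trig_mbern.
- move=> x; rewrite ler_norml; apply/andP; split.
    rewrite -[leLHS](mbern_cst (enum 'I_N) m (sinc c ^~ x)); apply: mbern_le.
      by move=> j; exact: sinc01.
    by move=> nu; have := fM (node nu); rewrite ler_norml => /andP[].
  rewrite -[leRHS](mbern_cst (enum 'I_N) m (sinc c ^~ x)); apply: mbern_le.
    by move=> j; exact: sinc01.
  by move=> nu; have := fM (node nu); rewrite ler_norml => /andP[].
- move=> x Kx.
  (* The modulus of [f] with squared distances written in counts, so that [bern_sqr] gives
     [s (1 - s) / m] per coordinate. *)
  pose Q (nu : 'I_N -> nat) := e / 2 + C * \sum_j m%:R^-2 * ((nu j)%:R + (- (m%:R * sinc c j x))) ^+ 2.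
  have hQ nu : `|f (node nu) - f x| <= Q nu.
    apply: le_trans (hC _ _ (Knode nu) Kx) _.
    rewrite lerD2l ler_wpM2l// /phi ler_sum// => j _; rewrite snode/=.
    have -> : m%:R^-2 * ((nu j)%:R - m%:R * sinc c j x) ^+ 2 = ((nu j)%:R / m%:R - sinc c j x) ^+ 2.
      by field; rewrite gt_eqF.
    (* For a count above [m] the capped ratio 1 is closer to [sinc c j x] than the ratio itself. *)
    have [h|h] := leqP (nu j) m; first exact: lexx.
    rewrite divff ?gt_eqF//; have /andP[s0 s1] := sinc01 c j x.
    have : 1 <= (nu j)%:R / m%:R :> R by rewrite ler_pdivlMr// mul1r ler_nat ltnW.
    by move=> h'; rewrite ler_sqr ?nnegrE ?subr_ge0// ?lerD2r//; lra.
  have EQ : mbern (enum 'I_N) m (sinc c ^~ x) Q <= e.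
    rewrite /Q mbernD mbern_cst mbernZ mbern_sum.
    rewrite [leRHS](splitr e) lerD2l; apply: le_trans hm.
    rewrite -mulrA ler_wpM2l//.
    apply: (@le_trans _ _ (\sum_(j < N) m%:R^-1)); last first.
      by rewrite sumr_const card_ord -[leLHS]mulr_natl.
    apply: ler_sum => j _; rewrite mbernZ.
    rewrite (mbern_coord _ _ (fun k => (k%:R + - (m%:R * sinc c j x)) ^+ 2)) ?mem_enum ?enum_uniq//.
    rewrite bern_sqr subrr expr0n/= add0r; have /andP[s0 s1] := sinc01 c j x.
    rewrite (_ : m%:R^-2 * _ = (sinc c j x * (1 - sinc c j x)) * m%:R^-1); last first.
      by field; rewrite gt_eqF.
    rewrite ler_piMl// ?invr_ge0 ?ltW//; nra.
  have up : mbern (enum 'I_N) m (sinc c ^~ x) (fun nu => f (node nu)) <= f x + e.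
    apply: (@le_trans _ _ (mbern (enum 'I_N) m (sinc c ^~ x) (fun nu => f x + Q nu))).
      apply: mbern_le => [j|nu]; first exact: sinc01.
      by have := hQ nu; rewrite ler_norml => /andP[_]; rewrite lerBlDl.
    by rewrite mbernD mbern_cst lerD2l.
  have dn : f x - e <= mbern (enum 'I_N) m (sinc c ^~ x) (fun nu => f (node nu)).
    apply: (@le_trans _ _ (mbern (enum 'I_N) m (sinc c ^~ x) (fun nu => f x + -1 * Q nu))); last first.
      apply: mbern_le => [j|nu]; first exact: sinc01.
      by have := hQ nu; rewrite ler_norml => /andP[+ _]; lra.
    by rewrite mbernD mbern_cst mbernZ mulN1r lerD2l lerN2.
  by rewrite ler_norml; apply/andP; split; lra.
Qed.

End TrigApproximation.

(** * Eventual bounds, outer probability and outer expectation *)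

Section EventualBounds.
Context {R : realType}.

Lemma cvge_eventually (u : nat -> \bar R) (c : R) :
  (forall e : R, 0 < e -> \forall n \near \oo, ((c - e)%:E <= u n <= (c + e)%:E)%E) ->
  u @ \oo --> c%:E.
Proof.
move=> h; apply/fine_cvgP; split.
  apply: filterS (h 1 ltr01) => n /andP[h1 h2].
  by rewrite fin_numE; apply/andP; split; apply/eqP => E; move: h1 h2; rewrite E.
apply/cvgrPdist_le => e e0; apply: filterS (h e e0) => n /=.
case: (u n) => [r| |]; last 2 first.
- by case/andP.
- by case/andP.
rewrite !lee_fin/=; by move=> /andP[h1 h2]; rewrite ler_norml; apply/andP; split; lra.
Qed.

Lemma cvge0_eventually (u : nat -> \bar R) (e : R) : u @ \oo --> 0%E -> 0 < e ->
  \forall n \near \oo, (u n < e%:E)%E.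
Proof.
move=> /fine_cvgP[fu cu] e0.
have e2 : 0 < e / 2 by rewrite divr_gt0.
move/cvgrPdist_le : cu => /(_ (e / 2) e2) h; near=> n.
have fn : u n \is a fin_num by near: n.
rewrite -(fineK fn) lte_fin.
have : `|0 - fine (u n)| <= e / 2 by near: n.
by rewrite sub0r normrN ler_norml => /andP[_ h1]; lra.
Unshelve. all: by end_near. Qed.

Lemma cvgr_eventually (u : nat -> R) (c e : R) : u @ \oo --> c -> 0 < e ->
  \forall n \near \oo, `|u n - c| <= e.
Proof.
move=> /cvgrPdist_le/[apply]; apply: filterS => n; by rewrite distrC.
Qed.

End EventualBounds.

Section OuterExpectation.
Context {R : realType} {d0 : measure_display} {Om : measurableType d0}.
Variable Pr : probability Om R.

Lemma outerP_lt (A : set Om) (e : R) : (outerP Pr A < e%:E)%E ->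
  exists E, [/\ measurable E, A `<=` E & fine (Pr E) <= e].
Proof.
move=> /ereal_inf_lt[_ [E [mE AE] <-]] h; exists E; split => //.
by rewrite -lee_fin fineK ?fin_num_measure// ltW.
Qed.

(** Outer expectations are evaluated by this sandwich; [h] itself may fail to be measurable. *)
Lemma outerE_bounds (h : Om -> R) (lo hi : Om -> R) : bmeas lo -> bmeas hi ->
  (forall w, lo w <= h w <= hi w) ->
  ((\int[Pr]_w lo w)%:E <= outerE Pr h <= (\int[Pr]_w hi w)%:E)%E.
Proof.
move=> blo bhi lh; apply/andP; split.
  apply: le_ereal_inf_tmp => _ [g [mg [Mg hg]] <-].
  have bg : bmeas g by split.
  rewrite (bmeas_integral_fin Pr bg) lee_fin; apply: exp_le => // w.
  by have /andP[h1 _] := lh w; exact: le_trans (hg w).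
apply: ereal_inf_lbound; exists hi; last by rewrite bmeas_integral_fin.
by split; [exact: bhi.1|split; [exact: bhi.2|move=> w; have /andP[] := lh w]].
Qed.

Lemma tight_rv (z : Om -> R) (e : R) : measurable_fun setT z -> 0 < e ->
  exists2 L : R, 0 < L & fine (Pr [set w | L < `|z w|]) <= e.
Proof.
move=> mz e0.
pose A (n : nat) : set Om := [set w | n%:R < `|z w|].
have mA n : measurable (A n).
  rewrite /A -[X in measurable X]setTI.
  have mn : measurable_fun setT (fun w => `|z w|) by exact: measurableT_comp.
  have := mn measurableT _ (measurable_itv `]n%:R, +oo[).
  by congr measurable; apply/seteqP; split=> x /=; rewrite in_itv/= andbT.
have A0 : \bigcap_n A n = set0.
  apply/seteqP; split=> // w /= h.
  have := h (Num.truncn `|z w|).+1 I; rewrite /A/= => h1.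
  by have := lt_trans (truncnS_gt `|z w|) h1; rewrite ltxx.
have : (Pr \o A) @ \oo --> Pr (\bigcap_n A n).
  apply: nonincreasing_cvg_mu => //.
  - by rewrite ltey_eq fin_num_measure.
  - by apply: bigcapT_measurable.
  - move=> m n mn; apply/subsetPset => w /=; apply: le_lt_trans.
    by rewrite ler_nat.
rewrite A0 measure0 => /cvge0_eventually/(_ e0)[n _ hn].
exists n.+1%:R => //.
have := hn n.+1 (leqnSn n); rewrite /= -[X in (X < _)%E]fineK ?fin_num_measure// lte_fin.
exact: ltW.
Qed.

End OuterExpectation.

(** * Convergence in law from characteristic functions *)

Section Levy.
Context {R : realType} {d0 d1 : measure_display} {Om : measurableType d0}
  {Om' : measurableType d1}.
Variables (Pr : probability Om R) (Pr' : probability Om' R) (N : nat).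
Variables (y : nat -> Om -> 'rV[R]_N) (y' : nat -> Om -> 'rV[R]_N) (z : Om' -> 'rV[R]_N).
Variable (D : R).
Hypothesis by_ : forall n j, bmeas (fun w => y n w ord0 j).
Hypothesis yD : \forall n \near \oo, forall j, \int[Pr]_w (y n w ord0 j ^+ 2) <= D.
Hypothesis mz : forall j, measurable_fun setT (fun w => z w ord0 j).
Hypothesis char : forall (a : 'rV[R]_N) (th : R),
  (fun n => \int[Pr]_w cos (dotr a (y n w) + th)) @ \oo --> \int[Pr']_w cos (dotr a (z w) + th).
Hypothesis yy' : forall e : R, 0 < e ->
  (fun n => outerP Pr [set w | exists j, e < `|y' n w ord0 j - y n w ord0 j|]) @ \oo --> 0%E.

Lemma bmeas_trig_comp d (T : measurableType d) (v : T -> 'rV[R]_N) p :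
  (forall j, measurable_fun setT (fun w => v w ord0 j)) -> trig p ->
  bmeas (fun w => p (v w)).
Proof.
move=> mv; elim=> {p} [a th|p q _ bp _ bq|c p _ bp]; [|exact: bmeasD|exact: bmeasZ].
have -> : (fun w => cos (dotr a (v w) + th)) = (fun w => cos (1 * dotr a (v w) + th)).
  by apply/funext => w; rewrite mul1r.
apply: bmeas_cos.
by apply: measurable_sum => j; apply: measurable_funM => //; exact: measurable_cst.
Qed.

Lemma trig_cvg p : trig p ->
  (fun n => \int[Pr]_w p (y n w)) @ \oo --> \int[Pr']_w p (z w).
Proof.
have my n j : measurable_fun setT (fun w => y n w ord0 j) := (by_ n j).1.
elim=> {p} [a th|p q tp IHp tq IHq|c p tp IHp]; first exact: char.
- rewrite expD; [|exact: (bmeas_trig_comp mz)|exact: (bmeas_trig_comp mz)].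
  under eq_fun do rewrite (expD _ (bmeas_trig_comp (my _) tp) (bmeas_trig_comp (my _) tq)).
  exact: cvgD.
- rewrite expZ; [|exact: (bmeas_trig_comp mz)].
  under eq_fun do rewrite (expZ _ _ (bmeas_trig_comp (my _) tp)).
  by apply: cvgM => //; exact: cvg_cst.
Qed.

(** On a large box [f] is close to a trigonometric polynomial, whose integrals converge; off the box
    both are bounded by [M], so the error costs [2 M] times a small probability. The possibly
    non-measurable [y'] is exchanged for [y] through the modulus of [f] on a slightly larger box. *)
Lemma levy_slutsky (f : 'rV[R]_N -> R) : bounded_continuous f ->
  (fun n => outerE Pr (fun w => f (y' n w))) @ \oo --> (\int[Pr']_w (f (z w))%:E)%E.
Proof.
move=> [cf [M fM]].
have M0 : 0 <= M := le_trans (normr_ge0 _) (fM 0).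
have mz' : measurable_fun setT (z : Om' -> Vb R N) by exact: Vb_measurable_coords.
have bfz : bmeas (fun w => f (z w)).
  apply: (bmeas_comp (T' := Vb R N)) mz'; split; last by exists M.
  exact: continuous_Vb_measurable.
rewrite bmeas_integral_fin//; apply: cvge_eventually => e e0.
(* All errors below together fit into [s (8 + 10 M + 10 M N)], which is [e]. *)
pose k : R := (8 + 10 * M + 10 * M * N%:R)^-1.
have k0 : 0 < k by rewrite invr_gt0 ltr_wpDr// ?mulr_ge0// ltr_wpDr// mulr_ge0.
pose s := e * k; have s0 : 0 < s by rewrite mulr_gt0.
have ks : s * (8 + 10 * M + 10 * M * N%:R) = e.
  by rewrite /s /k divfK// gt_eqF// -invr_gt0.
have [L [L1 hLy hLz]] : exists L : R, [/\ 1 < L,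
   \forall n \near \oo, forall j, fine (Pr [set w | L < `|y n w ord0 j|]) <= s &
   forall j, fine (Pr' [set w | L < `|z w ord0 j|]) <= s].
  have [Lz hz] : {Lz : 'I_N -> R & forall j, 0 < Lz j /\ fine (Pr' [set w | Lz j < `|z w ord0 j|]) <= s}.
    apply: (@choice _ _ (fun j L => 0 < L /\ fine (Pr' [set w | L < `|z w ord0 j|]) <= s)) => j.
    by have [L L0 hL] := tight_rv Pr' (mz j) s0; exists L.
  (* [L >= 1] and [L >= |D| / s] give [D / L^2 <= s] in Chebyshev's inequality; the sum dominates
     every [Lz j]. *)
  pose L : R := 2 + `|D| / s + \sum_j Lz j.
  have SL : 0 <= \sum_j Lz j by apply: sumr_ge0 => j _; have [/ltW] := hz j.
  have Ds : 0 <= `|D| / s by rewrite divr_ge0// ltW.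
  have L1 : 1 < L by rewrite /L; lra.
  have L0 : 0 < L by lra.
  exists L; split => //.
    apply: filterS yD => n hD j.
    have h := prob_chebyshev (by_ n j) L0 (hD j).
    apply: (le_trans h).
    rewrite ler_pdivrMr ?exprn_gt0//; apply: le_trans (ler_norm _) _.
    rewrite mulrC -ler_pdivrMr//; apply: (@le_trans _ _ L); first by rewrite /L; lra.
    by rewrite expr2 ler_pMl// ltW.
  move=> j; have [L0j hj] := hz j; apply: le_trans hj.
  have mS (c : R) : measurable [set w | c < `|z w ord0 j|].
    rewrite -[X in measurable X]setTI.
    have mn : measurable_fun setT (fun w => `|z w ord0 j|) by exact: measurableT_comp.
    have := mn measurableT _ (measurable_itv `]c, +oo[).
    by congr measurable; apply/seteqP; split=> x /=; rewrite in_itv/= andbT.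
  rewrite fine_le ?fin_num_measure//; apply: le_measure; rewrite ?inE//.
  move=> w /=; apply: le_lt_trans; rewrite /L (bigD1 j)//=.
  have : 0 <= \sum_(i | i != j) Lz i by apply: sumr_ge0 => i _; have [/ltW] := hz i.
  by lra.
have L0 : 0 < L by lra.
have [p [tp pM pf]] := trig_approx cf fM L0 s0.
pose phi (x : 'rV[R]_N * 'rV[R]_N) := \sum_j (x.1 ord0 j - x.2 ord0 j) ^+ 2.
have [C C0 hC] : exists2 C : R, 0 <= C & forall x x' : 'rV[R]_N,
    (forall j, `|x ord0 j| <= L + 1) -> (forall j, `|x' ord0 j| <= L + 1) ->
    `|f x - f x'| <= s + C * phi (x, x').
  apply: (compact_modulus (@box_compact R N (L + 1)) cf _ fM) => //.
  - apply: continuous_bigsum => j; apply: continuous_sqr_diff => x.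
    + by apply: (@continuous_comp _ _ _ fst (fun v : 'rV[R]_N => v ord0 j)); [exact: cvg_fst|exact: coord_continuous].
    + by apply: (@continuous_comp _ _ _ snd (fun v : 'rV[R]_N => v ord0 j)); [exact: cvg_snd|exact: coord_continuous].
  - by move=> x; apply: sumr_ge0 => j _; exact: sqr_ge0.
  - move=> x x' _ _; rewrite /phi => /eqP; rewrite psumr_eq0; last by move=> j _; exact: sqr_ge0.
    move=> /allP h; apply/rowP => j; have := h j; rewrite mem_index_enum => /(_ isT).
    by rewrite /= sqrf_eq0 subr_eq0 => /eqP.
(* The cap 1 keeps [y'] in the box of size [L + 1], for which [C] was chosen. *)
pose de : R := Num.min 1 (s / (1 + C * N%:R)).
have CN : 0 < 1 + C * N%:R by rewrite ltr_wpDr// mulr_ge0.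
have de0 : 0 < de by rewrite lt_min ltr01 divr_gt0.
have de1 : de <= 1 by rewrite ge_min lexx.
have des : C * N%:R * de <= s.
  have : de <= s / (1 + C * N%:R) by rewrite ge_min lexx orbT.
  rewrite ler_pdivlMr// => h; apply: le_trans h; rewrite mulrC ler_wpM2l//; lra.
have near_f (x x' : 'rV[R]_N) : (forall j, `|x ord0 j| <= L) ->
    (forall j, `|x' ord0 j - x ord0 j| <= de) -> `|f x' - f x| <= 2 * s.
  move=> Kx Kx'; have Kx1 j : `|x ord0 j| <= L + 1 by have := Kx j; lra.
  have Kx'1 j : `|x' ord0 j| <= L + 1.
    by have := ler_normD (x' ord0 j - x ord0 j) (x ord0 j); rewrite subrK; have := Kx j; have := Kx' j; lra.
  apply: le_trans (hC _ _ Kx'1 Kx1) _; rewrite mulr_natl mulr2n lerD2l; apply: le_trans des.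
  rewrite -mulrA ler_wpM2l// /phi.
  apply: (@le_trans _ _ (\sum_(j < N) de)).
    apply: ler_sum => j _ /=; rewrite -[leLHS]real_normK ?num_real//.
    apply: (@le_trans _ _ (de ^+ 2)); first by rewrite ler_sqr// nnegrE ltW.
    by rewrite expr2 ler_piMl// ltW.
  by rewrite sumr_const card_ord -[leLHS]mulr_natl.
have my n j : measurable_fun setT (fun w => y n w ord0 j) := (by_ n j).1.
have mS (n : nat) j : measurable [set w | L < `|y n w ord0 j|].
  rewrite -[X in measurable X]setTI.
  have mn : measurable_fun setT (fun w => `|y n w ord0 j|) by exact: measurableT_comp.
  have := mn measurableT _ (measurable_itv `]L, +oo[).
  by congr measurable; apply/seteqP; split=> x /=; rewrite in_itv/= andbT.
have mSz j : measurable [set w | L < `|z w ord0 j|].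
  rewrite -[X in measurable X]setTI.
  have mn : measurable_fun setT (fun w => `|z w ord0 j|) by exact: measurableT_comp.
  have := mn measurableT _ (measurable_itv `]L, +oo[).
  by congr measurable; apply/seteqP; split=> x /=; rewrite in_itv/= andbT.
have Ez : `|\int[Pr']_w f (z w) - \int[Pr']_w p (z w)| <= s + 2 * M * (N%:R * s).
  have bpz : bmeas (fun w => p (z w)) by exact: (bmeas_trig_comp mz).
  have bS : bmeas (fun w => \sum_j (\1_[set w | L < `|z w ord0 j|] w : R)).
    by apply: bmeas_sum => j _; exact: bmeas_indic.
  rewrite -expB//; apply: le_trans (exp_norm _ _) _; first by bm.
  apply: (@le_trans _ _ (\int[Pr']_w (s + 2 * M * \sum_j (\1_[set w | L < `|z w ord0 j|] w : R)))).
    apply: exp_le; [by bm|by bm|] => w.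
    have [/forallP h|/forallPn[j]] := boolP [forall j, `|z w ord0 j| <= L].
      rewrite distrC; apply: le_trans (pf _ h) _; rewrite lerDl mulr_ge0// ?mulr_ge0//.
      by apply: sumr_ge0 => j _; rewrite indicE.
    rewrite -ltNge => hj.
    apply: (@le_trans _ _ (2 * M)).
      by rewrite (le_trans (ler_normB _ _))// mulr_natl mulr2n lerD.
    apply: ler_wpDl; first exact: ltW.
    rewrite ler_peMr ?mulr_ge0// (bigD1 j)//= indicE mem_set// lerDl.
    by apply: sumr_ge0 => i _; rewrite indicE.
  rewrite expD ?exp_cst ?expZ ?exp_sum//; [|by move=> j _; exact: bmeas_indic|by bm|by bm].
  rewrite lerD2l ler_wpM2l ?mulr_ge0//.
  apply: (@le_trans _ _ (\sum_(j < N) s)); last by rewrite sumr_const card_ord -[leLHS]mulr_natl.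
  by apply: ler_sum => j _; rewrite exp_indic.
near=> n.
have hLn : forall j, fine (Pr [set w | L < `|y n w ord0 j|]) <= s by near: n.
have hp : `|\int[Pr]_w p (y n w) - \int[Pr']_w p (z w)| <= s.
  by near: n; exact: cvgr_eventually (trig_cvg tp) s0.
have hA : (outerP Pr [set w | exists j, (de < `|y' n w ord0 j - y n w ord0 j|)%R] < s%:E)%E.
  by near: n; exact: cvge0_eventually (yy' de0) s0.
have [E [mE AE PE]] := outerP_lt hA.
pose err w : R := 3 * s + 2 * M * \1_E w + 2 * M * \sum_j (\1_[set w | L < `|y n w ord0 j|] w : R).
have bE : bmeas (\1_E : Om -> R) by exact: bmeas_indic.
have bS : bmeas (fun w => \sum_j (\1_[set w | L < `|y n w ord0 j|] w : R)).
  by apply: bmeas_sum => j _; exact: bmeas_indic.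
have bpy : bmeas (fun w => p (y n w)) by exact: (bmeas_trig_comp (my n)).
have berr : bmeas err by rewrite /err; bm.
have Eerr : \int[Pr]_w err w <= 3 * s + 2 * M * s + 2 * M * (N%:R * s).
  rewrite /err expD; [|by bm|by bm]; rewrite expD; [|by bm|by bm].
  rewrite exp_cst !expZ// exp_indic// exp_sum; last by move=> j _; exact: bmeas_indic.
  rewrite lerD//.
    by rewrite lerD2l ler_wpM2l// mulr_ge0.
  rewrite ler_wpM2l ?mulr_ge0//.
  apply: (@le_trans _ _ (\sum_(j < N) s)); last by rewrite sumr_const card_ord -[leLHS]mulr_natl.
  by apply: ler_sum => j _; rewrite exp_indic.
have ferr w : `|f (y' n w) - p (y n w)| <= err w.
  have i1 : 0 <= \1_E w :> R by rewrite indicE.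
  have i2 : 0 <= \sum_j (\1_[set w | L < `|y n w ord0 j|] w : R).
    by apply: sumr_ge0 => i _; rewrite indicE.
  have M2 : 0 <= 2 * M by rewrite mulr_ge0.
  have j1 := mulr_ge0 M2 i1; have j2 := mulr_ge0 M2 i2.
  have crude : `|f (y' n w) - p (y n w)| <= 2 * M.
    by rewrite (le_trans (ler_normB _ _))// mulr_natl mulr2n lerD.
  have [Ew|Ew] := pselect (E w).
    apply: le_trans crude _; rewrite /err indicE mem_set// mulr1; lra.
  have [/forallP h|/forallPn[j]] := boolP [forall j, `|y n w ord0 j| <= L]; last first.
    rewrite -ltNge => hj.
    apply: le_trans crude _; rewrite /err.
    have : 1 <= \sum_j (\1_[set w | L < `|y n w ord0 j|] w : R).
      rewrite (bigD1 j)//= indicE mem_set// lerDl.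
      by apply: sumr_ge0 => i _; rewrite indicE.
    move=> /(ler_wpM2l M2); rewrite mulr1; lra.
  have hd j : `|y' n w ord0 j - y n w ord0 j| <= de.
    by rewrite leNgt; apply/negP => hj; apply: Ew; apply: AE; exists j.
  have h1 := near_f _ _ h hd; have h2 := pf _ h.
  have := ler_distD (f (y n w)) (f (y' n w)) (p (y n w)).
  by rewrite [`|f (y n w) - _|]distrC /err; lra.
have /andP[lo hi] : ((\int[Pr]_w (p (y n w) - err w))%:E <= outerE Pr (fun w => f (y' n w))
    <= (\int[Pr]_w (p (y n w) + err w))%:E)%E.
  apply: outerE_bounds; [by bm|by bm|] => w.
  by have := ferr w; rewrite ler_norml => /andP[h1 h2]; apply/andP; split; lra.
have Mn0 : 0 <= M * N%:R by rewrite mulr_ge0.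
move: Ez hp; rewrite !ler_norml => /andP[a1 a2] /andP[a3 a4].
apply/andP; split.
  apply: le_trans lo; rewrite lee_fin expB//.
  by move: ks Eerr a1 a2 a3 a4; nra.
apply: le_trans hi _; rewrite lee_fin expD//.
by move: ks Eerr a1 a2 a3 a4; nra.
Unshelve. all: by end_near. Qed.

End Levy.

(** * The sampling scheme: i.i.d. data and conditioning on the permutations *)

Section Sampling.
Context {d0 : measure_display} {Om : measurableType d0} {R : realType} {q d : nat}.
Variables (Pr : probability Om R) (P : probability (Vb R q) R)
  (X : nat -> Om -> Vb R q) (Pi : forall n : nat, 'I_d -> Om -> {perm 'I_n}).
Hypothesis samp : sampling Pr P X Pi.

Let mX : forall i, measurable_fun setT (X i). Proof. exact: samp.1. Qed.
Let mPi : forall n l (s : {perm 'I_n}), measurable [set w | Pi n l w = s].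
Proof. exact: samp.2.1. Qed.

Lemma sampling_iid (m : nat) (B : nat -> set (Vb R q)) :
  (forall i, measurable (B i)) ->
  Pr [set w | forall i, (i < m)%N -> B i (X i w)] = (\prod_(i < m) fine (P (B i)))%:E.
Proof.
move=> mB; have [_ [_ h]] := samp.
(* For [n = 0] the permutations are trivial and [0! = 1], which leaves the law of the sample
   alone. *)
have := h 0%N m (fun i => B i) (fun=> 1%g) (fun i => mB i).
rewrite fact0 invr1 expr1n mulr1 => <-; congr (Pr _).
apply/seteqP; split=> w /= hw.
  split; first by move=> i; exact: hw.
  by move=> l; apply/permP => -[].
by move=> i im; have := hw.1 (Ordinal im).
Qed.

Lemma PsetT : fine (P setT) = 1.
Proof. by rewrite (_ : P setT = 1%E)//; exact: probability_setT. Qed.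

Lemma sampling_law i A : measurable A -> Pr (X i @^-1` A) = P A.
Proof.
move=> mA; pose B j := if j == i then A else setT.
have mB j : measurable (B j) by rewrite /B; case: ifP.
have := sampling_iid i.+1 mB.
rewrite (bigD1 (@ord_max i))//= big1 ?mulr1; last first.
  move=> j hj; rewrite /B; case: eqP => [e|]; last by rewrite PsetT.
  by move: hj; rewrite -val_eqE/= e eqxx.
rewrite /B eqxx fineK ?fin_num_measure// => <-; congr (Pr _).
apply/seteqP; split=> w /=; first by move=> h j _; case: eqP => // ->.
by move=> /(_ i (ltnSn i)); rewrite eqxx.
Qed.

Lemma prod_support (B : nat -> set (Vb R q)) (r : seq nat) (m : nat) : uniq r ->
  (forall i, i \notin r -> B i = setT) -> (forall i, i \in r -> (i < m)%N) ->
  \prod_(i < m) fine (P (B i)) = \prod_(i <- r) fine (P (B i)).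
Proof.
move=> ur Br rm; rewrite -(big_mkord xpredT (fun i => fine (P (B i)))).
rewrite (bigID (mem r))/= [X in _ * X]big1 ?mulr1; last first.
  by move=> i /Br ->; rewrite PsetT.
rewrite -big_filter; apply: perm_big; apply: uniq_perm => //.
  by rewrite filter_uniq// iota_uniq.
move=> i; rewrite mem_filter mem_index_iota leq0n/=.
by case: (boolP (i \in r)) => // /rm ->.
Qed.

Lemma support_bound (r : seq nat) : exists m, forall i, i \in r -> (i < m)%N.
Proof.
elim: r => [|a r [m hm]]; first by exists 0%N.
exists (maxn m a.+1) => i; rewrite inE leq_max => /orP[/eqP ->|/hm ->//].
by rewrite ltnSn orbT.
Qed.

Lemma sampling_PR (B : nat -> set (Vb R q)) (r : seq nat) : uniq r ->
  (forall i, measurable (B i)) -> (forall i, i \notin r -> B i = setT) ->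
  Pr [set w | forall i, B i (X i w)] = (\prod_(i <- r) fine (Pr (X i @^-1` B i)))%:E.
Proof.
move=> ur mB Br; have [m rm] := support_bound r.
rewrite (eq_bigr (fun i => fine (P (B i)))); last by move=> i _; rewrite sampling_law.
rewrite -(prod_support ur Br rm) -sampling_iid//; congr (Pr _).
apply/seteqP; split=> w /= h i; first by move=> _; exact: h.
have [/rm im|/Br ->//] := boolP (i \in r); exact: h.
Qed.

Definition perm_event n (s : 'I_d -> {perm 'I_n}) : set Om :=
  [set w | forall l, Pi n l w = s l].

Lemma perm_event_measurable n s : measurable (@perm_event n s).
Proof.
have -> : perm_event s = \bigcap_(l in [set: 'I_d]) [set w | Pi n l w = s l].
  by apply/seteqP; split=> w /= h l; [move=> _|]; exact: h.
by apply: fin_bigcap_measurable => // l _; exact: mPi.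
Qed.

Lemma perm_event_prob n s : Pr (@perm_event n s) = ((n`!%:R)^-1 ^+ d)%:E.
Proof.
have [_ [_ h]] := samp.
have := h n 0%N (fun=> setT) s (fun=> measurableT).
rewrite big_ord0 mul1r => <-; congr (Pr _).
by apply/seteqP; split=> w /=; [split => // -[]|case].
Qed.

Lemma perm_event_indep n s A : measurable (A : set (subsigma X setT)) ->
  Pr (A `&` @perm_event n s) = (Pr A * Pr (@perm_event n s))%E.
Proof.
move=> mA; apply: (indep_sigma_pi (@cylinders_setI _ _ _ _ _ X setT) _ _ _ mA).2.
- exact: (cylinders_measurable mX).
- exact: perm_event_measurable.
move=> _ [B [r [mB Br ->]]].
have Br' i : i \notin undup r -> B i = setT by rewrite mem_undup => ir; apply: Br; left.
have [m rm] := support_bound (undup r).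
rewrite perm_event_prob (sampling_PR (undup_uniq r) mB Br').
rewrite (eq_bigr (fun i => fine (P (B i)))); last by move=> i _; rewrite sampling_law.
rewrite -(prod_support (undup_uniq r) Br' rm).
have [_ [_ h]] := samp.
rewrite -EFinM -(h n m (fun i => B i) s (fun i => mB i)); congr (Pr _).
apply/seteqP; split=> w /= -[h1 h2]; split => // i.
by have [/rm im|/Br' ->//] := boolP (i \in undup r); exact: (h1 (Ordinal im)).
Qed.

Lemma exp_perm_event n s (U : Om -> R) : bmeas (U : subsigma X setT -> R) ->
  \int[Pr]_w (U w * \1_(@perm_event n s) w) = (n`!%:R)^-1 ^+ d * \int[Pr]_w U w.
Proof.
move=> bU; pose E := @perm_event n s.
have mE : measurable E := perm_event_measurable s.
(* The sigma-algebra generated by the single event [E], through which [exp_indep_pair] also covers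
   its indicator. *)
pose TE := g_sigma_algebraType [set E].
have mEE : measurable (E : set TE) by apply: sub_sigma_algebra.
have mid : measurable_fun setT (id : Om -> TE).
  move=> _ B mB; rewrite setTI preimage_id.
  by apply: (smallest_sub (sigma_algebra_measurable Om) _ mB) => _ ->.
have bf : bmeas (fun z : subsigma X setT * TE => U z.1 * \1_E z.2).
  apply: bmeasM; first exact: (bmeas_comp bU).
  exact: (bmeas_comp (bmeas_indic mEE)).
have hi A B : measurable (A : set (subsigma X setT)) -> measurable (B : set TE) ->
    Pr (A `&` B) = (Pr A * Pr B)%E.
  move=> mA mB; rewrite setIC muleC.
  apply: (@indep_sigma_pi _ _ _ Pr [set E] A _ _ _ _ B mB).2.
  - by move=> _ _ -> ->; rewrite setIid.
  - by move=> _ ->.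
  - exact: (subsigma_le mX mA).
  - by move=> _ ->; rewrite setIC muleC; exact: perm_event_indep.
have -> := @exp_indep_pair _ _ _ Pr _ (subsigma X setT) _ TE id id _
  (@measurable_id_subsigma _ _ _ _ _ X mX setT) mid bf hi.
transitivity (\int[Pr]_w (\int[Pr]_w U w * \1_E w)).
  apply: eq_Rintegral => w _ /=; under eq_Rintegral do rewrite mulrC.
  by rewrite expZ; [rewrite mulrC|exact: (bmeas_subsigma mX bU)].
rewrite expZ; last exact: bmeas_indic.
by rewrite exp_indic// /E perm_event_prob mulrC.
Qed.

Lemma perm_split n (F : ('I_d -> {perm 'I_n}) -> Om -> R) w :
  F (fun l => Pi n l w) w =
  \sum_(s : {ffun 'I_d -> {perm 'I_n}}) F s w * \1_(perm_event s) w.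
Proof.
rewrite (bigD1 [ffun l => Pi n l w])//= indicE mem_set; last first.
  by move=> l /=; rewrite ffunE.
rewrite mulr1 big1 ?addr0.
  by congr (F _ _); apply/funext => l; rewrite ffunE.
move=> s hs; rewrite indicE memNset ?mulr0// => h; move/negP: hs; apply.
by apply/eqP/ffunP => l; rewrite ffunE (h l).
Qed.

Lemma bmeas_perm n (F : ('I_d -> {perm 'I_n}) -> Om -> R) :
  (forall s, bmeas (F s)) -> bmeas (fun w => F (fun l => Pi n l w) w).
Proof.
move=> bF; under eq_fun do rewrite perm_split.
apply: bmeas_sum => s _; apply: bmeasM; first exact: bF.
exact: bmeas_indic (perm_event_measurable s).
Qed.

(** Conditioning on the permutations: they take finitely many equally likely values and are
    independent of the sample, so the expectation is an average over frozen permutations. *)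
Lemma exp_perm n (F : ('I_d -> {perm 'I_n}) -> Om -> R) :
  (forall s, bmeas (F s : subsigma X setT -> R)) ->
  \int[Pr]_w F (fun l => Pi n l w) w =
  ffavg (fun s : {ffun 'I_d -> {perm 'I_n}} => \int[Pr]_w F s w).
Proof.
move=> bF; under eq_Rintegral do rewrite perm_split.
rewrite exp_sum; last first.
  move=> s _; apply: bmeasM; first exact: (bmeas_subsigma mX (bF s)).
  exact: bmeas_indic (perm_event_measurable s).
rewrite /ffavg card_Sn -exprVn mulr_sumr; apply: eq_bigr => s _.
exact: exp_perm_event.
Qed.

End Sampling.

(** * The Frobenius inner product *)

Section Frobenius.
Context {R : realType} {q : nat}.
Implicit Types A B M : 'M[R]_q.

Lemma frobE A B : frob A B = \sum_i \sum_j A i j * B i j.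
Proof.
rewrite /frob /mxtrace; under eq_bigr do rewrite mxE.
by rewrite exchange_big/=; apply: eq_bigr => i _; apply: eq_bigr => j _; rewrite mxE.
Qed.

Lemma frobDr A B C : frob A (B + C) = frob A B + frob A C.
Proof. by rewrite /frob mulmxDr mxtraceD. Qed.

Lemma frobZr A c B : frob A (c *: B) = c * frob A B.
Proof. by rewrite /frob -scalemxAr mxtraceZ. Qed.

Lemma frobDl A B C : frob (A + B) C = frob A C + frob B C.
Proof. by rewrite /frob linearD/= mulmxDl mxtraceD. Qed.

Lemma frobZl A c B : frob (c *: A) B = c * frob A B.
Proof. by rewrite /frob linearZ/= -scalemxAl mxtraceZ. Qed.

Lemma frob0r A : frob A 0 = 0.
Proof. by rewrite /frob mulmx0 mxtrace0. Qed.

Lemma frob0l A : frob 0 A = 0.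
Proof. by rewrite /frob trmx0 mul0mx mxtrace0. Qed.

Lemma frob_sumr (I : eqType) (r : seq I) (p : pred I) A (F : I -> 'M[R]_q) :
  frob A (\sum_(i <- r | p i) F i) = \sum_(i <- r | p i) frob A (F i).
Proof.
elim/big_rec2: _ => [|i x y _ <-]; first exact: frob0r.
by rewrite frobDr.
Qed.

Lemma frob_suml (I : eqType) (r : seq I) (p : pred I) A (F : I -> 'M[R]_q) :
  frob (\sum_(i <- r | p i) F i) A = \sum_(i <- r | p i) frob (F i) A.
Proof.
elim/big_rec2: _ => [|i x y _ <-]; first exact: frob0l.
by rewrite frobDl.
Qed.

Lemma frob_delta i j B : frob (delta_mx i j) B = B i j.
Proof.
rewrite frobE (bigD1 i)//= (bigD1 j)//= mxE !eqxx mul1r.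
rewrite big1 ?addr0; last by move=> k /negbTE kj; rewrite mxE eqxx kj mul0r.
rewrite big1 ?addr0// => k /negbTE ki; rewrite big1// => k' _.
by rewrite mxE ki mul0r.
Qed.

(** [gaussian_sym] prescribes the characteristic function for symmetric [A] only, whereas single
    entries correspond to [delta_mx]; symmetrizing does not change the inner product with symmetric
    matrices. *)
Definition symmetrize A : 'M[R]_q := 2^-1 *: (A + A^T).

Lemma symmetrize_sym A : symmx (symmetrize A).
Proof. by rewrite /symmx /symmetrize linearZ/= linearD/= trmxK addrC. Qed.

Lemma frob_symmetrize A B : symmx B -> frob (symmetrize A) B = frob A B.
Proof.
move=> sB; rewrite /symmetrize frobZl frobDl.
have -> : frob A^T B = frob A B.
  by rewrite /frob trmxK -[RHS]mxtrace_tr trmx_mul trmxK sB mxtrace_mulC.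
by field.
Qed.

Lemma mxnorm_entry M i j : `|M i j| <= mxnorm M.
Proof.
rewrite /mxnorm -sqrtr_sqr ler_wsqrtr// frobE (bigD1 i)//= (bigD1 j)//= expr2 -addrA lerDl.
rewrite addr_ge0//; first by apply: sumr_ge0 => k _; rewrite -expr2 sqr_ge0.
by apply: sumr_ge0 => k _; apply: sumr_ge0 => k' _; rewrite -expr2 sqr_ge0.
Qed.

Lemma mxnorm_le M (c : R) : 0 <= c -> (forall i j, `|M i j| <= c) -> mxnorm M <= q%:R * c.
Proof.
move=> c0 Mc; rewrite /mxnorm -[leRHS]ger0_norm ?mulr_ge0// -sqrtr_sqr ler_wsqrtr// frobE.
apply: (@le_trans _ _ (\sum_(i < q) \sum_(j < q) c ^+ 2)).
  apply: ler_sum => i _; apply: ler_sum => j _; rewrite -expr2 -[leLHS]real_normK ?num_real//.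
  by rewrite ler_sqr ?nnegrE.
by eqle; rewrite !sumr_const card_ord -mulrnA -[LHS]mulr_natl natrM; ring.
Qed.

End Frobenius.

Lemma Vb_sub_measurable (R : realType) q :
  measurable_fun setT (fun z : Vb R q * Vb R q => (z.1 - z.2 : Vb R q)).
Proof.
apply: Vb_measurable_coords => j; under eq_fun do rewrite mxE [X in _ + X]mxE.
apply: measurable_funB.
- exact: (measurableT_comp (Vb_coord_measurable j) measurable_fst).
- exact: (measurableT_comp (Vb_coord_measurable j) measurable_snd).
Qed.

Lemma bmeas_common_bound d (T : measurableType d) d' (T' : measurableType d')
  (R : realType) (I : finType) (f : T -> R) (h : I -> T' -> R) :
  bmeas f -> (forall i, bmeas (h i)) ->
  exists B : R, [/\ 0 <= B, forall t, `|f t| <= B & forall i t, `|h i t| <= B].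
Proof.
move=> [_ [Mf hMf]] bh.
have [Mh hMh] : {Mh : I -> R & forall i t, `|h i t| <= Mh i}.
  by apply: (@choice _ _ (fun i M => forall t, `|h i t| <= M)) => i; have [_] := bh i.
exists (`|Mf| + \sum_i `|Mh i|); split.
- by rewrite addr_ge0// sumr_ge0.
- by move=> t; rewrite (le_trans (hMf t))// ler_wpDr ?sumr_ge0// ler_norm.
- move=> i t; rewrite (le_trans (hMh i t))// (bigD1 i)//= ler_wpDl// ler_wpDr ?ler_norm//.
  exact: sumr_ge0.
Qed.

(** * The kernels H_1, H_2 and the linear statistic *)

Section Statistic.
Context {d0 : measure_display} {Om : measurableType d0} {R : realType} {q d : nat}.
Variables (Pr : probability Om R) (P : probability (Vb R q) R)
  (X : nat -> Om -> Vb R q) (Pi : forall n : nat, 'I_d -> Om -> {perm 'I_n}).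
Hypothesis samp : sampling Pr P X Pi.
Variable J : 'rV[R]_q -> 'M[R]_q.
Hypothesis mJ : forall i j, measurable_fun setT (fun x : Vb R q => J x i j).
Hypothesis bJ : bounded_mxfun J.
Hypothesis eJ : even_mxfun J.
Hypothesis sJ : symvalued J.
Hypothesis J0 : mxint (law Pr (fun w => (X 0%N w - X 1%N w : Vb R q))) J = 0.

Let mX : forall i, measurable_fun setT (X i). Proof. exact: samp.1. Qed.
Let lawX := sampling_law samp.
Let PR := sampling_PR samp.

Lemma bmeasJ i j : bmeas (fun x : Vb R q => J x i j).
Proof.
split => //; have [M JM] := bJ; exists M => x.
exact: le_trans (mxnorm_entry _ _ _) (JM x).
Qed.

Lemma bmeas_diff (f : Vb R q -> R) : bmeas f ->
  bmeas (fun z : Vb R q * Vb R q => f (z.1 - z.2 : Vb R q)).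
Proof. by move=> bf; apply: (bmeas_comp bf); exact: Vb_sub_measurable. Qed.

Lemma bmeas_diffC (f : Vb R q -> R) : bmeas f ->
  bmeas (fun z : Vb R q * Vb R q => f (z.2 - z.1 : Vb R q)).
Proof.
move=> bf; apply: (bmeas_comp (bmeas_diff bf) (g := fun z => (z.2, z.1))).
exact: measurable_fun_pair.
Qed.

Lemma H1E x i j : H1 P J x i j = \int[P]_y J (x - y) i j.
Proof. by rewrite mxE. Qed.

Lemma bmeasH1 i j : bmeas (fun x : Vb R q => H1 P J x i j).
Proof.
under eq_fun do rewrite H1E.
exact: (bmeas_section P P (bmeas_diffC (bmeasJ i j))).
Qed.

Lemma H1_sym x : symmx (H1 P J x).
Proof.
apply/matrixP => i j; rewrite mxE !H1E; apply: eq_Rintegral => y _.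
by rewrite -[in RHS](sJ (x - y)) mxE.
Qed.

Lemma H2E x y i j : H2 P J x y i j = J (x - y) i j - H1 P J x i j - H1 P J y i j.
Proof.
rewrite /H2; move: (H1 P J x) (H1 P J y) (J (x - y)) => a b c.
by rewrite !mxE.
Qed.

Lemma H2_sym x y : symmx (H2 P J x y).
Proof. by rewrite /symmx /H2 !linearB/= (sJ _) !H1_sym. Qed.

Lemma H2C x y : H2 P J x y = H2 P J y x.
Proof. by rewrite /H2 -(eJ (x - y)) opprB addrAC. Qed.

Lemma bmeasH2 i j : bmeas (fun z : Vb R q * Vb R q => H2 P J z.1 z.2 i j).
Proof.
under eq_fun do rewrite H2E.
apply: bmeasB; first apply: bmeasB.
- exact: (bmeas_diff (bmeasJ i j)).
- exact: (bmeas_comp (bmeasH1 i j)).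
- exact: (bmeas_comp (bmeasH1 i j)).
Qed.

Lemma exp_diff (f : Vb R q -> R) a b : bmeas f -> a != b ->
  \int[Pr]_w f (X a w - X b w : Vb R q) = \int[Pr]_w f (X 0%N w - X 1%N w : Vb R q).
Proof.
move=> bf ab; have bd := bmeas_diff bf.
by rewrite (exp_pair mX lawX PR ab bd) -(exp_pair mX lawX PR (i := 0%N) (j := 1%N) _ bd).
Qed.

Lemma Rint_law (f : Vb R q -> R) : bmeas f ->
  Defs.Rint (law Pr (fun w => (X 0%N w - X 1%N w : Vb R q))) f =
  \int[Pr]_w f (X 0%N w - X 1%N w : Vb R q).
Proof.
move=> bf.
have mD : measurable_fun setT (fun w => (X 0%N w - X 1%N w : Vb R q)).
  exact: (measurableT_comp (@Vb_sub_measurable R q) (measurable_fun_pair (mX 0%N) (mX 1%N))).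
have [PQ hPQ] := law_exists Pr mD.
have -> : law Pr (fun w => (X 0%N w - X 1%N w : Vb R q)) = PQ :> (set _ -> \bar R).
  by apply/funext => A; rewrite hPQ.
by rewrite -(exp_pushforward mD bf (P' := PQ)).
Qed.

(** Up to the sign of the argument, which evenness removes, this is an entry of the integral of [J]
    against the law of [X 0 - X 1], hence [J0]. *)
Lemma exp_H1 i j : \int[P]_x H1 P J x i j = 0.
Proof.
have h : \int[Pr]_w J (X 0%N w - X 1%N w) i j = 0.
  by rewrite -(Rint_law (bmeasJ i j)); have := congr1 (fun M : 'M[R]_q => M i j) J0; rewrite !mxE.
rewrite -h (exp_pair mX lawX PR (i := 0%N) (j := 1%N) _ (bmeas_diff (bmeasJ i j)))//.
apply: eq_Rintegral => y _; rewrite H1E; apply: eq_Rintegral => x _ /=.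
by rewrite -eJ opprB.
Qed.

(** By evenness [J (x - y)] integrates over [x] to [H1 y], which cancels the third term, and the
    second integrates to 0. *)
Lemma exp_H2 i j y : \int[P]_x H2 P J x y i j = 0.
Proof.
under eq_Rintegral do rewrite H2E.
have b1 : bmeas (fun x : Vb R q => J (x - y) i j).
  have h := bmeas_pair2 (y : Vb R q) (bmeas_diff (bmeasJ i j)).
  exact h.
have b2 := bmeasH1 i j.
rewrite expB; [|exact: bmeasB|exact: bmeas_cst].
rewrite expB// exp_cst exp_H1 subr0 H1E.
apply/eqP; rewrite subr_eq0; apply/eqP; apply: eq_Rintegral => x _.
by rewrite -eJ opprB.
Qed.

Definition gfun (A : 'M[R]_q) (x : Vb R q) : R := frob A (H1 P J x).
Definition hfun (A : 'M[R]_q) (z : Vb R q * Vb R q) : R := frob A (H2 P J z.1 z.2).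

Lemma bmeas_gfun A : bmeas (gfun A).
Proof.
rewrite /gfun; under eq_fun do rewrite frobE.
by apply: bmeas_sum => i _; apply: bmeas_sum => j _; apply: bmeasZ; exact: bmeasH1.
Qed.

Lemma bmeas_hfun A : bmeas (hfun A).
Proof.
rewrite /hfun; under eq_fun do rewrite frobE.
by apply: bmeas_sum => i _; apply: bmeas_sum => j _; apply: bmeasZ; exact: bmeasH2.
Qed.

Lemma exp_gfun A : \int[P]_x gfun A x = 0.
Proof.
rewrite /gfun; under eq_Rintegral do rewrite frobE.
rewrite exp_sum; last first.
  by move=> i _; apply: bmeas_sum => j _; apply: bmeasZ; exact: bmeasH1.
rewrite big1// => i _; rewrite exp_sum; last by move=> j _; apply: bmeasZ; exact: bmeasH1.
by rewrite big1// => j _; rewrite expZ ?exp_H1 ?mulr0//; exact: bmeasH1.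
Qed.

Lemma exp_hfun A y : \int[P]_x hfun A (x, y) = 0.
Proof.
rewrite /hfun/=; under eq_Rintegral do rewrite frobE.
have b i j : bmeas (fun x : Vb R q => H2 P J x y i j) by exact: (bmeas_pair2 y (bmeasH2 i j)).
rewrite exp_sum; last by move=> i _; apply: bmeas_sum => j _; apply: bmeasZ; exact: b.
rewrite big1// => i _; rewrite exp_sum; last by move=> j _; apply: bmeasZ; exact: b.
by rewrite big1// => j _; rewrite expZ ?exp_H2 ?mulr0//; exact: b.
Qed.

Definition lin_stat (A : 'I_d.+1 -> 'M[R]_q) (n : nat) (w : Om) : R :=
  \sum_k frob (A k) (stat_vec P J X Pi n w k).

Definition perm_stat (A : 'I_d.+1 -> 'M[R]_q) (n : nat) (s : 'I_d -> {perm 'I_n}) : Om -> R :=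
  tstat X (fun l => cycle_perm (s l)) (gfun (A ord0)) (fun l => hfun (A (lift ord0 l))).

(** The edge sums of [Mn] run over positions; relabelling by observations through each permutation
    brings them into the form of [tstat]. *)
Lemma lin_statE A n w : lin_stat A n w = perm_stat A (fun l => Pi n l w) w.
Proof.
rewrite /lin_stat big_ord_recl /perm_stat /tstat /zeta.
rewrite [X in _ = _ * X]big_split/= [X in _ = _ * (_ + X)]exchange_big/= mulrDr.
(* It holds at [n = 0] too, where both sides are 0 because [0^-1 = 0]. *)
have sn : Num.sqrt n%:R * n%:R^-1 = (Num.sqrt n%:R)^-1 :> R.
  have [->|n0] := posnP n; first by rewrite sqrtr0 mul0r invr0.
  have s0 : Num.sqrt n%:R != 0 :> R by rewrite sqrtr_eq0 -ltNge ltr0n.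
  by rewrite -{2}(@sqr_sqrtr R n%:R)//; field.
congr (_ + _).
  rewrite /stat_vec unlift_none frobZr /intH1_emp frobZr frob_sumr mulrA sn.
  by [].
rewrite mulr_sumr; apply: eq_bigr => l _.
rewrite /stat_vec liftK frobZr /Mn frobZr frob_sumr mulrA sn; congr (_ * _).
rewrite [RHS](reindex_inj (@perm_inj _ (Pi n l w)))/=; apply: eq_bigr => i _.
by rewrite cycle_perm_image.
Qed.

Lemma bmeas_perm_stat A n s : bmeas (@perm_stat A n s : subsigma X setT -> R).
Proof.
apply: bmeasZ; apply: bmeas_sum => a _; apply: bmeasD.
  by apply: bmeas_var1 => //; exact: bmeas_gfun.
by apply: bmeas_sum => l _; apply: bmeas_var2 => //; exact: bmeas_hfun.
Qed.

Lemma bmeas_lin_stat A n : bmeas (lin_stat A n).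
Proof.
have -> : lin_stat A n = (fun w => perm_stat A (fun l => Pi n l w) w).
  by apply/funext => w; rewrite lin_statE.
apply: (bmeas_perm samp (F := fun s w => perm_stat A s w)) => s.
exact: (bmeas_subsigma mX (@bmeas_perm_stat A n s)).
Qed.

Lemma lin_stat_sqr A : exists D : R, forall n, (1 < n)%N ->
  \int[Pr]_w (lin_stat A n w ^+ 2) <= D.
Proof.
have [B [B0 gB hB]] := bmeas_common_bound (bmeas_gfun (A ord0))
  (fun l => bmeas_hfun (A (lift ord0 l))).
exists (#|{: option ('I_d * bool)}|%:R ^+ 2 * (2 * (d.+1%:R * B)) ^+ 2) => n n1.
under eq_Rintegral do rewrite lin_statE.
rewrite (exp_perm samp (F := fun s w => perm_stat A s w ^+ 2)); last first.
  by move=> s; apply: bmeasX; exact: bmeas_perm_stat.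
have S0 : (0 < #|{perm 'I_n}|)%N by rewrite card_Sn fact_gt0.
rewrite -[leRHS](@ffavg_cst R {perm 'I_n} d _ S0); apply: ffavg_le => s.
apply: (exp_tstat_sqr mX lawX PR).
- by move=> l a; exact: cycle_perm_neq.
- exact: bmeas_gfun.
- by move=> l; exact: bmeas_hfun.
- by [].
- by [].
- exact: exp_gfun.
- by move=> l y; exact: exp_hfun.
- exact: ltnW.
Qed.

Definition var1 (A : 'M[R]_q) : R :=
  fine (\int[Pr]_w ((frob A (H1 P J (X 0%N w))) ^+ 2)%:E)%E.
Definition var2 (A : 'M[R]_q) : R :=
  fine (\int[Pr]_w ((frob A (H2 P J (X 0%N w) (X 1%N w))) ^+ 2)%:E)%E.

Lemma sig2E A : sig2 P (gfun (A ord0)) (fun l => hfun (A (lift ord0 l))) =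
  var1 (A ord0) + \sum_(l < d) var2 (A (lift ord0 l)).
Proof.
rewrite /sig2; congr (_ + _).
  have b : bmeas (fun x => gfun (A ord0) x ^+ 2) by apply: bmeasX; exact: bmeas_gfun.
  by rewrite -(exp_var mX lawX 0%N b).
apply: eq_bigr => l _.
have b : bmeas (fun z => hfun (A (lift ord0 l)) z ^+ 2) by apply: bmeasX; exact: bmeas_hfun.
by rewrite -(exp_pair mX lawX PR (i := 0%N) (j := 1%N) _ b).
Qed.

(** For frozen permutations [charfun_clt] bounds the error by a constant independent of them times
    an expression linear in [collisions], so only the mean number of collisions enters, and it is
    bounded in [n]. *)
Lemma lin_stat_charfun A th :
  (fun n => \int[Pr]_w cos (lin_stat A n w + th)) @ \oo -->
  cos th * expR (- ((var1 (A ord0) + \sum_(l < d) var2 (A (lift ord0 l))) / 2)).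
Proof.
have [B [B0 gB hB]] := bmeas_common_bound (bmeas_gfun (A ord0))
  (fun l => bmeas_hfun (A (lift ord0 l))).
pose C : R := stein_const d B.
have C0 : 0 <= C.
  rewrite /C /stein_const.
  have Z0 : 0 <= d.+1%:R * B by rewrite mulr_ge0.
  have Y0 : 0 <= d.+1%:R * B + d%:R * B by rewrite addr_ge0// mulr_ge0.
  rewrite addr_ge0//; last by rewrite mulr_ge0// sqr_ge0.
  rewrite addr_ge0//; first by rewrite mulr_ge0 ?sqr_ge0// mulr_ge0.
  by rewrite divr_ge0// addr_ge0// mulr_ge0// sqr_ge0.
have key n : (2 < n)%N -> `|\int[Pr]_w cos (lin_stat A n w + th) -
   cos th * expR (- ((var1 (A ord0) + \sum_(l < d) var2 (A (lift ord0 l))) / 2))| <=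
   C * ((Num.sqrt n%:R)^-1 + 4 * d%:R ^+ 2 / n%:R).
  move=> n2; have n1 := ltnW n2; have n0 := ltnW n1.
  under eq_Rintegral do rewrite lin_statE.
  rewrite (exp_perm samp (F := fun s w => cos (perm_stat A s w + th))); last first.
    move=> s; have -> : (fun w => cos (perm_stat A s w + th)) = (fun w => cos (1 * perm_stat A s w + th)).
      by apply/funext => w; rewrite mul1r.
    by apply: bmeas_cos; exact: (bmeas_perm_stat A s).1.
  have S0 : (0 < #|{perm 'I_n}|)%N by rewrite card_Sn fact_gt0.
  rewrite -[X in _ - X](@ffavg_cst R {perm 'I_n} d _ S0) -[X in _ - X]mul1r -mulNr -ffavgZ -ffavgD.
  apply: le_trans (ffavg_norm _) _.
  apply: (@le_trans _ _ (ffavg (fun s : {ffun 'I_d -> {perm 'I_n}} => C * ((Num.sqrt n%:R)^-1 +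
     n%:R^-1 * (collisions (fun l => cycle_perm (s l)))%:R)))).
    apply: ffavg_le => s; rewrite mulN1r [n%:R^-1 * _]mulrC -sig2E.
    apply: (charfun_clt mX lawX PR) => //.
    - by move=> l a; exact: cycle_perm_neq.
    - by move=> l a; exact: cycle_perm2_neq.
    - exact: bmeas_gfun.
    - by move=> l; exact: bmeas_hfun.
    - by move=> l x y; rewrite /hfun/= H2C.
    - exact: exp_gfun.
    - by move=> l y; exact: exp_hfun.
  rewrite ffavgZ ffavgD ffavg_cst// ffavgZ.
  by rewrite ler_wpM2l// lerD2l [leRHS]mulrC ler_wpM2l ?invr_ge0// ffavg_collisions.
apply/cvgrPdist_le => e e0.
pose K : R := C * (1 + 4 * d%:R ^+ 2).
have K0 : 0 <= K by rewrite mulr_ge0// addr_ge0// mulr_ge0// sqr_ge0.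
near=> n.
have n2 : (2 < n)%N by near: n; exact: nbhs_infty_gt.
have n0 : 0 < n%:R :> R by rewrite ltr0n; lia.
have hn : (K / e) ^+ 2 <= n%:R.
  near: n; exists (Num.truncn ((K / e) ^+ 2)).+1 => // m /= hm.
  by apply: le_trans (ltW (truncnS_gt _)) _; rewrite ler_nat.
have s1 : 1 <= Num.sqrt n%:R :> R by rewrite -[leLHS]sqrtr1 ler_wsqrtr// ler1n; lia.
have s0 : 0 < Num.sqrt n%:R :> R by lra.
have hs : K / e <= Num.sqrt n%:R.
  have Ke : 0 <= K / e by rewrite divr_ge0// ltW.
  by rewrite -[leLHS](ger0_norm Ke) -sqrtr_sqr ler_wsqrtr.
rewrite distrC; apply: le_trans (key n n2) _.
apply: (@le_trans _ _ (K / Num.sqrt n%:R)); last first.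
  by rewrite ler_pdivrMr// mulrC -ler_pdivrMr.
have d4 : 0 <= 4 * d%:R ^+ 2 :> R by rewrite mulr_ge0// sqr_ge0.
have i1 : n%:R^-1 <= (Num.sqrt n%:R)^-1 :> R.
  by rewrite lef_pV2 ?posrE// -[leRHS](@sqr_sqrtr R n%:R)// expr2 ler_peMr// ltW.
rewrite /K -[leRHS]mulrA; apply: (ler_wpM2l C0).
by rewrite [leRHS]mulrDl mul1r lerD2l; exact: (ler_wpM2l d4).
Unshelve. all: by end_near. Qed.

(** A mean-square law of large numbers: every symmetrized summand has the mean of [f (X 0 - X 1)]
    and, for frozen permutations, depends on two neighbouring observations only. [D] is uniform in
    [n] and [l]. *)
Lemma Rint_emp_sqr (f : Vb R q -> R) : bmeas f -> exists D : R, forall n (l : 'I_d),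
  (1 < n)%N ->
  \int[Pr]_w ((n%:R^-1 * \sum_(i < n) 2^-1 * (f (incr X (Pi n l w) w i : Vb R q)
      + f (- incr X (Pi n l w) w i : Vb R q)) -
    \int[Pr]_w f (X 0%N w - X 1%N w : Vb R q)) ^+ 2) <= D / n%:R.
Proof.
move=> bf; have [M fM] := bf.2.
exists (#|{: option ('I_d * bool)}|%:R ^+ 2 * (2 * M) ^+ 2) => n l n1.
have n0 : (n%:R : R) != 0 by rewrite pnatr_eq0; lia.
pose m := \int[Pr]_w f (X 0%N w - X 1%N w : Vb R q).
pose f2 (z : Vb R q * Vb R q) := 2^-1 * (f (z.1 - z.2 : Vb R q) + f (z.2 - z.1 : Vb R q)).
have bf2 : bmeas f2.
  by apply: bmeasZ; apply: bmeasD; [exact: bmeas_diff|exact: bmeas_diffC].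
pose U (s : 'I_d -> {perm 'I_n}) (a : 'I_n) w := f2 (X (cycle_perm (s l) a) w, X a w).
pose F (s : 'I_d -> {perm 'I_n}) w := (n%:R^-1 * \sum_a U s a w - m) ^+ 2.
have -> : (fun w => (n%:R^-1 * \sum_(i < n) 2^-1 * (f (incr X (Pi n l w) w i : Vb R q)
      + f (- incr X (Pi n l w) w i : Vb R q)) - m) ^+ 2) = (fun w => F (fun l => Pi n l w) w).
  apply/funext => w; rewrite /F; congr ((_ * _ - _) ^+ 2).
  rewrite [RHS](reindex_inj (@perm_inj _ (Pi n l w)))/=; apply: eq_bigr => i _.
  by rewrite /U /f2 cycle_perm_image /= /incr opprB.
rewrite (exp_perm samp); last first.
  move=> s; apply: bmeasX; apply: bmeasB; last exact: bmeas_cst.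
  by apply: bmeasZ; apply: bmeas_sum => a _; exact: bmeas_var2.
have S0 : (0 < #|{perm 'I_n}|)%N by rewrite card_Sn fact_gt0.
rewrite -[leRHS](@ffavg_cst R {perm 'I_n} d _ S0); apply: ffavg_le => s.
have ne a : ((cycle_perm (s l) a : 'I_n) : nat) != a.
  by apply: contraNneq (cycle_perm_neq (s l) a n1) => /val_inj ->.
have EU a : \int[Pr]_w U s a w = m.
  rewrite /U /f2 expZ; last first.
    apply: bmeasD.
    - exact: (bmeas_pair mX _ _ (bmeas_diff bf)).
    - exact: (bmeas_pair mX _ _ (bmeas_diffC bf)).
  rewrite expD; [|exact: (bmeas_pair mX _ _ (bmeas_diff bf))|exact: (bmeas_pair mX _ _ (bmeas_diffC bf))].
  by rewrite /= !exp_diff// 1?eq_sym// -/m; field.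
have UM a w : `|U s a w| <= M.
  rewrite /U /f2 normrM ger0_norm ?invr_ge0//.
  rewrite ler_pdivrMl// (le_trans (ler_normD _ _))// mulr_natl mulr2n lerD//.
have bU a : bmeas (U s a : subsigma X [set i | exists k,
    i = nbr (fun l => cycle_perm (s l)) k a :> nat] -> R).
  apply: bmeas_var2 => //; first by exists (Some (l, true)).
  by exists None; rewrite /= perm1.
have vl := var_local_dependence mX PR bU UM.
have -> : (fun w => F s w) = (fun w => n%:R^-1 ^+ 2 * (\sum_a (U s a w - \int[Pr]_w U s a w)) ^+ 2).
  apply/funext => w; rewrite /F -exprMn; congr (_ ^+ 2).
  rewrite sumrB mulrBr; congr (_ - _); rewrite (eq_bigr (fun=> m)) => [|a _]; last exact: EU.
  by rewrite sumr_const card_ord -[m *+ n]mulr_natl mulrA mulVf// mul1r.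
have bU' a : bmeas (U s a) by exact: (bmeas_subsigma mX (bU a)).
rewrite expZ; last by bm.
have h1 : 0 <= n%:R^-1 ^+ 2 :> R by rewrite sqr_ge0.
apply: le_trans (ler_wpM2l h1 vl) _.
by eqle; field.
Qed.

End Statistic.

(** * Empirical measures as probabilities *)

Section EmpiricalMeasure.
Context {R : realType} {q : nat}.

Lemma empirical_measure (n : nat) (pt : 'I_n -> Vb R q) : (0 < n)%N ->
  exists Pq : probability (Vb R q) R,
    (forall A, Pq A = (n%:R^-1 * \sum_(i < n) \1_A (pt i))%:E) /\
    forall f, bmeas f -> \int[Pq]_x f x = n%:R^-1 * \sum_(i < n) f (pt i).
Proof.
move=> n0; have n0' : 0 < n%:R :> R by rewrite ltr0n.
(* [msum] is indexed by natural numbers; the default point is not reached below [n]. *)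
pose pt' (k : nat) : Vb R q := pt (insubd (Ordinal n0) k).
have pt'E (i : 'I_n) : pt' i = pt i.
  by rewrite /pt'; congr pt; apply: val_inj; rewrite val_insubd ltn_ord.
have ci : 0 <= (n%:R^-1 : R) by rewrite invr_ge0 ltW.
pose mu : {measure set (Vb R q) -> \bar R} := mscale (NngNum ci) (msum (fun k => \d_(pt' k) : {measure set (Vb R q) -> \bar R}) n).
have muE A : mu A = (n%:R^-1 * \sum_(i < n) \1_A (pt i))%:E.
  rewrite /mu /mscale /= /msum EFinM; congr (_ * _)%E.
  by rewrite -sumEFin; apply: eq_bigr => i _; rewrite -pt'E.
have muT : mu setT = 1%E.
  rewrite muE (eq_bigr (fun=> 1)) => [|i _]; last by rewrite indicE in_setT.
  by rewrite sumr_const card_ord mulVf// gt_eqF.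
pose mi := Measure_isProbability.Build _ _ _ mu muT.
pose Pq : probability (Vb R q) R := HB.pack (Measure.sort mu) mi.
exists Pq; split; first exact: muE.
have nn f : bmeas f -> (forall x, 0 <= f x) -> \int[Pq]_x f x = n%:R^-1 * \sum_(i < n) f (pt i).
  move=> bf f0; rewrite /Rintegral.
  have mf : measurable_fun setT (EFin \o f) by apply/measurable_EFinP; exact: bf.1.
  transitivity (fine (\int[mu]_x (f x)%:E)); first by [].
  rewrite ge0_integral_mscale//; last by move=> x _; rewrite lee_fin.
  rewrite ge0_integral_measure_sum//; last by move=> x _; rewrite lee_fin.
  under eq_bigr do rewrite integral_dirac// diracT mul1e.
  rewrite sumEFin -EFinM /=; congr (_ * _); apply: eq_bigr => i _.
  by rewrite /= pt'E.
move=> f bf; have [M fM] := bf.2.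
have M0 : 0 <= M := le_trans (normr_ge0 _) (fM 0).
(* Shifting by [M] reduces a bounded [f] to the nonnegative case. *)
have fM0 x : 0 <= f x + M by have := fM x; rewrite ler_norml => /andP[]; lra.
have := nn (fun x => f x + M) (bmeasD bf (bmeas_cst M)) fM0.
rewrite expD//; last exact: bmeas_cst.
rewrite exp_cst big_split/= sumr_const card_ord -[M *+ n]mulr_natl mulrDr.
by rewrite (mulKf (lt0r_neq0 n0')) => /addIr.
Qed.

End EmpiricalMeasure.

Section EmpiricalPairs.
Context {d0 : measure_display} {Om : measurableType d0} {R : realType} {q : nat}.
Variable (X : nat -> Om -> Vb R q).

(** [Qhat] puts equal weights on [2 n] points, the increments and their negatives, which is an
    instance of [empirical_measure]. *)
Lemma Qhat_measure n (s : {perm 'I_n}) w : (0 < n)%N ->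
  exists Pq : probability (Vb R q) R,
    (forall A, Pq A = Qhat X s w A) /\
    forall f, bmeas f -> \int[Pq]_x f x = n%:R^-1 * \sum_(i < n)
      2^-1 * (f (incr X s w i : Vb R q) + f (- incr X s w i : Vb R q)).
Proof.
move=> n0.
pose pt (k : 'I_(n + n)) : Vb R q :=
  match fintype.split k with inl i => incr X s w i | inr i => - incr X s w i end.
have nn0 : (0 < n + n)%N by rewrite addn_gt0 n0.
have e (f : Vb R q -> R) : (n + n)%:R^-1 * \sum_(k < n + n) f (pt k) =
    n%:R^-1 * \sum_(i < n) 2^-1 * (f (incr X s w i : Vb R q) + f (- incr X s w i : Vb R q)).
  have n0' : (n%:R : R) != 0 by rewrite pnatr_eq0 -lt0n.
  rewrite big_split_ord/= -mulr_sumr big_split/= natrD.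
  rewrite (eq_bigr (fun i => f (incr X s w i : Vb R q))); last first.
    by move=> i _; rewrite /pt (unsplitK (inl i)).
  rewrite [X in _ * (_ + X) = _](eq_bigr (fun i => f (- incr X s w i : Vb R q))); last first.
    by move=> i _; rewrite /pt (unsplitK (inr i)).
  move: (\sum_(i < n) f (incr X s w i : Vb R q)) (\sum_(i < n) f (- incr X s w i : Vb R q)) => a b.
  by field; rewrite n0' -mulr2n mulrn_eq0.
have [Pq [h1 h2]] := empirical_measure pt nn0.
exists Pq; split=> [A|f bf]; first by rewrite h1 e.
by rewrite h2// e.
Qed.

Lemma Qhat_is_prob n (s : {perm 'I_n}) w : (0 < n)%N -> is_prob (Qhat X s w).
Proof. by move=> n0; have [Pq [h _]] := Qhat_measure s w n0; exists Pq. Qed.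

Lemma Rint_Qhat n (s : {perm 'I_n}) w (f : Vb R q -> R) : (0 < n)%N -> bmeas f ->
  Defs.Rint (Qhat X s w) f = n%:R^-1 * \sum_(i < n)
      2^-1 * (f (incr X s w i : Vb R q) + f (- incr X s w i : Vb R q)).
Proof.
move=> n0 bf; have [Pq [h1 h2]] := Qhat_measure s w n0.
rewrite -h2//; have -> : Qhat X s w = Pq :> (set _ -> \bar R) by apply/funext => A; rewrite h1.
by [].
Qed.

End EmpiricalPairs.

(** * Orthogonal projections *)

Section Projections.
Context {R : realType} {q : nat}.

Lemma gram_unit k (A : 'M[R]_(k, q)) : row_free A -> A *m A^T \in unitmx.
Proof.
move=> fA; rewrite -row_free_unit -kermx_eq0; apply/rowV0P => v /sub_kermxP h.
have h2 : (v *m A) *m (v *m A)^T = 0 by rewrite trmx_mul mulmxA -[v *m A *m A^T]mulmxA h mul0mx.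
have h3 : v *m A = 0.
  apply/rowP => j; rewrite [RHS]mxE; apply/eqP.
  have /eqP : \sum_i (v *m A) ord0 i * (v *m A)^T i ord0 = 0.
    by move/matrixP/(_ ord0 ord0): h2; rewrite mxE [X in _ = X]mxE.
  rewrite psumr_eq0; last by move=> i _; rewrite [X in _ * X]mxE -expr2 sqr_ge0.
  by move=> /allP/(_ j); rewrite mem_index_enum => /(_ isT)/=; rewrite [X in _ * X]mxE mulf_eq0 orbb.
by apply: (row_free_inj fA); rewrite mul0mx.
Qed.

(* The orthogonal projections of trace [k]; these form a compact set, unlike the
   matrices of rank [k]. *)
Definition proj_set (k : nat) : set 'M[R]_q :=
  [set D | [/\ D *m D = D, D^T = D & \tr D = k%:R]].

(** The projection is [A^T (A A^T)^-1 A] for a row basis [A] of [W]; [gram_unit] makes the Gram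
    matrix invertible. *)
Lemma proj_exists (W : 'M[R]_q) : exists D, proj_set (\rank W) D /\
  forall x : 'rV[R]_q, (x <= W)%MS -> x *m D = x.
Proof.
pose A := row_base W; have fA : row_free A by rewrite /A row_base_free.
have uA := gram_unit fA.
pose B := A^T *m invmx (A *m A^T).
have e : A *m B = 1%:M by rewrite /B mulmxA mulmxV.
exists (B *m A); split; first split.
- by rewrite mulmxA -[B *m A *m B]mulmxA e mulmx1.
- have sG : (invmx (A *m A^T))^T = invmx (A *m A^T) by rewrite trmx_inv trmx_mul trmxK.
  have BT : B^T = invmx (A *m A^T) *m A by rewrite /B trmx_mul sG trmxK.
  by rewrite trmx_mul BT mulmxA.
- by rewrite mxtrace_mulC e mxtrace1.
- move=> x; rewrite -(eq_row_base W) => /submxP[v ->].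
  by rewrite -/A mulmxA -[v *m A *m B]mulmxA e mulmx1.
Qed.

(** In a full-rank factorization [D = C R] idempotence forces [R C = 1], so the trace, being cyclic,
    equals the rank. *)
Lemma proj_rank k (D : 'M[R]_q) : proj_set k D -> \rank D = k.
Proof.
move=> [DD _ tD].
have := mulmx_base D => e.
have h : row_base D *m col_base D = 1%:M.
  apply: (row_free_inj (row_base_free D)).
  apply: (@row_full_inj _ _ _ _ (col_base D)); first exact: col_base_full.
  by rewrite mul1mx e -mulmxA mulmxA e DD.
have : \tr D = (\rank D)%:R by rewrite -{1}e mxtrace_mulC h mxtrace1.
by rewrite tD => /eqP; rewrite eqr_nat => /eqP.
Qed.

Lemma proj_mem (D : 'M[R]_q) (x : 'rV[R]_q) : D *m D = D -> (x <= D)%MS = (x *m D == x).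
Proof.
move=> DD; apply/idP/eqP => [/submxP[v ->]|<-]; first by rewrite -mulmxA DD.
exact: submxMl.
Qed.

Lemma proj_bound k (D : 'M[R]_q) i j : proj_set k D -> `|D i j| <= 1 + k%:R.
Proof.
move=> [DD Ds tD]; apply: le_trans (mxnorm_entry D i j) _.
have : frob D D = k%:R by rewrite /frob Ds DD.
rewrite /mxnorm => ->; have k0 : 0 <= k%:R :> R by [].
have h : k%:R <= (1 + k%:R) ^+ 2 :> R by nra.
have := ler_wsqrtr h; rewrite sqrtr_sqr ger0_norm// addr_ge0//.
Qed.

End Projections.

(** * Weak neighbourhoods and Tyler's subspace condition *)

Section WeakNeighbourhoods.
Context {R : realType} {q : nat}.
Implicit Types (Q : dist R q) (N : set (dist R q)).

Lemma weak_nbhdT Q : weak_nbhd Q setT.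
Proof. by exists 0%N, (fun _ _ => 0), 1; split => //; split => // -[]. Qed.

Lemma weak_nbhdS Q N N' : (forall Q', is_prob Q' -> N Q' -> N' Q') ->
  weak_nbhd Q N -> weak_nbhd Q N'.
Proof.
move=> NN' [k [f [e [e0 [cf h]]]]]; exists k, f, e; split => //; split => // Q' pQ' hQ'.
by apply: NN' => //; exact: h.
Qed.

Lemma weak_nbhdI Q N N' : weak_nbhd Q N -> weak_nbhd Q N' -> weak_nbhd Q (N `&` N').
Proof.
move=> [k [f [e [e0 [cf h]]]]] [k' [f' [e' [e0' [cf' h']]]]].
exists (k + k')%N, (fun i => match fintype.split i with inl i => f i | inr i => f' i end),
  (Num.min e e'); split; first by rewrite lt_min e0.
split; first by move=> i; case: (fintype.split i).
move=> Q' pQ' hQ'; split.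
  apply: h => // i; have := hQ' (lshift k' i); rewrite (unsplitK (inl i)) => /lt_le_trans; apply.
  by rewrite ge_min lexx.
apply: h' => // i; have := hQ' (rshift k i); rewrite (unsplitK (inr i)) => /lt_le_trans; apply.
by rewrite ge_min lexx orbT.
Qed.

Lemma weak_nbhd_all Q (I : eqType) (r : seq I) (N : I -> set (dist R q)) :
  (forall i, i \in r -> weak_nbhd Q (N i)) ->
  weak_nbhd Q [set Q' | forall i, i \in r -> N i Q'].
Proof.
elim: r => [|i r IH] h; first by apply: weak_nbhdS (weak_nbhdT Q).
have h1 : weak_nbhd Q (N i) by apply: h; rewrite mem_head.
have h2 := IH (fun j jr => h j (mem_behead (s := i :: r) jr)).
apply: weak_nbhdS (weak_nbhdI h1 h2) => Q' _ [a b] j.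
by rewrite inE => /orP[/eqP ->//|]; exact: b.
Qed.

Lemma weak_nbhd_lt Q (f : 'rV[R]_q -> R) (c : R) : bounded_continuous f ->
  Defs.Rint Q f < c -> weak_nbhd Q [set Q' | Defs.Rint Q' f < c].
Proof.
move=> bf fc; exists 1%N, (fun=> f), (c - Defs.Rint Q f); split; first by rewrite subr_gt0.
split => // Q' _ /(_ ord0) /=.
by rewrite ltr_norml => /andP[_]; rewrite ltrD2r.
Qed.

End WeakNeighbourhoods.

Section SubspaceNeighbourhoods.
Context {R : realType} {q : nat}.

Definition norm1 (x : 'rV[R]_q) : R := \sum_j `|x ord0 j|.

Lemma norm1_ge0 x : 0 <= norm1 x.
Proof. exact: sumr_ge0. Qed.

Lemma norm1_eq0 x : norm1 x = 0 -> x = 0.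
Proof.
move=> /eqP; rewrite psumr_eq0// => /allP h; apply/rowP => j; rewrite mxE.
by have := h j; rewrite mem_index_enum => /(_ isT); rewrite /= normr_eq0 => /eqP.
Qed.

Lemma mulmx_coord_cont (D : 'M[R]_q) j : continuous (fun x : 'rV[R]_q => (x *m D) ord0 j).
Proof.
have -> : (fun x : 'rV[R]_q => (x *m D) ord0 j) = (fun x => \sum_i x ord0 i * D i j).
  by apply/funext => x; rewrite mxE.
apply: continuous_bigsum => i; apply: continuous_mulr_fun; first exact: coord_cont.
exact: continuous_cst_fun.
Qed.

Definition defect (D : 'M[R]_q) (x : 'rV[R]_q) : R := norm1 (x - x *m D).

Lemma norm1_cont : continuous norm1.
Proof.
by apply: continuous_bigsum => j; apply: continuous_normr_fun; exact: coord_cont.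
Qed.

Lemma defect_cont D : continuous (defect D).
Proof.
apply: (@continuous_bigsum _ _ _ (fun j (x : 'rV[R]_q) => `|(x - x *m D) ord0 j|)) => j.
have -> : (fun x : 'rV[R]_q => `|(x - x *m D) ord0 j|) = (fun x => `|x ord0 j - (x *m D) ord0 j|).
  by apply/funext => y; rewrite mxE [X in _ + X]mxE.
apply: continuous_normr_fun; apply: continuous_subr_fun; first exact: coord_cont.
exact: mulmx_coord_cont.
Qed.

(** A cut-off of the subspace [x D = x] whose width grows with [norm1 x]. The growth lets one bump
    dominate the indicators of all nearby subspaces, since the deviation [x (D' - D)] scales with
    [x]. *)
Definition bump (m : nat) (D : 'M[R]_q) (x : 'rV[R]_q) : R :=
  Num.max 0 (Num.min 1 (1 + norm1 x - m%:R * defect D x)).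

Lemma bump_cont m D : bounded_continuous (bump m D).
Proof.
split; last first.
  exists 1 => x; rewrite /bump ger0_norm ?le_max ?lexx//.
  by rewrite ge_max ler01 ge_min lexx.
have h : continuous (fun x => 1 + norm1 x - m%:R * defect D x).
  apply: continuous_subr_fun.
    by apply: continuous_addr_fun; [exact: continuous_cst_fun|exact: norm1_cont].
  by apply: continuous_mulr_fun; [exact: continuous_cst_fun|exact: defect_cont].
move=> x; apply: (@continuous_max R _ (fun=> 0) (fun x => Num.min 1 (1 + norm1 x - m%:R * defect D x))).
  exact: continuous_cst_fun.
apply: (@continuous_min R _ (fun=> 1) (fun x => 1 + norm1 x - m%:R * defect D x)).
  exact: continuous_cst_fun.
exact: h.
Qed.

Lemma bump_bmeas m D : bmeas (bump m D : Vb R q -> R).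
Proof.
have [c b] := bump_cont m D; split => //; exact: continuous_Vb_measurable.
Qed.

Lemma bump_subspace m (D D' : 'M[R]_q) (x : 'rV[R]_q) :
  (forall i j, `|D' i j - D i j| <= (m%:R * q%:R)^-1) -> x *m D' = x -> bump m D x = 1.
Proof.
move=> DD' xD'.
have [m0|m0] := posnP m.
  rewrite /bump m0 mul0r subr0 min_l ?max_r// lerDl; exact: norm1_ge0.
have [q0|q0] := posnP q.
  have z v : norm1 v = 0 by rewrite /norm1 big1// => j; have := ltn_ord j; rewrite {2}q0.
  by rewrite /bump /defect !z mulr0 subr0 addr0 min_l ?max_r.
have mq : 0 < m%:R * q%:R :> R by rewrite mulr_gt0 ?ltr0n.
(* Each of the [q] coordinates of [x (D' - D)] is at most [norm1 x / (m q)], which explains the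
   tolerance. *)
have h : m%:R * defect D x <= norm1 x.
  have -> : defect D x = norm1 (x *m (D' - D)) by rewrite /defect mulmxBr xD'.
  rewrite -ler_pdivlMl ?ltr0n// /norm1.
  apply: (@le_trans _ _ (\sum_(j < q) \sum_i `|x ord0 i| * (m%:R * q%:R)^-1)).
    apply: ler_sum => j _; rewrite mxE; apply: le_trans (ler_norm_sum _ _ _) _.
    apply: ler_sum => i _; rewrite normrM ler_wpM2l//.
    by rewrite mxE [X in _ + X]mxE.
  rewrite sumr_const card_ord -mulr_suml -[leLHS]mulr_natl; eqle.
  by field; rewrite !pnatr_eq0 -!lt0n m0 q0.
by rewrite /bump min_l ?max_r//; lra.
Qed.

Lemma defect_eq0 (D : 'M[R]_q) x : defect D x = 0 -> x *m D = x.
Proof. by move=> /norm1_eq0/eqP; rewrite subr_eq0 => /eqP. Qed.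

(* The bumps decrease to the indicator of the subspace [x D = x]. *)
Lemma bump_integral (Q : probability (Vb R q) R) (D : 'M[R]_q) (c : R) :
  (Q [set x : Vb R q | x *m D = x] < c%:E)%E ->
  exists2 m : nat, (0 < m)%N & \int[Q]_x bump m D x < c.
Proof.
move=> QD.
pose A (m : nat) : set (Vb R q) := [set x | m%:R * defect D x < 1 + norm1 x].
have mA m : measurable (A m).
  have md := continuous_Vb_measurable (@defect_cont D).
  have mn := continuous_Vb_measurable norm1_cont.
  have mf : measurable_fun setT (fun x : Vb R q => 1 + norm1 x - m%:R * defect D x).
    apply: measurable_funB; first by apply: measurable_funD => //; exact: measurable_cst.
    by apply: measurable_funM => //; exact: measurable_cst.
  rewrite -[X in measurable X]setTI.
  have := mf measurableT _ (measurable_itv `]0, +oo[).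
  by congr measurable; apply/seteqP; split=> x /=; rewrite in_itv/= andbT subr_gt0.
have AD : \bigcap_m A m = [set x : Vb R q | x *m D = x].
  apply/seteqP; split=> x /=; last first.
    move=> h m _; rewrite /A/= /defect h subrr.
    have -> : norm1 0 = 0 by rewrite /norm1 big1// => j _; rewrite mxE normr0.
    by rewrite mulr0; have := norm1_ge0 x; lra.
  move=> h; apply: defect_eq0; apply/eqP; rewrite eq_le {2}/defect norm1_ge0 andbT leNgt.
  apply/negP => d0.
  have := h (Num.truncn ((1 + norm1 x) / defect D x)).+1 I; rewrite /A/= -ltr_pdivlMr//.
  by move=> /(lt_trans (truncnS_gt _)); rewrite ltxx.
have : (Q \o A) @ \oo --> Q (\bigcap_m A m).
  apply: nonincreasing_cvg_mu => //.
  - by rewrite ltey_eq fin_num_measure.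
  - exact: bigcapT_measurable.
  - move=> m n mn; apply/subsetPset => x /=; apply: le_lt_trans.
    by rewrite ler_wpM2r ?ler_nat// /defect norm1_ge0.
have mD : measurable [set x : Vb R q | x *m D = x] by rewrite -AD; exact: bigcapT_measurable.
rewrite AD => cv.
have QDf : Q [set x : Vb R q | x *m D = x] = (fine (Q [set x : Vb R q | x *m D = x]))%:E.
  by rewrite fineK// fin_num_measure.
rewrite QDf lte_fin in QD; rewrite QDf in cv.
move/fine_cvgP : cv => [_] /cvgrPdist_lt /(_ (c - fine (Q [set x : Vb R q | x *m D = x]))).
rewrite subr_gt0 => /(_ QD)[m _ hm]; exists m.+1 => //.
have := hm m.+1 (leqnSn m); rewrite /= ltr_norml => /andP[h _].
apply: (@le_lt_trans _ _ (fine (Q (A m.+1)))); last by lra.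
rewrite -exp_indic//; apply: exp_le; [exact: bump_bmeas|exact: bmeas_indic|] => x.
rewrite indicE; case: (boolP (x \in A m.+1)) => [_|]; first by rewrite /bump ge_max ler01 ge_min lexx.
move=> /negP; rewrite inE /A/= => /negP; rewrite -leNgt => hx.
by rewrite /bump ge_max lexx/= ge_min; apply/orP; right; lra.
Qed.

(** Closed polynomial equations inside a box, stated on flattened matrices because [box_compact]
    concerns row vectors. *)
Lemma proj_set_compact k :
  compact [set v : 'rV[R]_(q * q) | proj_set k (vec_mx v)].
Proof.
have cc (i j : 'I_q) : continuous (fun v : 'rV[R]_(q * q) => (vec_mx v : 'M[R]_q) i j).
  have -> : (fun v : 'rV[R]_(q * q) => (vec_mx v : 'M[R]_q) i j) = (fun v => v ord0 (mxvec_index i j)).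
    by apply/funext => v; rewrite mxE.
  by move=> v; exact: coord_continuous.
have cl0 (g : 'rV[R]_(q * q) -> R) : continuous g -> closed [set v | g v = 0].
  move=> cg; have -> : [set v | g v = 0] = g @^-1` [set 0] by [].
  by apply: closed_comp; [move=> v _; exact: cg|exact: closed_eq].
have -> : [set v : 'rV[R]_(q * q) | proj_set k (vec_mx v)] =
  [set v : 'rV[R]_(q * q) | forall j, `|v ord0 j| <= 1 + k%:R] `&`
  ((\bigcap_(ij in [set: 'I_q * 'I_q]) [set v : 'rV[R]_(q * q) |
      \sum_l (vec_mx v : 'M[R]_q) ij.1 l * (vec_mx v : 'M[R]_q) l ij.2 - (vec_mx v : 'M[R]_q) ij.1 ij.2 = 0]) `&`
   ((\bigcap_(ij in [set: 'I_q * 'I_q]) [set v : 'rV[R]_(q * q) |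
      (vec_mx v : 'M[R]_q) ij.2 ij.1 - (vec_mx v : 'M[R]_q) ij.1 ij.2 = 0]) `&`
    [set v : 'rV[R]_(q * q) | \sum_i (vec_mx v : 'M[R]_q) i i - k%:R = 0])).
  apply/seteqP; split=> v /=.
    move=> h; have [DD Ds tD] := h; split; [|split; [|split]].
    - move=> j; have := @mxvec_indexP q q j; case=> i j'.
      have := proj_bound i j' h; by rewrite mxE.
    - move=> [i j] _ /=; apply/eqP; rewrite subr_eq0; apply/eqP.
      by rewrite -[in RHS]DD [in RHS]mxE.
    - move=> [i j] _ /=; apply/eqP; rewrite subr_eq0; apply/eqP.
      by rewrite -[in LHS]Ds [in LHS]mxE.
    - by rewrite -tD /mxtrace subrr.
  move=> [_ [h1 [h2 h3]]]; split.
  - apply/matrixP => i j; rewrite [LHS]mxE.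
    by have /eqP := h1 (i, j) I; rewrite /= subr_eq0 => /eqP.
  - apply/matrixP => i j; rewrite [LHS]mxE.
    by have /eqP := h2 (i, j) I; rewrite /= subr_eq0 => /eqP.
  - by apply/eqP; rewrite -subr_eq0 /mxtrace h3.
apply: compact_closedI; first exact: (@box_compact R (q * q) (1 + k%:R)).
apply: closedI; last apply: closedI.
- apply: closed_bigI => -[i j] _ /=; apply: cl0; apply: continuous_subr_fun; last exact: cc.
  apply: continuous_bigsum => l; apply: continuous_mulr_fun; exact: cc.
- by apply: closed_bigI => -[i j] _ /=; apply: cl0; apply: continuous_subr_fun; exact: cc.
- apply: cl0; apply: continuous_subr_fun; last exact: continuous_cst_fun.
  by apply: continuous_bigsum => i; exact: cc.
Qed.

(** At each projection some bump has integral below [k / q]. By compactness finitely many bumps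
    dominate the indicators of all subspaces of dimension [k], and their integrals give finitely
    many weakly open constraints. *)
Lemma subspace_nbhd_rank (Q : probability (Vb R q) R) (k : nat) :
  (forall W : 'M[R]_q, \rank W = k ->
      (Q [set x : Vb R q | (x <= W)%MS] < (k%:R / q%:R)%:E)%E) ->
  weak_nbhd Q [set Q' : dist R q | forall W : 'M[R]_q, \rank W = k ->
      (Q' [set x : Vb R q | (x <= W)%MS] < (k%:R / q%:R)%:E)%E].
Proof.
move=> hQ; pose K := [set v : 'rV[R]_(q * q) | proj_set k (vec_mx v)].
have [m hm] : {m : 'rV[R]_(q * q) -> nat & forall v, K v -> (0 < m v)%N /\
    \int[Q]_x bump (m v) (vec_mx v) x < k%:R / q%:R}.
  apply: (@choice _ _ (fun v m => K v -> (0 < m)%N /\ \int[Q]_x bump m (vec_mx v) x < k%:R / q%:R)) => v.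
  have [Kv|Kv] := pselect (K v); last by exists 0%N.
  have [DD _ _] := Kv.
  have : (Q [set x : Vb R q | x *m vec_mx v = x] < (k%:R / q%:R)%:E)%E.
    have -> : [set x : Vb R q | x *m vec_mx v = x] = [set x : Vb R q | (x <= vec_mx v)%MS].
      by apply/seteqP; split=> x /=; rewrite (proj_mem x DD) => /eqP.
    by apply: hQ; exact: proj_rank Kv.
  by move=> /bump_integral[m0 h1 h2]; exists m0.
pose r v : R := ((m v)%:R * q%:R)^-1.
(* For [q = 0] the bound [k / q] is 0 by convention, which no measure undercuts. *)
have [q0|q0] := posnP q.
  apply: weak_nbhdS (weak_nbhdT _) => Q' pQ' _ W rW.
  exfalso; have z : k%:R / q%:R = 0 :> R by rewrite q0 invr0 mulr0.
  by have := hQ W rW; rewrite z ltNge measure_ge0.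
have r0 v : K v -> 0 < r v.
  by move=> /hm[h _]; rewrite invr_gt0 mulr_gt0 ?ltr0n.
have cK := @proj_set_compact k; rewrite compact_cover in cK.
have [D' D'K cov] : finite_subset_cover K (fun v : 'rV[R]_(q * q) => ball v (r v)) K.
  apply: cK; first by move=> v Kv; exact: ball_open.
  by move=> v Kv; exists v => //; apply: ballxx; exact: r0.
pose N v := [set Q' : dist R q | Defs.Rint Q' (bump (m v) (vec_mx v)) < k%:R / q%:R].
have := @weak_nbhd_all R q Q _ (finmap.enum_fset D') N.
have hN v : v \in finmap.enum_fset D' -> weak_nbhd Q (N v).
  move=> vD; apply: weak_nbhd_lt; first exact: bump_cont.
  by have Kv := set_mem (D'K v vD); have [_] := hm v Kv.
move=> /(_ hN); apply: weak_nbhdS => Q' [P' PQ'] hQ' W rW.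
have [D [pD xD]] := proj_exists W; rewrite rW in pD.
have KD : K (mxvec D) by rewrite /K/= mxvecK.
have [v /= vD' bv] := cov _ KD.
have Kv := set_mem (D'K v vD'); have [mv0 _] := hm v Kv.
have e : Q' = P' :> (set _ -> \bar R) by apply/funext => A; rewrite PQ'.
(* The row space of [W] is the fixed space of its projection [D], cut out by [q] linear
   equations. *)
have mW : measurable [set x : Vb R q | (x <= W)%MS].
  have [DD _ _] := pD.
  have -> : [set x : Vb R q | (x <= W)%MS] = \bigcap_(j in [set: 'I_q])
      [set x : Vb R q | (x *m D) ord0 j - x ord0 j = 0].
    apply/seteqP; split=> x /=.
      by move=> xW j _ /=; rewrite xD// subrr.
    move=> h; have xDx : x *m D = x.
      by apply/rowP => j; have /eqP := h j I; rewrite subr_eq0 => /eqP.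
    have rD : \rank D = \rank W by rewrite (proj_rank pD).
    have WD : (W <= D)%MS.
      by apply/row_subP => i; rewrite (proj_mem _ DD) xD// row_sub.
    have : (D <= W)%MS by have := mxrank_leqif_sup WD; rewrite rD => -[_]; rewrite eqxx => /esym.
    by apply: submx_trans; rewrite proj_mem// xDx.
  apply: fin_bigcap_measurable => // j _.
  have mf : measurable_fun setT (fun x : Vb R q => (x *m D) ord0 j - x ord0 j).
    apply: measurable_funB; last exact: Vb_coord_measurable.
    exact: (continuous_Vb_measurable (mulmx_coord_cont (D := D) (j := j))).
  rewrite -[X in measurable X]setTI.
  have := mf measurableT [set 0] (measurable_set1 0).
  by congr measurable.
rewrite -PQ' -[X in (X < _)%E]fineK ?fin_num_measure// lte_fin.
have := hQ' v vD'; rewrite /N/= e => /le_lt_trans; apply.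
rewrite -exp_indic//; apply: exp_le; [exact: bmeas_indic|exact: bump_bmeas|] => x.
rewrite indicE; case: (boolP (x \in _)) => [|_]; last by rewrite /bump le_max lexx.
rewrite inE/= => xW; rewrite (@bump_subspace (m v) (vec_mx v) D)//; last exact: xD.
move=> i j; move/(rV_ballP _ _ (r0 v Kv)) : bv => /(_ (mxvec_index i j)).
by rewrite mxvecE distrC [vec_mx v i j]mxE => /ltW.
Qed.

Lemma subspace_nbhd (Q : probability (Vb R q) R) :
  (forall W : 'M[R]_q, (1 <= \rank W < q)%N ->
      (Q [set x : Vb R q | (x <= W)%MS] < ((\rank W)%:R / q%:R)%:E)%E) ->
  weak_nbhd Q [set Q' : dist R q | forall W : 'M[R]_q, (1 <= \rank W < q)%N ->
      (Q' [set x : Vb R q | (x <= W)%MS] < ((\rank W)%:R / q%:R)%:E)%E].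
Proof.
move=> hQ.
have h k : k \in index_iota 1 q -> weak_nbhd Q [set Q' : dist R q | forall W : 'M[R]_q,
    \rank W = k -> (Q' [set x : Vb R q | (x <= W)%MS] < (k%:R / q%:R)%:E)%E].
  rewrite mem_index_iota => kq; apply: subspace_nbhd_rank => W rW.
  by rewrite -rW; apply: hQ; rewrite rW.
apply: weak_nbhdS (weak_nbhd_all h) => Q' _ hQ' W rW.
by apply: (hQ' (\rank W)) => //; rewrite mem_index_iota.
Qed.

End SubspaceNeighbourhoods.

(** * Unions of events and null limits of outer probabilities *)

Section Unions.
Context {d0 : measure_display} {Om : measurableType d0} {R : realType}.
Variable Pr : probability Om R.

Lemma prob_union_le (I : finType) (B : I -> set Om) : (forall i, measurable (B i)) ->
  exists E, [/\ measurable E, forall i, B i `<=` E & fine (Pr E) <= \sum_i fine (Pr (B i))].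
Proof.
move=> mB; pose E := \bigcup_(i in [set: I]) B i.
have mE : measurable E by apply: fin_bigcup_measurable => // i _; exact: mB.
exists E; split => //; first by move=> i w Bw; exists i.
rewrite -exp_indic//; under eq_bigr do rewrite -exp_indic//.
rewrite -exp_sum; last by move=> i _; exact: bmeas_indic.
apply: exp_le; [exact: bmeas_indic|by apply: bmeas_sum => i _; exact: bmeas_indic|] => w.
rewrite indicE; case: (boolP (w \in E)) => [|_]; last by apply: sumr_ge0 => i _; rewrite indicE.
move=> /set_mem[i _ Biw]; rewrite (bigD1 i)//= indicE mem_set// lerDl.
by apply: sumr_ge0 => j _; rewrite indicE.
Qed.

Lemma outerP_le (A E : set Om) : measurable E -> A `<=` E -> (outerP Pr A <= Pr E)%E.
Proof. by move=> mE AE; apply: ereal_inf_lbound; exists E. Qed.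

Lemma outerP_ge0 (A : set Om) : (0 <= outerP Pr A)%E.
Proof. by apply: le_ereal_inf_tmp => _ [E _ <-]; exact: measure_ge0. Qed.

Lemma outerP_cvg0 (A : nat -> set Om) :
  (forall e : R, 0 < e -> \forall n \near \oo,
     exists E, [/\ measurable E, A n `<=` E & fine (Pr E) <= e]) ->
  (fun n => outerP Pr (A n)) @ \oo --> 0%E.
Proof.
move=> h; apply: cvge_eventually => e e0; apply: filterS (h e e0) => n [E [mE AE hE]].
apply/andP; split.
  by apply: le_trans (outerP_ge0 _); rewrite lee_fin; lra.
by apply: le_trans (outerP_le mE AE) _; rewrite -[leLHS]fineK ?fin_num_measure// lee_fin add0r.
Qed.

Lemma outerP_cvg0P (A : nat -> set Om) : (fun n => outerP Pr (A n)) @ \oo --> 0%E ->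
  forall e : R, 0 < e -> \forall n \near \oo,
     exists E, [/\ measurable E, A n `<=` E & fine (Pr E) <= e].
Proof.
move=> h e e0; apply: filterS (cvge0_eventually h e0) => n.
exact: outerP_lt.
Qed.

Lemma bmeas_gt_measurable (f : Om -> R) (c : R) : bmeas f -> measurable [set w | c < `|f w|].
Proof.
move=> bf; rewrite -[X in measurable X]setTI.
have [mn _] := bmeas_norm bf.
have := mn measurableT _ (measurable_itv `]c, +oo[).
by congr measurable; apply/seteqP; split=> x /=; rewrite in_itv/= andbT.
Qed.

End Unions.

Lemma near_natr_ge (R : realType) (c : R) : \forall n \near \oo, c <= n%:R.
Proof.
exists (Num.truncn c).+1 => // m /= hm.
by apply: le_trans (ltW (truncnS_gt _)) _; rewrite ler_nat.
Qed.

(** * First-order expansion of the estimator *)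

Section Expansion.
Context {d0 : measure_display} {Om : measurableType d0} {R : realType} {q d : nat}.
Variables (Pr : probability Om R) (P : probability (Vb R q) R)
  (X : nat -> Om -> Vb R q) (Pi : forall n : nat, 'I_d -> Om -> {perm 'I_n}).
Hypothesis samp : sampling Pr P X Pi.
Variable J : 'rV[R]_q -> 'M[R]_q.
Hypothesis mJ : forall i j, measurable_fun setT (fun x : Vb R q => J x i j).
Hypothesis bJ : bounded_mxfun J.
Hypothesis eJ : even_mxfun J.
Let Q : dist R q := law Pr (fun w => (X 0%N w - X 1%N w : Vb R q)).
Hypothesis J0 : mxint Q J = 0.

(** Every observation starts one edge and ends another, hence the factor 2; evenness of [J] undoes
    the symmetrization in [Qhat]. *)
Lemma mxint_Qhat n (s : {perm 'I_n}) w : (0 < n)%N ->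
  mxint (Qhat X s w) J = 2%:R *: intH1_emp P J X n w + Mn P J X s w.
Proof.
move=> n0; apply/matrixP => i j.
rewrite [LHS]mxE (Rint_Qhat X s w n0 (bmeasJ mJ bJ i j)) [RHS]mxE [X in _ = X + _]mxE.
rewrite /intH1_emp /Mn [X in _ = _ * X + _]mxE [X in _ = _ + X]mxE !summxE.
have -> : \sum_(k < n) H2 P J (X (s k) w) (X (s (ordS k)) w) i j =
  \sum_(k < n) J (incr X s w k) i j - 2 * \sum_(k < n) H1 P J (X k w) i j.
  have e1 : \sum_(k < n) H1 P J (X (s k) w) i j = \sum_(k < n) H1 P J (X k w) i j.
    by rewrite [RHS](reindex_inj (@perm_inj _ s)).
  have e2 : \sum_(k < n) H1 P J (X (s (ordS k)) w) i j = \sum_(k < n) H1 P J (X k w) i j.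
    by rewrite [RHS](reindex_inj (inj_comp (@perm_inj _ s) (@ordS_inj n))).
  rewrite mulr_natl mulr2n -{1}e1 -e2 opprD addrA -!sumrB; apply: eq_bigr => k _.
  by rewrite H2E /incr -(eJ (X (s k) w - _)) opprB.
rewrite (eq_bigr (fun k => J (incr X s w k) i j)); first by ring.
by move=> k _; rewrite eJ; field.
Qed.

(** With these coefficients the linear statistic is [sqrt n] times an entry of the integral of [J]
    against [Qhat], and [lin_stat_sqr] yields its order n^(-1/2). *)
Definition coefJ (l : 'I_d) (i j : 'I_q) (k : 'I_d.+1) : 'M[R]_q :=
  match unlift ord0 k with
  | None => 2 *: delta_mx i j
  | Some l' => (l' == l)%:R *: delta_mx i j
  end.

Lemma lin_stat_coefJ l i j n w : lin_stat P X Pi J (coefJ l i j) n w =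
  Num.sqrt n%:R * (2%:R *: intH1_emp P J X n w + Mn P J X (Pi n l w) w) i j.
Proof.
rewrite /lin_stat big_ord_recl /coefJ unlift_none /stat_vec unlift_none.
rewrite frobZl frobZr frob_delta (bigD1 l)//= !liftK eqxx scale1r frobZr frob_delta.
rewrite big1 ?addr0; last first.
  by move=> l' /negbTE ll'; rewrite !liftK ll' scale0r frob0l.
move: (intH1_emp P J X n w) (Mn P J X (Pi n l w) w) => a b.
by rewrite !mxE; ring.
Qed.

Variables (F : set (dist R q)) (Sig : dist R q -> 'M[R]_q) (good : set (dist R q)).
Hypothesis diffJ : diff_at Sig F Q J.
Hypothesis nbhdF : weak_nbhd Q [set Q' | good Q' -> F Q'].
Hypothesis goodQ : forall n (l : 'I_d), (1 < n)%N -> exists Z : set Om,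
  [/\ measurable Z, Pr Z = 0%E & forall w, ~ Z w -> good (Qhat X (Pi n l w) w)].

(** Outside three small events [Qhat] is good, lies in the neighbourhood from differentiability at
    level [e1], and the integral of [J] has norm at most [q K / sqrt n]. The product of [e1] with
    this bound is below [e / sqrt n]. *)
Lemma sigma_expansion (l : 'I_d) :
  o_p Pr (fun n w => Sig (Qhat X (Pi n l w) w) - Sig Q
                     - 2%:R *: intH1_emp P J X n w - Mn P J X (Pi n l w) w)
         (fun n => (Num.sqrt n%:R)^-1).
Proof.
move=> e e0; apply: outerP_cvg0 => eta eta0.
have [D hD] : {D : 'I_q * 'I_q -> R & forall ij n, (1 < n)%N ->
    \int[Pr]_w (lin_stat P X Pi J (coefJ l ij.1 ij.2) n w ^+ 2) <= D ij}.
  apply: (@choice _ _ (fun ij D => forall n, (1 < n)%N ->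
    \int[Pr]_w (lin_stat P X Pi J (coefJ l ij.1 ij.2) n w ^+ 2) <= D)) => -[i j].
  exact: (lin_stat_sqr samp mJ bJ eJ J0 (coefJ l i j)).
pose DD : R := \sum_ij `|D ij|.
have DD0 : 0 <= DD by apply: sumr_ge0.
(* Large enough for the Chebyshev bound [DD / K^2 <= eta / 2]. *)
pose K : R := 1 + 2 * DD / eta.
have K1 : 1 <= K by rewrite lerDl divr_ge0// ?mulr_ge0// ltW.
have K0 : 0 < K by lra.
have KD : DD / K ^+ 2 <= eta / 2.
  rewrite ler_pdivrMr ?exprn_gt0//; apply: (@le_trans _ _ (eta / 2 * K)).
    rewrite /K mulrDr (_ : eta / 2 * (2 * DD / eta) = DD); last by field; rewrite gt_eqF.
    by rewrite lerDr mulr1 divr_ge0// ltW.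
  by rewrite ler_wpM2l ?divr_ge0 ?(ltW eta0)// expr2 ler_peMr// ltW.
pose e1 := e / (q%:R * K + 1).
have qK : 0 < q%:R * K + 1 by rewrite ltr_wpDl// mulr_ge0// ltW.
have e10 : 0 < e1 by rewrite divr_gt0.
have [N1 [nN1 hN1]] := diffJ e10.
have [k [f [e' [e'0 [cf hN]]]]] := weak_nbhdI nN1 nbhdF.
have bf i : bmeas (f i : Vb R q -> R).
  by have [c b] := cf i; split => //; exact: continuous_Vb_measurable.
have [D2 hD2] : {D2 : 'I_k -> R & forall i n (l : 'I_d), (1 < n)%N ->
  \int[Pr]_w ((n%:R^-1 * \sum_(a < n) 2^-1 * (f i (incr X (Pi n l w) w a : Vb R q)
      + f i (- incr X (Pi n l w) w a : Vb R q)) -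
    \int[Pr]_w f i (X 0%N w - X 1%N w : Vb R q)) ^+ 2) <= D2 i / n%:R}.
  apply: (@choice _ _ (fun i D2 => forall n (l : 'I_d), (1 < n)%N ->
  \int[Pr]_w ((n%:R^-1 * \sum_(a < n) 2^-1 * (f i (incr X (Pi n l w) w a : Vb R q)
      + f i (- incr X (Pi n l w) w a : Vb R q)) -
    \int[Pr]_w f i (X 0%N w - X 1%N w : Vb R q)) ^+ 2) <= D2 / n%:R)) => i.
  exact: (Rint_emp_sqr samp (bf i)).
pose C2 : R := \sum_i `|D2 i| / (e' / 2) ^+ 2.
have C20 : 0 <= C2 by apply: sumr_ge0 => i _; rewrite divr_ge0// sqr_ge0.
near=> n.
have n1 : (1 < n)%N by near: n; exact: nbhs_infty_gt.
have n0 : (0 < n)%N by exact: ltnW.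
have n0' : 0 < n%:R :> R by rewrite ltr0n.
have nC : 2 * C2 / eta <= n%:R by near: n; exact: near_natr_ge.
have [Z [mZ Z0 gZ]] := goodQ l n1.
pose T1 i w := n%:R^-1 * \sum_(a < n) 2^-1 * (f i (incr X (Pi n l w) w a : Vb R q)
      + f i (- incr X (Pi n l w) w a : Vb R q)) -
    \int[Pr]_w f i (X 0%N w - X 1%N w : Vb R q).
have bT1 i : bmeas (T1 i).
  apply: bmeasB; last exact: bmeas_cst.
  apply: (bmeas_perm samp (F := fun s w => n%:R^-1 * \sum_(a < n) 2^-1 *
    (f i (incr X (s l) w a : Vb R q) + f i (- incr X (s l) w a : Vb R q)))) => s.
  apply: bmeasZ; apply: bmeas_sum => a _; apply: bmeasZ; apply: bmeasD.
    exact: (bmeas_pair samp.1 _ _ (bmeas_diff (bf i))).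
  rewrite /incr; under eq_fun do rewrite opprB.
  exact: (bmeas_pair samp.1 _ _ (bmeas_diff (bf i))).
have [E1 [mE1 hE1 pE1]] := prob_union_le Pr
  (fun i => bmeas_gt_measurable (e' / 2) (bT1 i)).
have bL ij := bmeas_lin_stat samp mJ bJ (coefJ l ij.1 ij.2) n.
have [E2 [mE2 hE2 pE2]] := prob_union_le Pr
  (fun ij : 'I_q * 'I_q => bmeas_gt_measurable K (bL ij)).
have [E [mE hE pE]] := @prob_union_le _ _ _ Pr _ (fun i : option bool =>
  match i with None => Z | Some true => E1 | Some false => E2 end)
  ltac:(by case=> [[]|]).
exists E; split => //; last first.
  apply: le_trans pE _.
  rewrite (bigD1 None)//= (bigD1 (Some true))//= (bigD1 (Some false))//=.
  rewrite big1 ?addr0; last by case=> [[]|].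
  rewrite Z0 add0r [leRHS](splitr eta) lerD//.
    apply: le_trans pE1 _; apply: (@le_trans _ _ (C2 / n%:R)); last first.
      rewrite ler_pdivrMr//; move: nC; rewrite ler_pdivrMr// => nC.
      by rewrite mulrAC ler_pdivlMr// mulrC [eta * _]mulrC.
    rewrite /C2 mulr_suml; apply: ler_sum => i _.
    have e20 : 0 < e' / 2 by rewrite divr_gt0.
    apply: le_trans (prob_chebyshev (bT1 i) e20 (hD2 i n l n1)) _.
    rewrite [leRHS]mulrAC ler_wpM2r ?invr_ge0 ?sqr_ge0//.
    by rewrite ler_wpM2r ?invr_ge0 ?ler_norm// ltW.
  apply: le_trans pE2 _; apply: le_trans KD.
  rewrite /DD mulr_suml; apply: ler_sum => ij _.
  apply: le_trans (prob_chebyshev (bL ij) K0 (hD ij n n1)) _.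
  by rewrite ler_wpM2r ?invr_ge0 ?sqr_ge0// ler_norm.
move=> w /= hw; apply: contrapT => nE.
have nZ : ~ Z w by move=> h; apply: nE; exact: (hE None).
have nE1 : ~ E1 w by move=> h; apply: nE; exact: (hE (Some true)).
have nE2 : ~ E2 w by move=> h; apply: nE; exact: (hE (Some false)).
have pQ : is_prob (Qhat X (Pi n l w) w) by exact: Qhat_is_prob.
have [N1Q NFQ] : (N1 `&` [set Q' | good Q' -> F Q']) (Qhat X (Pi n l w) w).
  apply: hN => // i; rewrite (Rint_Qhat _ _ _ n0 (bf i)) (Rint_law samp (bf i)).
  have : `|T1 i w| <= e' / 2.
    by rewrite leNgt; apply/negP => h; apply: nE1; exact: (hE1 i).
  by move=> /le_lt_trans; apply; lra.
have FQ := NFQ (gZ w nZ).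
have := hN1 _ FQ N1Q; rewrite (mxint_Qhat _ _ n0) opprD addrA => hb.
move: hw; rewrite ltNge => /negP; apply; apply: le_trans hb _.
have s0 : 0 < Num.sqrt n%:R :> R by rewrite sqrtr_gt0.
have hJ : mxnorm (2%:R *: intH1_emp P J X n w + Mn P J X (Pi n l w) w) <= q%:R * (K / Num.sqrt n%:R).
  apply: mxnorm_le; first by rewrite divr_ge0// ltW.
  move=> i j; rewrite ler_pdivlMr//.
  have : `|lin_stat P X Pi J (coefJ l i j) n w| <= K.
    by rewrite leNgt; apply/negP => h; apply: nE2; exact: (hE2 (i, j)).
  by rewrite lin_stat_coefJ normrM (gtr0_norm s0) mulrC.
apply: le_trans (ler_wpM2l (ltW e10) hJ) _.
rewrite !mulrA ler_wpM2r ?invr_ge0 ?(ltW s0)// /e1 -mulrA mulrAC ler_pdivrMr//.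
by rewrite ler_wpM2l ?(ltW e0)// lerDl.
Unshelve. all: by end_near. Qed.

End Expansion.

(** * Continuity of maps into matrices *)

Section MatrixContinuity.
Context {R : realType} {T : topologicalType} {q : nat}.

Lemma continuous_mx_coords (g : T -> 'M[R]_q) :
  (forall i j, continuous (fun t => g t i j)) -> continuous g.
Proof.
move=> cg x A [B /= hB BA].
have h : \forall t \near x, forall i j, B i j (g t i j).
  by apply: filter_forall => i; apply: filter_forall => j; exact: cg.
by apply: filterS h => t ht; apply: BA => i j; exact: ht.
Qed.

Lemma continuous_ptws_coords (k : nat) (g : T -> {ptws 'I_k -> 'M[R]_q}) :
  (forall l i j, continuous (fun t => g t l i j)) -> continuous g.
Proof.
move=> cg x; apply/cvg_sup => l.
apply: (@continuous_comp_initial _ _ _ (fun h : 'I_k -> 'M[R]_q => h l) g).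
exact: (@continuous_mx_coords (fun t => g t l)).
Qed.

End MatrixContinuity.

(** * Joint characteristic function of independent Gaussian matrices *)

Section GaussianFamily.
Context {d1 : measure_display} {Om : measurableType d1} {R : realType} {q k : nat}.
Variables (Pr : probability Om R) (G : 'I_k -> Om -> 'M[R]_q) (c : 'I_k -> 'M[R]_q -> R).
Hypothesis indG : indep_mx Pr G.
Hypothesis gG : forall i, gaussian_sym Pr (G i) (c i).

Let Y : 'I_k -> Om -> Mb R q := G.
Let mY i : measurable_fun setT (Y i). Proof. by have [] := gG i. Qed.

Lemma gaussian_PR (B : 'I_k -> set (Mb R q)) (r : seq 'I_k) :
  uniq r -> (forall i, measurable (B i)) -> (forall i, i \notin r -> B i = setT) ->
  Pr [set w | forall i, B i (Y i w)] = (\prod_(i <- r) fine (Pr (Y i @^-1` B i)))%:E.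
Proof.
move=> ur mB Br; rewrite (indG mB); congr EFin.
rewrite (bigID (mem r))/= [X in _ * X]big1 ?mulr1; last first.
  move=> i /Br ->; rewrite -[RHS]/(fine (1%E : \bar R)) -(probability_setT Pr).
  by congr (fine (Pr _)); apply/seteqP; split.
rewrite -big_filter; apply: perm_big; apply: uniq_perm => //.
  by rewrite filter_uniq// index_enum_uniq.
by move=> i; rewrite mem_filter mem_index_enum andbT.
Qed.

Lemma measurable_frob d (T : measurableType d) (g : T -> Mb R q) (A : 'M[R]_q) :
  measurable_fun setT g -> measurable_fun setT (fun t => frob A (g t)).
Proof.
move=> mg; under eq_fun do rewrite frobE.
apply: measurable_sum => i; apply: measurable_sum => j.
apply: measurable_funM; first exact: measurable_cst.
exact: (measurableT_comp (Mb_coord_measurable i j) mg).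
Qed.

(** Induction over the summands: the addition formula and independence split off one Gaussian, and
    the product of sines has mean 0 because the sine of a single term has. *)
Lemma gaussian_family_charfun (A : 'I_k -> 'M[R]_q) (th : R) :
  \int[Pr]_w cos (\sum_i frob (A i) (G i w) + th) =
  cos th * expR (- ((\sum_i c i (symmetrize (A i))) / 2)).
Proof.
have main (r : seq 'I_k) : uniq r -> forall th,
  \int[Pr]_w cos (\sum_(i <- r) frob (A i) (G i w) + th) =
  cos th * expR (- ((\sum_(i <- r) c i (symmetrize (A i))) / 2)).
  elim: r => [|i r IH] /=.
    move=> _ ph; rewrite big_nil mul0r oppr0 expR0 mulr1.
    under eq_Rintegral do rewrite big_nil add0r; exact: exp_cst.
  move=> /andP[ir ur] ph.
  have e1 : (fun w => cos (\sum_(j <- i :: r) frob (A j) (G j w) + ph)) =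
    (fun w => cos (1 * frob (A i) (G i w) + 0) * cos (1 * (\sum_(j <- r) frob (A j) (G j w)) + ph) -
      sin (1 * frob (A i) (G i w) + 0) * sin (1 * (\sum_(j <- r) frob (A j) (G j w)) + ph)).
    by apply/funext => w; rewrite big_cons -addrA cosD !mul1r addr0.
  have dis (j : 'I_k) : [set i] j -> [set j | j \in r] j -> False.
    by move=> /= -> h; rewrite h in ir.
  have mi : measurable_fun setT ((fun w => frob (A i) (G i w)) : subsigma Y [set i] -> R).
    by apply: measurable_frob; exact: subsigma_measurable_var.
  have mr : measurable_fun setT ((fun w => \sum_(j <- r) frob (A j) (G j w)) : subsigma Y [set j | j \in r] -> R).
    have -> : (fun w => \sum_(j <- r) frob (A j) (G j w)) =
       (fun w => \sum_(j <- r) if j \in r then frob (A j) (G j w) else 0).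
      apply/funext => w; rewrite big_seq [RHS]big_seq.
      by apply: eq_bigr => j ->.
    apply: measurable_sum => j; have [jr|jr] := boolP (j \in r).
      by apply: measurable_frob; exact: subsigma_measurable_var.
    exact: measurable_cst.
  have bc1 := bmeas_cos 1 0 mi; have bs1 := bmeas_sin 1 0 mi.
  have bc2 := bmeas_cos 1 ph mr; have bs2 := bmeas_sin 1 ph mr.
  have lift1 (f : Om -> R) : bmeas (f : subsigma Y [set i] -> R) -> bmeas f.
    exact: bmeas_subsigma.
  have lift2 (f : Om -> R) : bmeas (f : subsigma Y [set j | j \in r] -> R) -> bmeas f.
    exact: bmeas_subsigma.
  rewrite e1 expB; [|apply: bmeasM; [exact: lift1|exact: lift2]
    |apply: bmeasM; [exact: lift1|exact: lift2]].
  rewrite (exp_indepM mY gaussian_PR dis bc1 bc2) (exp_indepM mY gaussian_PR dis bs1 bs2).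
  have [_ [sG /(_ _ (symmetrize_sym (A i)))[hc hs]]] := gG i.
  have fE w : frob (symmetrize (A i)) (G i w) = frob (A i) (G i w) by rewrite frob_symmetrize.
  have -> : \int[Pr]_w cos (1 * frob (A i) (G i w) + 0) = expR (- (c i (symmetrize (A i)) / 2)).
    rewrite -[RHS]/(fine (expR (- (c i (symmetrize (A i)) / 2)))%:E) -hc /Rintegral; congr fine.
    by apply: eq_integral => w _; rewrite mul1r addr0 fE.
  have -> : \int[Pr]_w sin (1 * frob (A i) (G i w) + 0) = 0.
    rewrite -[RHS]/(fine (0%E : \bar R)) -hs /Rintegral; congr fine.
    by apply: eq_integral => w _; rewrite mul1r addr0 fE.
  under [X in _ * X]eq_Rintegral do rewrite mul1r.
  rewrite mul0r subr0 (IH ur) big_cons mulrDl opprD expRD; ring.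
exact: (main _ (index_enum_uniq _)).
Qed.

End GaussianFamily.

(** * Cramer-Wold reduction *)

Section CentralLimit.
Context {d0 : measure_display} {Om : measurableType d0} {R : realType} {q d : nat}.
Variables (Pr : probability Om R) (P : probability (Vb R q) R)
  (X : nat -> Om -> Vb R q) (Pi : forall n : nat, 'I_d -> Om -> {perm 'I_n}).
Hypothesis samp : sampling Pr P X Pi.
Variable J : 'rV[R]_q -> 'M[R]_q.
Hypothesis mJ : forall i j, measurable_fun setT (fun x : Vb R q => J x i j).
Hypothesis bJ : bounded_mxfun J.
Hypothesis eJ : even_mxfun J.
Hypothesis sJ : symvalued J.
Let Q : dist R q := law Pr (fun w => (X 0%N w - X 1%N w : Vb R q)).
Hypothesis J0 : mxint Q J = 0.

Notation v1 := (var1 Pr P X J).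
Notation v2 := (var2 Pr P X J).

Lemma var1_symmetrize A : v1 (symmetrize A) = v1 A.
Proof.
rewrite /var1; congr fine; apply: eq_integral => w _.
by rewrite frob_symmetrize//; exact: H1_sym.
Qed.

Lemma var2_symmetrize A : v2 (symmetrize A) = v2 A.
Proof.
rewrite /var2; congr fine; apply: eq_integral => w _.
by rewrite frob_symmetrize//; exact: H2_sym.
Qed.

Lemma var2Z t A : v2 (t *: A) = t ^+ 2 * v2 A.
Proof.
have b (B : 'M[R]_q) : bmeas (fun w => frob B (H2 P J (X 0%N w) (X 1%N w)) ^+ 2).
  apply: bmeasX; exact: (bmeas_pair samp.1 0%N 1%N (bmeas_hfun P mJ bJ B)).
transitivity (\int[Pr]_w (t ^+ 2 * frob A (H2 P J (X 0%N w) (X 1%N w)) ^+ 2)).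
  by apply: eq_Rintegral => w _; rewrite frobZl exprMn.
by rewrite expZ.
Qed.

Definition comb N (A : 'I_N -> 'I_d.+1 -> 'M[R]_q) (a : 'rV[R]_N) (k : 'I_d.+1) : 'M[R]_q :=
  \sum_e a ord0 e *: A e k.

Lemma lin_stat_comb N (A : 'I_N -> 'I_d.+1 -> 'M[R]_q) a n w :
  dotr a (\row_e lin_stat P X Pi J (A e) n w) = lin_stat P X Pi J (comb A a) n w.
Proof.
rewrite /dotr /lin_stat; under eq_bigr do rewrite mxE mulr_sumr.
rewrite exchange_big/=; apply: eq_bigr => k _; rewrite /comb frob_suml.
by apply: eq_bigr => e _; rewrite frobZl.
Qed.

(** A linear combination of the [lin_stat (A e)] is again a linear statistic, with coefficients
    [comb A a], so [lin_stat_charfun] covers every direction. [y'] leaves room for the remainder of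
    the estimator. *)
Lemma lin_stat_clt d1 (Om' : measurableType d1) (Pr' : probability Om' R)
  N (A : 'I_N -> 'I_d.+1 -> 'M[R]_q) (z : Om' -> 'rV[R]_N)
  (y' : nat -> Om -> 'rV[R]_N) (f : 'rV[R]_N -> R) :
  (forall j, measurable_fun setT (fun w => z w ord0 j)) ->
  (forall (a : 'rV[R]_N) (th : R), \int[Pr']_w cos (dotr a (z w) + th) =
     cos th * expR (- ((v1 (comb A a ord0) + \sum_(l < d) v2 (comb A a (lift ord0 l))) / 2))) ->
  (forall e : R, 0 < e -> (fun n => outerP Pr [set w | exists j,
     e < `|y' n w ord0 j - lin_stat P X Pi J (A j) n w|]) @ \oo --> 0%E) ->
  bounded_continuous f ->
  (fun n => outerE Pr (fun w => f (y' n w))) @ \oo --> (\int[Pr']_w (f (z w))%:E)%E.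
Proof.
move=> mz cz hy bf.
have [D hD] : {D : 'I_N -> R & forall e n, (1 < n)%N ->
    \int[Pr]_w (lin_stat P X Pi J (A e) n w ^+ 2) <= D e}.
  apply: (@choice _ _ (fun e D => forall n, (1 < n)%N ->
    \int[Pr]_w (lin_stat P X Pi J (A e) n w ^+ 2) <= D)) => e.
  exact: (lin_stat_sqr samp mJ bJ eJ J0 (A e)).
apply: (@levy_slutsky _ _ _ _ _ Pr Pr' N (fun n w => \row_e lin_stat P X Pi J (A e) n w) y' z
  (\sum_e `|D e|)) => //.
- by move=> n j; under eq_fun do rewrite mxE; exact: (bmeas_lin_stat samp mJ bJ).
- near=> n => j; under eq_Rintegral do rewrite mxE.
  have n1 : (1 < n)%N by near: n; exact: nbhs_infty_gt.
  apply: le_trans (hD j n n1) _; apply: le_trans (ler_norm _) _.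
  by rewrite (bigD1 j)//= lerDl sumr_ge0.
- move=> a th; rewrite cz; under eq_fun do under eq_Rintegral do rewrite lin_stat_comb.
  exact: (lin_stat_charfun samp mJ bJ eJ J0).
- move=> e e0; set g := (X in X @ _).
  have -> : g = (fun n => outerP Pr [set w | exists j,
     e < `|y' n w ord0 j - lin_stat P X Pi J (A j) n w|]).
    apply/funext => n; congr outerP; apply/seteqP.
    by split=> w /= -[j hj]; exists j; move: hj; rewrite mxE.
  exact: hy.
Unshelve. all: by end_near. Qed.

End CentralLimit.

(** * Cases (a) and (b) under common hypotheses *)

Section SettingFacts.
Context {R : realType} {q : nat}.

Lemma Vb_set0_measurable : measurable ([set 0] : set (Vb R q)).
Proof.
have mf := continuous_Vb_measurable (@norm1_cont R q).
have -> : ([set 0] : set (Vb R q)) = norm1 @^-1` [set 0].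
  apply/seteqP; split => x /=; last exact: norm1_eq0.
  by move=> ->; rewrite /norm1 big1// => j _; rewrite mxE normr0.
by rewrite -[X in measurable X]setTI; apply: mf => //; exact: measurable_set1.
Qed.

(** The preimage of an open interval is an open set up to the point 0, and [[set 0]] is Borel. This
    supplies measurability of [J] in Tyler's case. *)
Lemma measurable_continuous_off0 (f : 'rV[R]_q -> R) :
  (forall x : 'rV[R]_q, x != 0 -> f @ x --> f x) -> measurable_fun setT (f : Vb R q -> R).
Proof.
move=> cf; apply: (measurability _ (RGenOpens.measurableE R)).
move=> _ [_ [a [b ->] <-]]; rewrite setTI; set U := f @^-1` _.
have -> : U = (U `&` [set 0]) `|` (U `\` [set 0]) by rewrite setUIDK.
apply: measurableU.
  have [U0|U0] := pselect (U 0).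
    by rewrite (_ : _ `&` _ = [set 0]); [exact: Vb_set0_measurable|
      apply/seteqP; split => [x []//|x ->]].
  by rewrite (_ : _ `&` _ = set0)//; apply/seteqP; split => // x [Ux x0]; apply: U0; rewrite -x0.
have -> : U `\` [set 0] = f @^-1` [set` `]a, b[] `&` (norm1 @^-1` [set t | t != 0]).
  apply/seteqP; split => x [/= Ux x0]; split => //.
    by apply/eqP => /norm1_eq0.
  by move=> xE; move: x0; rewrite xE /norm1 big1 ?eqxx// => j _; rewrite mxE normr0.
apply: sub_sigma_algebra; rewrite openE => x [/= fx nx].
have x0 : x != 0.
  by apply: contra_neq nx => ->; rewrite /norm1 big1// => j _; rewrite mxE normr0.
apply: filterI.
  by apply: (cf x x0); exact: (open_nbhs_nbhs (conj (interval_open _ _) fx)).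
have /(_ [set t | t != 0]) := @norm1_cont R q x; apply.
by apply: open_nbhs_nbhs; split => //; exact: open_neq.
Qed.

End SettingFacts.

Section Pairs.
Context {d0 : measure_display} {Om : measurableType d0} {R : realType} {q d : nat}.
Variables (Pr : probability Om R) (P : probability (Vb R q) R)
  (X : nat -> Om -> Vb R q) (Pi : forall n : nat, 'I_d -> Om -> {perm 'I_n}).
Hypothesis samp : sampling Pr P X Pi.
Let Q : dist R q := law Pr (fun w => (X 0%N w - X 1%N w : Vb R q)).

(** Every pair of distinct indices has the difference law [Q], so a tie in a given pair is null, and
    there are finitely many pairs. *)
Lemma ties_null n : Q [set 0] = 0%E -> exists Z : set Om,
  [/\ measurable Z, Pr Z = 0%E & forall w, ~ Z w ->
      forall a b : 'I_n, a != b -> X a w - X b w != 0 :> 'rV[R]_q].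
Proof.
move=> Q0; have mX := samp.1.
pose S (ab : 'I_n * 'I_n) : set Om := if ab.1 == ab.2 then set0 else
  (fun w => (X ab.1 w - X ab.2 w : Vb R q)) @^-1` [set 0].
have mD a b : measurable ((fun w => (X a w - X b w : Vb R q)) @^-1` [set 0]).
  rewrite -[X in measurable X]setTI.
  apply: (measurableT_comp (@Vb_sub_measurable R q) (measurable_fun_pair (mX a) (mX b))) => //.
  exact: Vb_set0_measurable.
have mS ab : measurable (S ab) by rewrite /S; case: ifP.
have pS ab : fine (Pr (S ab)) = 0.
  rewrite /S; case: ifPn => ab0; first by rewrite measure0.
  have bi : bmeas (\1_[set 0] : Vb R q -> R) by apply: bmeas_indic; exact: Vb_set0_measurable.
  have := exp_diff samp bi ab0.
  have e a b : \int[Pr]_w (\1_[set 0] (X a w - X b w : Vb R q) : R) =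
      fine (Pr ((fun w => (X a w - X b w : Vb R q)) @^-1` [set 0])).
    by rewrite -exp_indic.
  rewrite !e => ->; by rewrite [Pr _]Q0.
have [Z [mZ hZ pZ]] := prob_union_le Pr mS.
exists Z; split => //.
  have pZ0 : fine (Pr Z) = 0.
    apply/eqP; rewrite eq_le fine_ge0// andbT; apply: le_trans pZ _.
    by rewrite big1// => ab _; exact: pS.
  by rewrite -[LHS]fineK ?pZ0// fin_num_measure.
move=> w nZ a b ab; apply/eqP => h; apply: nZ; apply: (hZ (a, b)).
by rewrite /S/= (negbTE ab).
Qed.

Lemma Qhat_no_atom0 n (s : {perm 'I_n}) w : (1 < n)%N ->
  (forall a b : 'I_n, a != b -> X a w - X b w != 0 :> 'rV[R]_q) ->
  Qhat X s w [set 0] = 0%E.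
Proof.
move=> n1 h; rewrite /Qhat big1 ?mulr0// => i _.
have hi : incr X s w i != 0.
  apply: h; rewrite (inj_eq perm_inj); apply/eqP => /(congr1 val)/=.
  case: (ltnP i.+1 n) => hi.
    by rewrite modn_small// => /esym/n_Sn.
  have -> : i.+1 = n by apply/eqP; rewrite eqn_leq hi ltn_ord.
  rewrite modnn => i0; move: hi; by rewrite -i0 leqNgt n1.
rewrite !indicE !memNset ?addr0 ?mulr0//=; first by apply/eqP; rewrite oppr_eq0.
exact/eqP.
Qed.

Variables (F : set (dist R q)) (Sig : dist R q -> 'M[R]_q) (J : 'rV[R]_q -> 'M[R]_q).
Hypothesis FQ : F Q.
Hypothesis set_ : setting P F Sig Q J.

Lemma setting_Jprops : Jprops_a Q J /\ diff_at Sig F Q J.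
Proof.
case: set_ => [[_ []]|[_ [[cJ [_ hJ]] dJ]]] //; split => //; split => // i j.
apply: measurable_continuous_off0 => x x0.
have := cJ x x0 => h; apply: (cvg_comp J (fun M : 'M[R]_q => M i j) h).
exact: coord_continuous.
Qed.

(** In case (a) openness of [F] suffices. In case (b) the absence of an atom at 0 does not persist
    in weak neighbourhoods, so it becomes the property [good], which [Qhat] has outside the null set
    of ties. *)
Lemma setting_nbhd : exists good : set (dist R q),
  weak_nbhd Q [set Q' | good Q' -> F Q'] /\
  forall n (l : 'I_d), (1 < n)%N -> exists Z : set Om,
    [/\ measurable Z, Pr Z = 0%E & forall w, ~ Z w -> good (Qhat X (Pi n l w) w)].
Proof.
case: set_ => [[[[_ oF] _] _]|[[_ [FE _]] _]].
  exists setT; split; first by apply: weak_nbhdS (oF _ FQ) => Q' _ h _.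
  by move=> n l _; exists set0; split.
exists [set Q' | Q' [set 0] = 0%E].
move: FQ; rewrite FE => -[[PQ hPQ] [Q0 hQ]]; split; last first.
  move=> n l n1; have [Z [mZ pZ hZ]] := ties_null n Q0; exists Z; split => // w /hZ h.
  exact: Qhat_no_atom0.
have PQE : (PQ : dist R q) = Q by apply/funext.
have hPQ' (W : 'M[R]_q) : (1 <= \rank W < q)%N ->
      (PQ [set x : Vb R q | (x <= W)%MS] < ((\rank W)%:R / q%:R)%:E)%E.
  by move=> rW; rewrite hPQ; exact: hQ.
have := subspace_nbhd hPQ'; rewrite [X in weak_nbhd X _]PQE.
by apply: weak_nbhdS => Q' pQ' h Q'0; split.
Qed.

End Pairs.

(** * The two limit theorems *)

Section Convergence.
Context {d0 : measure_display} {Om : measurableType d0} {R : realType} {q d : nat}.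
Variables (Pr : probability Om R) (P : probability (Vb R q) R)
  (X : nat -> Om -> Vb R q) (Pi : forall n : nat, 'I_d -> Om -> {perm 'I_n}).
Hypothesis samp : sampling Pr P X Pi.
Variable J : 'rV[R]_q -> 'M[R]_q.
Hypothesis mJ : forall i j, measurable_fun setT (fun x : Vb R q => J x i j).
Hypothesis bJ : bounded_mxfun J.
Hypothesis eJ : even_mxfun J.
Hypothesis sJ : symvalued J.
Let Q : dist R q := law Pr (fun w => (X 0%N w - X 1%N w : Vb R q)).
Hypothesis J0 : mxint Q J = 0.

Notation v1 := (var1 Pr P X J).
Notation v2 := (var2 Pr P X J).

(** All entries of the [d + 1] matrices are laid out in one row vector by [ro]; continuity of its
    inverse [io] carries the test function over to row vectors. *)
Lemma stat_vec_clt d1 (Om' : measurableType d1) (Pr' : probability Om' R)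
  (G : 'I_d.+1 -> Om' -> 'M[R]_q) :
  indep_mx Pr' G -> gaussian_sym Pr' (G ord0) v1 ->
  (forall l : 'I_d, gaussian_sym Pr' (G (lift ord0 l)) v2) ->
  cvg_law Pr (stat_vec P J X Pi) Pr'
    (fun w => (fun k => G k w) : {ptws 'I_d.+1 -> 'M[R]_q}).
Proof.
move=> iG g1 g2 f [cf bf].
pose N := #|{: 'I_d.+1 * ('I_q * 'I_q)}|.
pose ix (e : 'I_N) : 'I_d.+1 * ('I_q * 'I_q) := enum_val e.
pose io (v : 'rV[R]_N) : {ptws 'I_d.+1 -> 'M[R]_q} :=
  fun k => \matrix_(i, j) v ord0 (enum_rank (k, (i, j))).
have cio : continuous io.
  apply: continuous_ptws_coords => l i j.
  have -> : (fun t : 'rV[R]_N => io t l i j) = (fun t => t ord0 (enum_rank (l, (i, j)))).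
    by apply/funext => t; rewrite mxE.
  exact: coord_cont.
pose A (e : 'I_N) (k : 'I_d.+1) : 'M[R]_q :=
  if k == (ix e).1 then delta_mx (ix e).2.1 (ix e).2.2 else 0.
have AE (v : 'I_d.+1 -> 'M[R]_q) e :
    \sum_k frob (A e k) (v k) = v (ix e).1 (ix e).2.1 (ix e).2.2.
  rewrite (bigD1 (ix e).1)//= {1}/A eqxx frob_delta big1 ?addr0// => k /negbTE ke.
  by rewrite /A ke frob0l.
pose ro (v : 'I_d.+1 -> 'M[R]_q) : 'rV[R]_N := \row_e v (ix e).1 (ix e).2.1 (ix e).2.2.
have ioK v : io (ro v) = v.
  by apply/funext => k; apply/matrixP => i j; rewrite !mxE /ix enum_rankK.
pose c (k : 'I_d.+1) := match unlift ord0 k with None => v1 | Some _ => v2 end.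
have gG k : gaussian_sym Pr' (G k) (c k).
  by case: (unliftP ord0 k) => [l ->|->]; rewrite /c ?liftK ?unlift_none.
have -> : (fun n => outerE Pr (fun w => f (stat_vec P J X Pi n w))) =
    (fun n => outerE Pr (fun w => (f \o io) (ro (stat_vec P J X Pi n w)))).
  by apply/funext => n; congr outerE; apply/funext => w; rewrite /= ioK.
have -> : (\int[Pr']_w (f (fun k => G k w))%:E)%E =
    (\int[Pr']_w ((f \o io) (ro (fun k => G k w)))%:E)%E.
  by apply: eq_integral => w _; rewrite /= ioK.
apply: (@lin_stat_clt _ _ _ _ _ Pr P X Pi samp J mJ bJ eJ J0 _ Om' Pr' N A
  (fun w => ro (fun k => G k w)) (fun n w => ro (stat_vec P J X Pi n w)) (f \o io)).
- move=> e; under eq_fun do rewrite mxE.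
  have [mG _] := gG (ix e).1.
  exact: (measurableT_comp (Mb_coord_measurable _ _) mG).
- move=> a th; transitivity (\int[Pr']_w cos (\sum_k frob (comb A a k) (G k w) + th)).
    apply: eq_Rintegral => w _; congr (cos (_ + _)).
    rewrite /dotr; under eq_bigr do rewrite mxE -(AE (fun k => G k w)) mulr_sumr.
    rewrite exchange_big/=; apply: eq_bigr => k _; rewrite /comb frob_suml.
    by apply: eq_bigr => e _; rewrite frobZl.
  rewrite (gaussian_family_charfun iG gG) big_ord_recl /c unlift_none var1_symmetrize//.
  congr (_ * expR (- ((_ + _) / 2))); apply: eq_bigr => l _.
  by rewrite liftK var2_symmetrize.
(* Here [y'] consists of the linear statistics themselves, so the exceptional event is empty. *)
- move=> e e0; apply: outerP_cvg0 => eta eta0; apply: nearW => n; exists set0; split => //.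
    by move=> w /= [j]; rewrite mxE -AE subrr normr0 => /(lt_trans e0); rewrite ltxx.
  by rewrite measure0 ltW.
- split; last by have [M fM] := bf; exists M => v; exact: fM.
  by move=> x; apply: (@continuous_comp _ _ _ io f); [exact: cio|exact: cf].
Qed.

Variable (Sig : dist R q -> 'M[R]_q).
Hypothesis expansion : forall l : 'I_d,
  o_p Pr (fun n w => Sig (Qhat X (Pi n l w) w) - Sig Q
                     - 2%:R *: intH1_emp P J X n w - Mn P J X (Pi n l w) w)
         (fun n => (Num.sqrt n%:R)^-1).

(** The remainders of the expansion form the gap between the estimator and the linear statistic;
    their average is small outside a union of [d] events of probability at most [eta / d]. *)
Lemma averaged_clt d1 (Om' : measurableType d1) (Pr' : probability Om' R)
  (G1 G2 : Om' -> 'M[R]_q) : (0 < d)%N ->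
  indep_mx Pr' (fun k : 'I_2 => if k == ord0 then G1 else G2) ->
  gaussian_sym Pr' G1 v1 -> gaussian_sym Pr' G2 v2 ->
  cvg_law Pr
    (fun n w => Num.sqrt n%:R *:
       (d%:R^-1 *: (\sum_(l < d) Sig (Qhat X (Pi n l w) w)) - Sig Q))
    Pr' (fun w => 2%:R *: G1 w + (Num.sqrt d%:R)^-1 *: G2 w).
Proof.
move=> dgt0 iG g1 g2 f [cf bf].
have dn0 : d%:R != 0 :> R by rewrite pnatr_eq0 -lt0n.
pose N := #|{: 'I_q * 'I_q}|.
pose ix (e : 'I_N) : 'I_q * 'I_q := enum_val e.
pose io (v : 'rV[R]_N) : 'M[R]_q := \matrix_(i, j) v ord0 (enum_rank (i, j)).
have cio : continuous io.
  apply: continuous_mx_coords => i j.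
  have -> : (fun t : 'rV[R]_N => io t i j) = (fun t => t ord0 (enum_rank (i, j))).
    by apply/funext => t; rewrite mxE.
  exact: coord_cont.
pose D (e : 'I_N) : 'M[R]_q := delta_mx (ix e).1 (ix e).2.
(* The weights 2 and [1 / d] come from averaging the expansion; the [d] variances [v2 / d^2] add up
   to [v2 / d], that of [d^(-1/2) G2]. *)
pose A (e : 'I_N) (k : 'I_d.+1) : 'M[R]_q :=
  match unlift ord0 k with None => 2 *: D e | Some _ => d%:R^-1 *: D e end.
pose ro (M : 'M[R]_q) : 'rV[R]_N := \row_e M (ix e).1 (ix e).2.
have ioK M : io (ro M) = M.
  by apply/matrixP => i j; rewrite !mxE /ix enum_rankK.
pose S n w := Num.sqrt n%:R *:
       (d%:R^-1 *: (\sum_(l < d) Sig (Qhat X (Pi n l w) w)) - Sig Q).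
pose L w := 2%:R *: G1 w + (Num.sqrt d%:R)^-1 *: G2 w.
have -> : (fun n => outerE Pr (fun w => f (Num.sqrt n%:R *:
       (d%:R^-1 *: (\sum_(l < d) Sig (Qhat X (Pi n l w) w)) - Sig Q)))) =
    (fun n => outerE Pr (fun w => (f \o io) (ro (S n w)))).
  by apply/funext => n; congr outerE; apply/funext => w; rewrite /= ioK.
have -> : (\int[Pr']_w (f (2%:R *: G1 w + (Num.sqrt d%:R)^-1 *: G2 w))%:E)%E =
    (\int[Pr']_w ((f \o io) (ro (L w)))%:E)%E.
  by apply: eq_integral => w _; rewrite /= ioK.
apply: (@lin_stat_clt _ _ _ _ _ Pr P X Pi samp J mJ bJ eJ J0 _ Om' Pr' N A
  (fun w => ro (L w)) (fun n w => ro (S n w)) (f \o io)).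
- move=> e; under eq_fun do rewrite mxE.
  have [mG1 _] := g1; have [mG2 _] := g2.
  have -> : (fun w => L w (ix e).1 (ix e).2) =
    (fun w => 2 * G1 w (ix e).1 (ix e).2 + (Num.sqrt d%:R)^-1 * G2 w (ix e).1 (ix e).2).
    by apply/funext => w; rewrite /L mxE [X in X + _]mxE [X in _ + X]mxE.
  apply: measurable_funD; apply: measurable_funM; [exact: measurable_cst| |exact: measurable_cst|].
    exact: (measurableT_comp (Mb_coord_measurable _ _) mG1).
  exact: (measurableT_comp (Mb_coord_measurable _ _) mG2).
- move=> a th.
  pose M : 'M[R]_q := \sum_e a ord0 e *: D e.
  have c0 : comb A a ord0 = 2 *: M.
    rewrite /comb /M scaler_sumr; apply: eq_bigr => e _.
    by rewrite /A unlift_none !scalerA mulrC.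
  have cl l : comb A a (lift ord0 l) = d%:R^-1 *: M.
    rewrite /comb /M scaler_sumr; apply: eq_bigr => e _.
    by rewrite /A liftK !scalerA mulrC.
  pose G (k : 'I_2) := if k == ord0 then G1 else G2.
  pose c (k : 'I_2) := if k == ord0 then v1 else v2.
  pose B (k : 'I_2) : 'M[R]_q := if k == ord0 then 2 *: M else (Num.sqrt d%:R)^-1 *: M.
  have gG k : gaussian_sym Pr' (G k) (c k) by rewrite /G /c; case: ifP.
  transitivity (\int[Pr']_w cos (\sum_k frob (B k) (G k w) + th)).
    apply: eq_Rintegral => w _; congr (cos (_ + _)).
    rewrite big_ord_recl big_ord1 /B /G/= !frobZl -!frobZr -frobDr -/(L w) /M frob_suml /dotr.
    by apply: eq_bigr => e _; rewrite mxE frobZl frob_delta.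
  rewrite (gaussian_family_charfun iG gG) big_ord_recl big_ord1 /c /B/=.
  rewrite var1_symmetrize// var2_symmetrize// c0; under [in RHS]eq_bigr do rewrite cl.
  rewrite sumr_const card_ord !(var2Z samp mJ bJ) exprVn sqr_sqrtr//.
  congr (_ * expR (- ((_ + _) / 2))).
  by rewrite -mulr_natl; field.
- move=> e e0; apply: outerP_cvg0 => eta eta0.
  pose Rem n l w := Sig (Qhat X (Pi n l w) w) - Sig Q
                     - 2%:R *: intH1_emp P J X n w - Mn P J X (Pi n l w) w.
  have eta1 : 0 < eta / d%:R by rewrite divr_gt0// ltr0n.
  have remE n w (j : 'I_N) : ro (S n w) ord0 j - lin_stat P X Pi J (A j) n w =
      Num.sqrt n%:R * (d%:R^-1 * \sum_l Rem n l w (ix j).1 (ix j).2).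
    have dK (x : R) : d%:R^-1 * (\sum_(l < d) x) = x.
      by rewrite sumr_const card_ord -[x *+ d]mulr_natl mulKf.
    have rE l : Rem n l w (ix j).1 (ix j).2 = Sig (Qhat X (Pi n l w) w) (ix j).1 (ix j).2 -
      Sig Q (ix j).1 (ix j).2 - 2 * intH1_emp P J X n w (ix j).1 (ix j).2 -
      Mn P J X (Pi n l w) w (ix j).1 (ix j).2.
      rewrite /Rem; move: (Sig _) (Sig _) (intH1_emp _ _ _ _ _) (Mn _ _ _ _ _) => a b c' m.
      by rewrite !mxE.
    under eq_bigr do rewrite rE.
    rewrite !sumrB !mulrBr !dK.
    rewrite /lin_stat big_ord_recl /A unlift_none /stat_vec unlift_none.
    under eq_bigr do rewrite !liftK frobZl frobZr frob_delta.
    rewrite frobZl frobZr frob_delta -2!mulr_sumr mxE /S.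
    move: (intH1_emp _ _ _ _ _) => H; rewrite mxE [X in _ * X]mxE [X in _ * (X + _)]mxE.
    rewrite [X in _ * (_ + X)]mxE summxE.
    by ring.
  have hl : \forall n \near \oo, forall l, exists E, [/\ measurable E,
      [set w | e / Num.sqrt n%:R < mxnorm (Rem n l w)] `<=` E & fine (Pr E) <= eta / d%:R].
    by apply: filter_forall => l; apply: outerP_cvg0P => //; exact: expansion.
  near=> n.
  have n0 : (0 < n)%N by near: n; exact: nbhs_infty_gt.
  have s0 : 0 < Num.sqrt n%:R :> R by rewrite sqrtr_gt0 ltr0n.
  have : forall l, exists E, [/\ measurable E,
      [set w | e / Num.sqrt n%:R < mxnorm (Rem n l w)] `<=` E & fine (Pr E) <= eta / d%:R].
    by near: n; exact: hl.
  move=> /(@choice _ _ (fun l E => [/\ measurable E,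
      [set w | e / Num.sqrt n%:R < mxnorm (Rem n l w)] `<=` E & fine (Pr E) <= eta / d%:R])) [E hE].
  have [E' [mE' hE' pE']] := @prob_union_le _ _ _ Pr _ E (fun l => let: And3 h _ _ := hE l in h).
  exists E'; split => //; last first.
    apply: le_trans pE' _; apply: (@le_trans _ _ (\sum_(l < d) eta / d%:R)).
      by apply: ler_sum => l _; case: (hE l).
    by rewrite sumr_const card_ord -[leLHS]mulr_natl mulrC divfK.
  move=> w /= [j hj]; apply: contrapT => nE; move: hj; rewrite ltNge => /negP; apply.
  rewrite remE normrM (gtr0_norm s0) -ler_pdivlMl// [leRHS]mulrC normrM ger0_norm ?invr_ge0//.
  rewrite ler_pdivrMl ?ltr0n// mulr_natl; apply: le_trans (ler_norm_sum _ _ _) _.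
  rewrite -[X in _ *+ X]card_ord -sumr_const; apply: ler_sum => l _.
  apply: le_trans (mxnorm_entry _ _ _) _; rewrite leNgt; apply/negP => h.
  by apply: nE; apply: (hE' l); case: (hE l) => _ + _; exact.
- split; last by have [M fM] := bf; exists M => v; exact: fM.
  by move=> x; apply: (@continuous_comp _ _ _ io f); [exact: cio|exact: cf].
Unshelve. all: by end_near. Qed.

End Convergence.

Theorem theorem2 (R : realType) (q d : nat) (d0 : measure_display)
  (Om : measurableType d0) (Pr : probability Om R)
  (P : dist R q) (X : nat -> Om -> Vb R q)
  (Pi : forall n : nat, 'I_d -> Om -> {perm 'I_n})
  (F : set (dist R q)) (Sig : dist R q -> 'M[R]_q) (J : 'rV[R]_q -> 'M[R]_q) :
  (0 < d)%N ->
  is_prob P ->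
  sampling Pr P X Pi ->
  let Q := law Pr (fun w => (X 0%N w - X 1%N w : Vb R q)) in
  F Q ->
  setting P F Sig Q J ->
  (* expansion *)
  (forall l : 'I_d,
     o_p Pr (fun n w => Sig (Qhat X (Pi n l w) w) - Sig Q
                        - 2%:R *: intH1_emp P J X n w - Mn P J X (Pi n l w) w)
            (fun n => (Num.sqrt n%:R)^-1)) /\
  (* joint convergence in law *)
  (forall (d1 : measure_display) (Om' : measurableType d1) (Pr' : probability Om' R)
          (G : 'I_d.+1 -> Om' -> 'M[R]_q),
     indep_mx Pr' G ->
     gaussian_sym Pr' (G ord0)
       (fun A => fine (\int[Pr]_w ((frob A (H1 P J (X 0%N w))) ^+ 2)%:E)%E) ->
     (forall l : 'I_d, gaussian_sym Pr' (G (lift ord0 l))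
       (fun A => fine (\int[Pr]_w ((frob A (H2 P J (X 0%N w) (X 1%N w))) ^+ 2)%:E)%E)) ->
     cvg_law Pr (stat_vec P J X Pi) Pr'
       (fun w => (fun k => G k w) : {ptws 'I_d.+1 -> 'M[R]_q})) /\
  (* averaged estimator *)
  (forall (d1 : measure_display) (Om' : measurableType d1) (Pr' : probability Om' R)
          (G1 G2 : Om' -> 'M[R]_q),
     indep_mx Pr' (fun k : 'I_2 => if k == ord0 then G1 else G2) ->
     gaussian_sym Pr' G1
       (fun A => fine (\int[Pr]_w ((frob A (H1 P J (X 0%N w))) ^+ 2)%:E)%E) ->
     gaussian_sym Pr' G2
       (fun A => fine (\int[Pr]_w ((frob A (H2 P J (X 0%N w) (X 1%N w))) ^+ 2)%:E)%E) ->
     cvg_law Pr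
       (fun n w => Num.sqrt n%:R *:
          (d%:R^-1 *: (\sum_(l < d) Sig (Qhat X (Pi n l w) w)) - Sig Q))
       Pr' (fun w => 2%:R *: G1 w + (Num.sqrt d%:R)^-1 *: G2 w)).
Proof.
move=> dgt0 [P' hP] samp Q FQ setQ.
have {hP} PE : P = P' by apply/funext => B; rewrite hP.
subst P.
have [[mJ [bJ [eJ [sJ J0]]]] diffJ] := setting_Jprops setQ.
have [good [nbhdF goodQ]] := setting_nbhd samp FQ setQ.
have ex := sigma_expansion samp mJ bJ eJ J0 diffJ nbhdF goodQ.
split; first exact: ex.
split=> [d1 Om' Pr' G iG g1 g2|d1 Om' Pr' G1 G2 iG g1 g2].
  exact: (stat_vec_clt samp mJ bJ eJ sJ J0 iG g1 g2).
exact: (averaged_clt samp mJ bJ eJ sJ J0 ex dgt0 iG g1 g2).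
Qed.
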